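(* Let $G\in C^3(\mathbb{R})$ and $g(c):=G(c)-G'(c)c$. Let $T\in(0,\infty)$, let $\Gamma$ be a $C^1$-$C^2$-evolving immersed closed hypersurface with reference surface $M\subset\mathbb{R}^{d+1}$ on $[0,T]$, and let $c\in C^1([0,T],C^0(M))\cap C^0([0,T],C^2(M))$ be such that $(\Gamma,c)$ solves $$V=g(c)H,\qquad \partial^\square c=\Delta_\Gamma\big(G'(c)\big)+cHV .$$ Then there exists a constant $m\in\mathbb{R}$ such that $$\int_{\Gamma(t)}c(t)\,\mathrm{d}\mathcal{H}^d=m\qquad\text{for all }t\in[0,T].$$
   Context: Let $d\ge 1$. A $C^2$-embedded closed hypersurface $M\subset\mathbb{R}^{d+1}$ is a connected, compact, $d$-dimensional $C^2$-embedded submanifold without boundary admitting a continuous unit normal. A $C^1$-$C^2$-evolving immersed closed hypersurface $\Gamma$ with reference surface $M$ and global parameterization $\theta$ is given by $\theta\in C^1([0,T],C^0(M,\mathbb{R}^{d+1}))\cap C^0([0,T],C^2(M,\mathbb{R}^{d+1}))$ such that $\theta_t:=\theta(t,\cdot)$ is an immersion for every $t\in[0,T]$; one writes $\Gamma(t):=\theta_t(M)$. Locally $\theta_t$ is an embedding, and all functions on $\Gamma(t)$ are understood as functions of $(t,p)\in[0,T]\times M$ (pullback to $M$). The normal $\nu:[0,T]\times M\to\mathbb{R}^{d+1}$ is a continuous field with $\nu(t,\cdot)$ a unit normal to $\Gamma(t)$. The mean curvature is $H:=-\mathrm{div}_\Gamma\nu$. The total velocity is $V^{\mathrm{tot}}:=\partial_t\theta$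 and the normal velocity is $V:=V^{\mathrm{tot}}\cdot\nu$. The surface gradient $\nabla_\Gamma$, surface divergence $\mathrm{div}_\Gamma$ and Laplace-Beltrami operator $\Delta_\Gamma$ at time $t$ are those of the embedded patches of $\Gamma(t)$, pulled back to $M$ (with $\nabla_\Gamma f$ viewed as an $\mathbb{R}^{d+1}$-valued tangential field). The normal time derivative is $\partial^\square f:=\partial_t f-V^{\mathrm{tot}}\cdot\nabla_\Gamma f$. Integrals $\int_{\Gamma(t)}f\,\mathrm{d}\mathcal{H}^d$ are integrals over $M$ with respect to the area measure induced by the immersion $\theta_t$ (so counted with multiplicity). *)

(* Defs.v *)
From HB Require Import structures.
From mathcomp Require Import all_boot all_order all_algebra.
From mathcomp Require Import all_classical all_reals all_analysis.
From mathcomp Require Import sesquilinear.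

Set Implicit Arguments.
Unset Strict Implicit.
Unset Printing Implicit Defensive.

Import Order.TTheory GRing.Theory Num.Theory.
Import numFieldNormedType.Exports.

Local Open Scope ring_scope.
Local Open Scope classical_set_scope.

Section Regularity.
Context {R : realType}.

Definition Ck_real (k : nat) (G : R -> R) : Prop :=
  (forall i x, (i < k)%N -> derivable G^`(i) x 1) /\ continuous G^`(k).

Fixpoint Ck_on {V W : normedModType R} (k : nat) (U : set V) (F : V -> W)
    : Prop :=
  {within U, continuous F} /\
  if k is k'.+1 then
    (forall x, U x -> differentiable F x) /\
    (forall v, Ck_on k' U ('D_v F))
  else True.

(* F : I -> C^k(U) is continuous for the Frechet topology of C^k(U), i.e. for
   uniform convergence on the compact subsets of U of all derivatives of order
   at most k. *)
Fixpoint C0_Ck_on {V W : normedModType R} (k : nat) (I : set R) (U : set V)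
    (F : R -> V -> W) : Prop :=
  [/\ forall t, I t -> {within U, continuous (F t)},
      forall t, I t ->
        {family [set K | compact K /\ K `<=` U],
          F s @[s --> within I (nbhs t)] --> F t}
    & if k is k'.+1 then
        (forall t x, I t -> U x -> differentiable (F t) x) /\
        (forall v, C0_Ck_on k' I U (fun t => 'D_v (F t)))
      else True].

(* Time derivative on [0, T], one-sided at the end points. *)
Definition dtime (T : R) {X : Type} {W : normedModType R} (f : R -> X -> W)
    (t : R) (p : X) : W :=
  lim (h^-1 *: (f (t + h) p - f t p)
        @[h --> within [set h | 0 <= t + h <= T] 0^']).

(* C^1([0, T], C^0(M, W)), where C^0(M, W) carries the supremum norm. *)
Definition C1_C0 (T : R) {V W : normedModType R} (M : set V)
    (f : R -> V -> W) : Prop :=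
  forall t, 0 <= t <= T ->
  [/\ {within M, continuous (f t)},
      {uniform M, (fun h p => h^-1 *: (f (t + h) p - f t p))
        @ within [set h | 0 <= t + h <= T] 0^' --> dtime T f t},
      {within M, continuous (dtime T f t)}
    & {uniform M, dtime T f s @[s --> within `[0, T] (nbhs t)]
        --> dtime T f t}].

End Regularity.

Section Coordinates.
Context {R : realType}.

Definition dotv n (u v : 'rV[R]_n) : R := \sum_i u 0 i * v 0 i.

Variables (d : nat).
Local Notation E := 'rV[R]_d.+1.

(* In this section F : 'rV_d -> E is (the germ at x of) a parameterization of a
   piece of hypersurface, and the functions on that piece are given in the
   coordinates defined by F. *)
Definition metric (F : 'rV[R]_d -> E) (x : 'rV[R]_d) : 'M[R]_d :=
  \matrix_(i, j) dotv ('D_('e_i) F x) ('D_('e_j) F x).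

Definition area_density (F : 'rV[R]_d -> E) (x : 'rV[R]_d) : R :=
  Num.sqrt (\det (metric F x)).

Definition grad_coord (F : 'rV[R]_d -> E) (u : 'rV[R]_d -> R)
    (x : 'rV[R]_d) : E :=
  \sum_i \sum_j (invmx (metric F x) i j * 'D_('e_j) u x) *: 'D_('e_i) F x.

Definition div_coord (F : 'rV[R]_d -> E) (Y : 'rV[R]_d -> E)
    (x : 'rV[R]_d) : R :=
  \sum_i \sum_j
    invmx (metric F x) i j * dotv ('D_('e_i) Y x) ('D_('e_j) F x).

Definition immersion_on (U : set 'rV[R]_d) (F : 'rV[R]_d -> E) : Prop :=
  forall x, U x -> row_free ('J F x).

End Coordinates.

(* The integral over R^d, as an iterated one-dimensional Lebesgue integral.  It
   is only applied to continuous functions with compact support. *)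
Fixpoint rV_integral {R : realType} (d : nat) : ('rV[R]_d -> R) -> R :=
  match d with
  | 0 => fun f => f 0
  | d'.+1 => fun f =>
      \int[lebesgue_measure]_s
        rV_integral (fun y : 'rV[R]_d' =>
          f (row_mx (s%:M : 'rV[R]_1) y : 'rV[R]_(d'.+1)))
  end.

Section Hypersurface.
Context {R : realType} {d : nat}.
Local Notation E := 'rV[R]_d.+1.
Implicit Types (M : set E) (U : set 'rV[R]_d) (phi : 'rV[R]_d -> E).

(* phi is a C^2 immersion of the open set U and a homeomorphism onto a relatively
   open subset of M. *)
Definition local_param M U phi : Prop :=
  [/\ open U, Ck_on 2 U phi, immersion_on U phi,
      exists2 A : set E, open A & phi @` U = M `&` A
    & exists2 psi : E -> 'rV[R]_d,
        {within phi @` U, continuous psi} & forall x, U x -> psi (phi x) = x].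

Definition unit_normal M (th : E -> E) (n : E -> E) : Prop :=
  (forall p, M p -> dotv (n p) (n p) = 1) /\
  (forall U phi, local_param M U phi ->
    forall x v, U x -> dotv (n (phi x)) ('D_v (th \o phi) x) = 0).

Definition closed_C2_hypersurface M : Prop :=
  [/\ connected M, compact M,
      forall p, M p -> exists U phi, local_param M U phi /\ (phi @` U) p
    & exists n : E -> E, {within M, continuous n} /\ unit_normal M id n].

(* C^0([0, T], C^2(M, W)): by compactness of M, the norm topology of C^2(M, W) is
   the one of compact convergence, in all local parameterizations, of the
   derivatives of order at most 2. *)
Definition C0_C2 (T : R) {W : normedModType R} M (f : R -> E -> W) : Prop :=
  forall U phi, local_param M U phi ->
    C0_Ck_on 2 `[0, T] U (fun t => f t \o phi).

Definition evolving_hypersurface (T : R) M (th : R -> E -> E) : Prop :=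
  [/\ C1_C0 T M th, C0_C2 T M th
    & forall t, 0 <= t <= T -> forall U phi, local_param M U phi ->
        immersion_on U (th t \o phi)].

Definition normal_field (T : R) M (th : R -> E -> E) (nu : R -> E -> E)
    : Prop :=
  {within `[0, T]%classic `*` M, continuous (fun z : R * E => nu z.1 z.2)} /\
  (forall t, 0 <= t <= T -> unit_normal M (th t) (nu t)).

(* A local parameterization around p, with the coordinates of p.  The surface
   operators below do not depend on the one chosen. *)
Definition local_coord M (p : E) : ('rV[R]_d -> E) * 'rV[R]_d :=
  get [set k | exists U, [/\ local_param M U k.1, U k.2 & k.1 k.2 = p]].

(* The surface operators of the immersed hypersurface th(M), pulled back to M. *)
Definition surface_grad M (th : E -> E) (f : E -> R) (p : E) : E :=
  let k := local_coord M p in grad_coord (th \o k.1) (f \o k.1) k.2.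

Definition surface_div M (th : E -> E) (Y : E -> E) (p : E) : R :=
  let k := local_coord M p in div_coord (th \o k.1) (Y \o k.1) k.2.

Definition laplace_beltrami M (th : E -> E) (f : E -> R) : E -> R :=
  surface_div M th (surface_grad M th f).

Definition mean_curvature M (th : R -> E -> E) (nu : R -> E -> E)
    (t : R) (p : E) : R :=
  - surface_div M (th t) (nu t) p.

Definition total_velocity (T : R) (th : R -> E -> E) : R -> E -> E :=
  dtime T th.

Definition normal_velocity (T : R) (th : R -> E -> E) (nu : R -> E -> E)
    (t : R) (p : E) : R :=
  dotv (total_velocity T th t p) (nu t p).

Definition normal_dtime (T : R) M (th : R -> E -> E) (f : R -> E -> R)
    (t : R) (p : E) : R :=
  dtime T f t p - dotv (total_velocity T th t p) (surface_grad M (th t) (f t) p).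

(* P = (n, (i |-> (U_i, phi_i, chi_i))), of which only the indices i < n matter:
   chi_0, ..., chi_(n-1) is a C^2 partition of unity on M subordinate to the
   parameterized pieces phi_i(U_i). *)
Definition partition_of_unity M
    (P : nat * (nat -> set 'rV[R]_d * ('rV[R]_d -> E) * (E -> R))) : Prop :=
  (forall i, (i < P.1)%N -> let: (U, phi, chi) := P.2 i in
    [/\ local_param M U phi,
        forall U' phi', local_param M U' phi' -> Ck_on 2 U' (chi \o phi'),
        forall p, M p -> 0 <= chi p
      & exists K, [/\ compact K, K `<=` U &
          forall p, M p -> chi p != 0 -> (phi @` K) p]]) /\
  (forall p, M p -> \sum_(i < P.1) (P.2 i).2 p = 1).

(* The integral of f over M for the area measure induced by the immersion th,
   glued with a partition of unity.  It does not depend on the partition, which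
   is chosen as a function of M alone, and exists when M is a closed C^2
   hypersurface. *)
Definition surface_integral M (th : E -> E) (f : E -> R) : R :=
  let P := get (partition_of_unity M) in
  \sum_(i < P.1) let: (U, phi, chi) := P.2 i in
    rV_integral (fun x => \1_U x *
      (chi (phi x) * f (phi x) * area_density (th \o phi) x)).

End Hypersurface.

(* Main.v *)
Require Import Defs.
From mathcomp Require Import all_boot all_order all_algebra.
From mathcomp Require Import all_classical all_reals all_analysis.
From mathcomp Require Import ring lra.
Import Order.TTheory GRing.Theory Num.Theory.
Import numFieldNormedType.Exports.
Local Open Scope ring_scope.
Local Open Scope classical_set_scope.
Set Implicit Arguments.
Unset Strict Implicit.
Unset Printing Implicit Defensive.

(* On a chart write F_h = theta_(t+h) o phi and P = DF_0, and let
   Z = sqrt (det g) g^-1 P be the derivative of the area density with respect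
   to P. Since theta is differentiable in time only as a continuous function
   of the point, the difference quotient q_h = (F_h - F_0)/h has no bounded
   space derivatives; the increment of the area density is written
   algebraically as (DF_h - DF_0) : Z_h, integrated by parts, and only then
   divided by h. The limit involves div Z = sqrt (det g) H nu, and with the
   equation for c the derivative at t of the integral of chi c over a chart is
   - int grad chi . (grad G'(c) + c V^tot). Summed over a partition of unity
   this vanishes, because the sum of the grad chi_i is 0 and the pieces can be
   moved to a common chart by the change of variables formula. *)

(** * Integration of continuous functions with compact support *)

(** [rV_integral] is an iterated one-dimensional integral, so its theory is built for continuous
    functions of bounded support: one-dimensional integrals are increments of primitives, and limits
    pass through by uniform convergence with a common support radius. The increment of the area
    density has to be an exact identity: a Taylor expansion would leave a remainder quadratic in
    DF_h - DF_0, which is not known to be o(h). In the exact form the factor Z_h is C^1 in space and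
    continuous up to h = 0, so all derivatives can be put on it while h is still nonzero. The change
    of area contributes the opposite of the term c H V of the equation, so that only the flux of
    grad G'(c) and the transport along V^tot remain, both paired with grad chi. Two regularities are
    not given and must be recovered: nu is only continuous, and it inherits differentiability from
    the tangent vectors; transition maps are only homeomorphisms, and the relation phi2 o tau = phi1
    makes them strictly differentiable. The substitution rule is proved for such maps by
    mollification, with linear substitutions as local model. *)

Section Supp.
Context {R : realType}.

Definition supp_in {V : normedModType R} (N : R) (f : V -> R) :=
  forall x, N < `|x| -> f x = 0.

(** The support is only asked to be bounded, which makes sense in any normed space, products
    included; on ['rV_d] this is compact support. A numerical radius is easily shared by a whole
    family of functions. *)
Definition Cc {V : normedModType R} (f : V -> R) :=
  continuous f /\ exists N, supp_in N f.

Lemma supp_inW {V : normedModType R} (N N' : R) (f : V -> R) :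
  N <= N' -> supp_in N f -> supp_in N' f.
Proof. by move=> NN' fN x Nx; apply: fN; exact: le_lt_trans Nx. Qed.

Lemma supp_in_pos {V : normedModType R} (f : V -> R) :
  (exists N, supp_in N f) -> exists2 N, 0 < N & supp_in N f.
Proof.
move=> [N fN]; exists (`|N| + 1); first by rewrite ltr_wpDl.
by apply: supp_inW fN; rewrite (le_trans (ler_norm N))// lerDl.
Qed.

Lemma continuousD_fun {T : topologicalType} (f g : T -> R) :
  continuous f -> continuous g -> continuous (fun x => f x + g x).
Proof. by move=> cf cg x; apply: cvgD; [exact: cf|exact: cg]. Qed.

Lemma continuousM_fun {T : topologicalType} (f g : T -> R) :
  continuous f -> continuous g -> continuous (fun x => f x * g x).
Proof. by move=> cf cg x; apply: cvgM; [exact: cf|exact: cg]. Qed.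

Lemma CcD {V : normedModType R} (f g : V -> R) :
  Cc f -> Cc g -> Cc (fun x => f x + g x).
Proof.
move=> [cf [N fN]] [cg [N' gN]]; split; first exact: continuousD_fun.
exists (Num.max N N') => x; rewrite gt_max => /andP[Nx N'x].
by rewrite fN// gN// addr0.
Qed.

Lemma CcMr {V : normedModType R} (f g : V -> R) :
  Cc f -> continuous g -> Cc (fun x => g x * f x).
Proof.
move=> [cf [N fN]] cg; split; first exact: continuousM_fun.
by exists N => x Nx; rewrite fN// mulr0.
Qed.

Lemma CcZ {V : normedModType R} (f : V -> R) (a : R) :
  Cc f -> Cc (fun x => a * f x).
Proof. by move=> cf; apply: CcMr => // x; exact: cvg_cst. Qed.

Lemma CcB {V : normedModType R} (f g : V -> R) :
  Cc f -> Cc g -> Cc (fun x => f x - g x).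
Proof.
move=> cf cg; have := CcD cf (CcZ (-1) cg).
by under eq_fun do rewrite mulN1r.
Qed.

End Supp.

(** * One-dimensional integrals as increments of primitives *)

Section OneDim.
Context {R : realType}.
Notation mu := (@lebesgue_measure R).
Implicit Types (f g : R -> R).

Lemma is_derive_continuous (F f : R -> R) :
  (forall x : R, is_derive x (1 : R) F (f x)) -> continuous F.
Proof.
by move=> dF x; apply: differentiable_continuous; apply/derivable1_diffP; apply: (@ex_derive _ _ _ _ _ _ _ (dF x)).
Qed.

Lemma MVT_norm (F f : R -> R) (a b e : R) :
  (forall x : R, is_derive x (1 : R) F (f x)) ->
  (forall x, `|x - a| <= `|b - a| -> `|f x| <= e) ->
  `|F b - F a| <= e * `|b - a|.
Proof.
move=> dF.
have cF := continuous_subspaceT (is_derive_continuous dF).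
move=> fe; have [ab|/ltW ba] := leP a b; last first.
  rewrite distrC (distrC b); have [c cab ->] := MVT_segment ba (fun x _ => dF x) (cF _).
  rewrite normrM ler_wpM2r// fe//; move: cab; rewrite in_itv/= => /andP[ac cb].
  by rewrite !ler0_norm ?subr_le0//; lra.
have [c cab ->] := MVT_segment ab (fun x _ => dF x) (cF _).
rewrite normrM ler_wpM2r// fe//; move: cab; rewrite in_itv/= => /andP[ac cb].
by rewrite !ger0_norm ?subr_ge0//; lra.
Qed.

Lemma Cc_integrable f : Cc f -> mu.-integrable setT (EFin \o f).
Proof.
move=> [cf [N fN]].
have mN : measurable `[- N, N]%classic by exact: measurable_itv.
have h : mu.-integrable (setT `&` `[- N, N]%classic) (EFin \o f).
  rewrite setTI; apply: continuous_compact_integrable; first exact: segment_compact.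
  exact: continuous_subspaceT.
have := (integrable_restrict mu mN measurableT _).1 h.
congr (mu.-integrable _ _); apply/funext => x; rewrite patchE; case: ifPn => // /negP xN.
rewrite /= fN// ltNge; apply/negP => xN'; apply: xN; apply/mem_set => /=.
by rewrite in_itv/= -ler_norml.
Qed.

(** The primitive is the integral over ]-oo, x]: it is 0 to the left of the support and the full
    integral to its right. From here on one-dimensional integrals can be handled by comparing
    antiderivatives. *)
Lemma Cc_primitive f : Cc f -> exists F : R -> R,
  (forall x : R, is_derive x (1 : R) F (f x)) /\
  (forall N x, supp_in N f -> (x < - N -> F x = 0) /\ (N < x -> F x = \int[mu]_s f s)).
Proof.
move=> cf; exists (fun x => \int[mu]_(t in `]-oo, x]) f t); split => [x|N x fN].
  have fi : mu.-integrable `]-oo, (x + 1)] (EFin \o f).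
    by apply: integrableS (Cc_integrable cf) => //; exact: measurableT.
  have xx1 : x < x + 1 by rewrite ltrDl.
  have [dF fE] := continuous_FTC1 xx1 fi (ltNyr _) (cf.1 x).
  by split; [exact: dF|rewrite -derive1E].
split=> xN.
  rewrite Rintegral_mkcond (_ : _ \_ _ = cst 0); last first.
    apply/funext => t; rewrite patchE; case: ifPn => // /set_mem /=; rewrite in_itv/= => tx.
    by apply: fN; rewrite ltr_normr; apply/orP; right; lra.
  by rewrite Rintegral_cst// mul0r.
rewrite Rintegral_mkcond; congr Rintegral.
apply/funext => t; rewrite patchE; case: ifPn => // /negP tx.
apply/esym/fN; rewrite ltr_normr; apply/orP; left.
rewrite (lt_trans xN)// ltNge; apply/negP => tx'; apply: tx; apply/mem_set => /=.
by rewrite in_itv.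
Qed.

Lemma primitive_eq (F G f : R -> R) (a b : R) :
  (forall x : R, is_derive x (1 : R) F (f x)) ->
  (forall x : R, is_derive x (1 : R) G (f x)) -> F b - F a = G b - G a.
Proof.
move=> dF dG.
have h (x : R) : is_derive x (1 : R) (F - G) 0.
  by apply: is_derive_eq (subrr (f x)).
by have := is_derive_0_is_cst a b h; rewrite /= !fctE; lra.
Qed.

Lemma Cc_integralE f F N a : Cc f -> supp_in N f -> N < a ->
  (forall x : R, is_derive x (1 : R) F (f x)) ->
  \int[mu]_s f s = F a - F (- a).
Proof.
move=> cf fN Na dF; have [G [dG GE]] := Cc_primitive cf.
rewrite -(primitive_eq (- a) a dG dF) (GE _ a fN).2// (GE _ (- a) fN).1 ?subr0//.
by rewrite ltrN2.
Qed.

Lemma I1_le f N e : Cc f -> 0 < N -> supp_in N f -> 0 <= e ->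
  (forall x, `|f x| <= e) -> `|\int[mu]_s f s| <= e * (4 * N).
Proof.
move=> cf N0 fN e0 fe; have [F [dF _]] := Cc_primitive cf.
(* The support lies strictly inside [-2N, 2N], whose length is the factor 4N of the bound. *)
rewrite (Cc_integralE (a := 2 * N) cf fN _ dF); last lra.
apply: le_trans (MVT_norm dF (fun x _ => fe x)) _.
rewrite ler_wpM2l// ger0_norm; lra.
Qed.

Lemma I1D f g : Cc f -> Cc g ->
  \int[mu]_s (f s + g s) = \int[mu]_s f s + \int[mu]_s g s.
Proof. by move=> cf cg; rewrite RintegralD//; exact: Cc_integrable. Qed.

Lemma I1Z f (a : R) : Cc f -> \int[mu]_s (a * f s) = a * \int[mu]_s f s.
Proof. by move=> cf; rewrite RintegralZl//; exact: Cc_integrable. Qed.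

Lemma Cc_affine1 f (a b : R) : a != 0 -> Cc f -> Cc (fun s : R => f (a * s + b)).
Proof.
move=> a0 [cf [N fN]]; split.
  move=> x; apply: (@continuous_comp _ _ _ (fun s : R => a * s + b) f); last exact: cf.
  by apply: cvgD; [apply: cvgMr; exact: cvg_id|exact: cvg_cst].
exists (`|a|^-1 * (`|N| + `|b|)) => x Nx; apply: fN.
have a0' : 0 < `|a| by rewrite normr_gt0.
have : `|N| + `|b| < `|a * x| by rewrite normrM -ltr_pdivrMl.
rewrite -ltrBrDr => h; apply: le_lt_trans (ler_norm N) _; apply: lt_le_trans h _.
by have := lerB_normD (a * x) b; lra.
Qed.

(** If F is a primitive of f, then a^-1 F (a s + b) is one of the substituted function, so both
    integrals are the same increment of F. The sign of a decides which end of the interval lands to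
    the right of the support, whence the absolute value. *)
Lemma I1_affine f (a b : R) : a != 0 -> Cc f ->
  `|a| * \int[mu]_s f (a * s + b) = \int[mu]_s f s.
Proof.
move=> a0 cf; have cfa := Cc_affine1 b a0 cf.
have [F [dF FE]] := Cc_primitive cf.
have dG (x : R) : is_derive x (1 : R) (fun s => a^-1 * F (a * s + b)) (f (a * x + b)).
  have d1 : is_derive x (1 : R) (fun s : R => a * s + b) a.
    apply: is_derive_eq; rewrite /GRing.scale/=; ring.
  have := is_derive1_comp (dF _) d1 => d2.
  by apply: is_derive_eq; rewrite /GRing.scale/= mulrCA mulVf// mulr1.
have [N N0 fN] := supp_in_pos cf.2.
have [M M0 fM] := supp_in_pos cfa.2.
(* The first entry puts [c] beyond the support of the substituted function; the second makes |a| c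
   exceed N + |b|, so that a c + b and - a c + b lie beyond the support of f on opposite sides. *)
set c := Num.max (M + 1) (`|a|^-1 * (N + `|b| + 1)).
have Mc : M < c by rewrite lt_max; apply/orP; left; lra.
have a0' : 0 < `|a| by rewrite normr_gt0.
have Nc : N + `|b| < `|a| * c.
  rewrite -ltr_pdivrMl// lt_max; apply/orP; right.
  by rewrite ltr_pM2l ?invr_gt0//; lra.
rewrite (Cc_integralE cfa fM Mc dG).
have bb := ler_norm b; have bb' := ler_norm (- b); rewrite normrN in bb'.
have [ap|an] := ltP 0 a.
  rewrite (gtr0_norm ap) in Nc *.
  rewrite (FE _ (a * c + b) fN).2; last lra.
  rewrite (FE _ (a * - c + b) fN).1; last lra.
  by rewrite mulr0 subr0 mulrA mulfV// mul1r.
have {}an : a < 0 by rewrite lt_neqAle a0.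
rewrite (ltr0_norm an) in Nc *.
rewrite (FE _ (a * - c + b) fN).2; last lra.
rewrite (FE _ (a * c + b) fN).1; last lra.
by rewrite mulr0 sub0r mulrN mulNr opprK mulrA mulfV// mul1r.
Qed.

(** A primitive is nondecreasing. If the integral were 0, it would be constant on [-(N+1), N+1],
    which contains x0 in its interior, and its derivative f x0 would vanish. *)
Lemma I1_gt0 f x0 : Cc f -> (forall x, 0 <= f x) -> 0 < f x0 ->
  0 < \int[mu]_s f s.
Proof.
move=> cf f0 fx0; have [F [dF FE]] := Cc_primitive cf.
have [N N0 fN] := supp_in_pos cf.2.
have x0N : `|x0| <= N by rewrite leNgt; apply/negP => /fN h; rewrite h ltxx in fx0.
have FI x y : x <= y -> F x <= F y.
  move=> xy; have [c _ h] := MVT_segment xy (fun x _ => dF x) (continuous_subspaceT (is_derive_continuous dF)).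
  by rewrite -subr_ge0 h mulr_ge0// subr_ge0.
rewrite (Cc_integralE (a := N + 1) cf fN _ dF); last lra.
rewrite subr_gt0 lt_neqAle FI ?andbT; last lra.
apply/negP => /eqP h.
have Fc y : - (N + 1) <= y -> y <= N + 1 -> F y = F (N + 1).
  by move=> y1 y2; apply/eqP; rewrite eq_le FI// -h FI.
have : is_derive x0 (1 : R) F 0.
  have : {near x0, cst (F (N + 1)) =1 F}.
    move: x0N; rewrite ler_norml => /andP[x1 x2].
    near=> y; rewrite Fc//; near: y.
      by apply: (cvgr_ge x0); [exact: cvg_id|lra].
    by apply: (cvgr_le x0); [exact: cvg_id|lra].
  move=> h'; apply: (near_eq_is_derive h').
move=> [_ /esym]; have [_ ->] := dF x0 => h'.
by rewrite -h' ltxx in fx0.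
Unshelve. all: by end_near. Qed.

End OneDim.

(** * Coordinates of row vectors and basic properties of the iterated integral *)

Section RowVec.
Context {R : realType}.
Notation mu := (@lebesgue_measure R).

(** The same [row_mx] by which [rV_integral] splits off the first coordinate, so that the two unify
    by conversion. *)
Definition consv {d} (s : R) (y : 'rV[R]_d) : 'rV[R]_d.+1 :=
  row_mx (s%:M : 'rV[R]_1) y.

Lemma rV_norm_ler {d} (x : 'rV[R]_d) (e : R) :
  0 <= e -> (`|x| <= e) <-> (forall i, `|x 0 i| <= e).
Proof.
move=> e0; rewrite {1}/Num.Def.normr/= mx_normrE; split.
  by move=> /bigmax_leP[_ h] i; apply: (h (0, i)).
by move=> h; apply/bigmax_leP; split => // -[i j] _ /=; rewrite ord1.
Qed.

Lemma rV_norm_ge {d} (x : 'rV[R]_d) i : `|x 0 i| <= `|x|.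
Proof. by apply: (rV_norm_ler x (normr_ge0 x)).1. Qed.

Lemma consvE0 {d} s (y : 'rV[R]_d) : consv s y 0 ord0 = s.
Proof.
have h : row_mx (s%:M : 'rV[R]_1) y 0 (lshift d 0) = s by rewrite row_mxEl mxE mulr1n.
by rewrite -[RHS]h; congr (row_mx _ _ _ _); apply/val_inj.
Qed.

Lemma consvES {d} s (y : 'rV[R]_d) i : consv s y 0 (lift ord0 i) = y 0 i.
Proof.
rewrite -(row_mxEr (s%:M : 'rV[R]_1) y 0 i).
by congr (row_mx _ _ _ _); apply/val_inj.
Qed.

Lemma consv_eta {d} (x : 'rV[R]_d.+1) :
  x = consv (x 0 ord0) (\row_i x 0 (lift ord0 i)).
Proof.
apply/rowP => i; case: (unliftP ord0 i) => [j|] ->; last by rewrite consvE0.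
by rewrite consvES mxE.
Qed.

Lemma consv_norm_le {d} s (y : 'rV[R]_d) e :
  0 <= e -> `|s| <= e -> `|y| <= e -> `|consv s y| <= e.
Proof.
move=> e0 se ye; apply/rV_norm_ler => // i.
case: (unliftP ord0 i) => [j|] ->; last by rewrite consvE0.
by rewrite consvES; apply: le_trans ye; exact: rV_norm_ge.
Qed.

Lemma consv_ge_l {d} s (y : 'rV[R]_d) : `|s| <= `|consv s y|.
Proof. by rewrite -{1}(consvE0 s y); exact: rV_norm_ge. Qed.

Lemma consv_ge_r {d} s (y : 'rV[R]_d) : `|y| <= `|consv s y|.
Proof. by apply/rV_norm_ler => // i; rewrite -(consvES s y i); exact: rV_norm_ge. Qed.

Lemma consvD {d} s s' (y y' : 'rV[R]_d) :
  consv s y + consv s' y' = consv (s + s') (y + y').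
Proof.
apply/rowP => i; rewrite mxE; case: (unliftP ord0 i) => [j|] ->.
  by rewrite !consvES mxE.
by rewrite !consvE0.
Qed.

Lemma consvN {d} s (y : 'rV[R]_d) : - consv s y = consv (- s) (- y).
Proof.
apply/rowP => i; rewrite mxE; case: (unliftP ord0 i) => [j|] ->.
  by rewrite !consvES mxE.
by rewrite !consvE0.
Qed.

Lemma consvB {d} s s' (y y' : 'rV[R]_d) :
  consv s y - consv s' y' = consv (s - s') (y - y').
Proof. by rewrite consvN consvD. Qed.

Lemma consv_cvg {d} {I} {F : set_system I} {FF : Filter F}
    (f : I -> R) (g : I -> 'rV[R]_d) a b :
  f @ F --> a -> g @ F --> b -> (fun i => consv (f i) (g i)) @ F --> consv a b.
Proof.
move=> /cvgrPdist_le fa /cvgrPdist_le gb; apply/cvgrPdist_le => e e0.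
near=> i; rewrite consvB; apply: consv_norm_le; first exact: ltW.
  by near: i; exact: fa.
by near: i; exact: gb.
Unshelve. all: by end_near. Qed.

Lemma consv_continuousr {d} s : continuous (@consv d s).
Proof.
move=> y.
have h1 : (fun=> s) @ nbhs y --> s by exact: cvg_cst.
have h2 : id @ nbhs y --> y by exact: cvg_id.
exact: (consv_cvg h1 h2).
Qed.

Lemma closed_ball_compact {d} N : compact [set x : 'rV[R]_d | `|x| <= N].
Proof.
apply: bounded_closed_compact.
  by exists N; split; [exact: num_real|] => M NM x /= xN; apply: le_trans xN _; exact: ltW.
have -> : [set x : 'rV[R]_d | `|x| <= N] = (fun x : 'rV[R]_d => `|x|) @^-1` [set y | y <= N] by [].
by apply: closed_comp => // x _; exact: norm_continuous.
Qed.

(** Joint convergence at every point of a compact ball, compared with the continuity of the limit,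
    is uniform by the covering form of compactness; outside the ball both functions vanish. *)
Lemma supp_in_uniform {V : normedModType R} {I} (F : set_system I) {FF : Filter F} N
    (f : I -> V -> R) (f0 : V -> R) :
  compact [set x : V | `|x| <= N] ->
  (\forall i \near F, supp_in N (f i)) -> supp_in N f0 -> continuous f0 ->
  (forall x, `|x| <= N -> f i.2 i.1 @[i --> filter_prod (nbhs x) F] --> f0 x) ->
  forall e, 0 < e -> \forall i \near F, forall x, `|f i x - f0 x| <= e.
Proof.
move=> /compact_near_coveringP cN fN f0N cf0 h e e0.
have : \forall i \near F, [set x : V | `|x| <= N] `<=` (fun x => `|f i x - f0 x| <= e).
  apply: cN => x xN.
  have e20 : 0 < e / 2 by rewrite divr_gt0.
  have /cvgrPdist_le /(_ _ e20) h1 := h x xN.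
  have /cvgrPdist_le /(_ _ e20) h2 := cf0 x.
  have h2' : \forall i \near filter_prod (nbhs x) F, `|f0 x - f0 i.1| <= e / 2.
    by exists ([set y | `|f0 x - f0 y| <= e / 2], setT) => //= [|[y i] []//]; split => //; exact: filterT.
  near=> i; have : `|f0 x - f i.2 i.1| <= e / 2 by near: i.
  have : `|f0 x - f0 i.1| <= e / 2 by near: i.
  move=> k1 k2; rewrite (_ : f i.2 i.1 - f0 i.1 = (f0 x - f0 i.1) - (f0 x - f i.2 i.1)); last ring.
  by rewrite (le_trans (ler_normB _ _))// (splitr e) lerD.
move=> hN; near=> i => x; have [xN|xN] := leP `|x| N.
  by move: x xN; near: i.
rewrite f0N// (near fN i _)//; first by rewrite subrr normr0 ltW.
Unshelve. all: by end_near. Qed.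

Notation rVI := rV_integral.

Definition rVI_good d := [/\ 
   forall f g : 'rV[R]_d -> R, Cc f -> Cc g -> rVI (fun x => f x + g x) = rVI f + rVI g,
   forall (f : 'rV[R]_d -> R) a, Cc f -> rVI (fun x => a * f x) = a * rVI f &
   forall N, exists C, 0 <= C /\ forall e (f : 'rV[R]_d -> R), Cc f -> supp_in N f -> 0 <= e ->
     (forall x, `|f x| <= e) -> `|rVI f| <= e * C].

(** Uniform convergence combined with the bound of [rVI_good]. That property is a premise because
    this limit theorem is used inside the induction establishing it. *)
Lemma rVI_good_cvg d {I} (F : set_system I) {FF : Filter F} N
    (f : I -> 'rV[R]_d -> R) (f0 : 'rV[R]_d -> R) :
  rVI_good d ->
  (\forall i \near F, continuous (f i) /\ supp_in N (f i)) -> continuous f0 -> supp_in N f0 -> 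
  (forall x, `|x| <= N -> f i.2 i.1 @[i --> filter_prod (nbhs x) F] --> f0 x) ->
  rVI (f i) @[i --> F] --> rVI f0.
Proof.
move=> [hD hZ /(_ N) [C [C0 hC]]] fN cf0 f0N h.
apply/cvgrPdist_le => e e0.
have C1 : 0 < C + 1 by rewrite ltr_wpDl.
have fN' : \forall i \near F, supp_in N (f i) by apply: filterS fN => i [].
have e' : 0 < e / (C + 1) by rewrite divr_gt0.
have h' := supp_in_uniform (@closed_ball_compact d N) fN' f0N cf0 h e'; have {}h' := h' FF.
near=> i.
have [ci Ni] : continuous (f i) /\ supp_in N (f i) by near: i.
have Cci : Cc (f i) by split => //; exists N.
have Cc0 : Cc f0 by split => //; exists N.
have -> : rVI f0 - rVI (f i) = rVI (fun x => f0 x - f i x).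
  rewrite -mulN1r -hZ// -hD//; last exact: CcZ.
  by congr rVI; apply/funext => x; rewrite mulN1r.
have : `|rVI (fun x => f0 x - f i x)| <= e / (C + 1) * C.
  apply: hC; [exact: CcB| |exact: ltW|].
    by move=> x Nx; rewrite f0N// Ni// subrr.
  by move=> x; rewrite distrC; move: x; near: i.
move=> /le_trans; apply.
rewrite -mulrA ler_piMr//; first exact: ltW.
by rewrite mulrC ler_pdivrMr// mul1r lerDl.
Unshelve. all: by end_near. Qed.

Lemma Cc_slice d (f : 'rV[R]_d.+1 -> R) s : Cc f -> Cc (fun y => f (consv s y)).
Proof.
move=> [cf [N fN]]; split.
  by move=> y; apply: continuous_comp; [exact: consv_continuousr|exact: cf].
by exists N => y Ny; apply: fN; apply: lt_le_trans Ny _; exact: consv_ge_r.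
Qed.

Lemma Cc_good_slice d (f : 'rV[R]_d.+1 -> R) : rVI_good d -> Cc f ->
  Cc (fun s => rVI (fun y => f (consv s y))).
Proof.
move=> gd [cf [N fN]]; split; last first.
  exists N => s Ns; rewrite (_ : (fun y => _) = fun y => 0 * f (consv s y)).
    by case: gd => _ -> //; rewrite ?mul0r//; apply: Cc_slice; split => //; exists N.
  by apply/funext => y; rewrite mul0r fN//; apply: lt_le_trans Ns _; exact: consv_ge_l.
move=> s; apply: (@rVI_good_cvg d _ _ _ N) => //.
- apply: nearW => t; split; first by apply: (Cc_slice _ _).1; split => //; exists N.
  by move=> y Ny; apply: fN; apply: lt_le_trans Ny _; exact: consv_ge_r.
- by apply: (Cc_slice _ _).1; split => //; exists N.
- by move=> y Ny; apply: fN; apply: lt_le_trans Ny _; exact: consv_ge_r.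
move=> y _; apply: (@cvg_comp _ _ _ (fun i : 'rV[R]_d * R => consv i.2 i.1) f _ (nbhs (consv s y))); last exact: cf.
by apply: consv_cvg; [exact: cvg_snd|exact: cvg_fst].
Qed.

Lemma rVI_goodP d : rVI_good d.
Proof.
elim: d => [|d gd].
  split => //= N; exists 1; split => // e f _ _ e0 fe; rewrite mulr1; exact: fe.
have [hD hZ hC] := gd; split => /=.
- move=> f g cf cg; rewrite -I1D; try exact: Cc_good_slice.
  congr Rintegral; apply/funext => s.
  by rewrite hD//; exact: Cc_slice.
- move=> f a cf; rewrite -I1Z; last exact: Cc_good_slice.
  by congr Rintegral; apply/funext => s; rewrite hZ//; exact: Cc_slice.
move=> N; have [C [C0 hC']] := hC N.
have N0 : 0 < `|N| + 1 by rewrite ltr_wpDl.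
exists (C * (4 * (`|N| + 1))); split; first by rewrite mulr_ge0// mulr_ge0// ltW.
move=> e f cf fN e0 fe; rewrite mulrA; apply: I1_le => //.
- exact: Cc_good_slice.
- move=> s Ns; rewrite (_ : (fun y => _) = fun y => 0 * f (consv s y)).
    by rewrite hZ ?mul0r//; exact: Cc_slice.
  apply/funext => y; rewrite mul0r fN//; apply: lt_le_trans (consv_ge_l _ _).
  by apply: le_lt_trans Ns; rewrite (le_trans (ler_norm N))// lerDl.
- exact: mulr_ge0.
move=> s; apply: hC' => //; first exact: Cc_slice.
by move=> y Ny; apply: fN; apply: lt_le_trans Ny _; exact: consv_ge_r.
Qed.

End RowVec.

(** * Linearity, parameters and Fubini in the plane *)

Section Fubini.
Context {R : realType}.
Notation mu := (@lebesgue_measure R).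
Notation rVI := rV_integral.

Lemma rVID {d} (f g : 'rV[R]_d -> R) :
  Cc f -> Cc g -> rVI (fun x => f x + g x) = rVI f + rVI g.
Proof. by case: (@rVI_goodP R d) => h _ _; exact: h. Qed.

Lemma rVIZ {d} (f : 'rV[R]_d -> R) a : Cc f -> rVI (fun x => a * f x) = a * rVI f.
Proof. by case: (@rVI_goodP R d) => _ h _; exact: h. Qed.

Lemma rVIB {d} (f g : 'rV[R]_d -> R) :
  Cc f -> Cc g -> rVI (fun x => f x - g x) = rVI f - rVI g.
Proof.
move=> cf cg; rewrite -mulN1r -rVIZ// -rVID//; last exact: CcZ.
by congr rVI; apply/funext => x; rewrite mulN1r.
Qed.

Lemma Cc_intB (f g : R -> R) : Cc f -> Cc g ->
  \int[mu]_s (f s - g s) = \int[mu]_s f s - \int[mu]_s g s.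
Proof. by move=> cf cg; rewrite RintegralB//; exact: Cc_integrable. Qed.

Lemma Cc0 {V : normedModType R} : Cc ((fun=> 0) : V -> R).
Proof. by split; [move=> x; exact: cvg_cst|exists 0]. Qed.

Lemma rVI0 {d} : rVI ((fun=> 0) : 'rV[R]_d -> R) = 0.
Proof.
rewrite -[RHS](mul0r (rVI ((fun=> 0) : 'rV[R]_d -> R))) -(rVIZ 0 (Cc0 (V := 'rV[R]_d))).
by congr rVI; apply/funext => x; rewrite mul0r.
Qed.

Lemma Cc_sum {V : normedModType R} {I : Type} (r : seq I) (P : pred I) (f : I -> V -> R) :
  (forall i, P i -> Cc (f i)) -> Cc (fun x => \sum_(i <- r | P i) f i x).
Proof.
move=> cf; elim: r => [|i r IH].
  by rewrite (_ : (fun x => _) = fun=> 0); [exact: Cc0|apply/funext => x; rewrite big_nil].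
have [Pi|Pi] := boolP (P i).
  rewrite (_ : (fun x => _) = fun x => f i x + \sum_(i <- r | P i) f i x); last first.
    by apply/funext => x; rewrite big_cons Pi.
  by apply: CcD => //; exact: cf.
rewrite (_ : (fun x => _) = fun x => \sum_(i <- r | P i) f i x)//.
by apply/funext => x; rewrite big_cons (negbTE Pi).
Qed.

Lemma rVI_sum {d} {I : Type} (r : seq I) (P : pred I) (f : I -> 'rV[R]_d -> R) :
  (forall i, P i -> Cc (f i)) ->
  rVI (fun x => \sum_(i <- r | P i) f i x) = \sum_(i <- r | P i) rVI (f i).
Proof.
move=> cf; elim: r => [|i r IH].
  rewrite big_nil (_ : (fun x => _) = fun=> 0) ?rVI0//.
  by apply/funext => x; rewrite big_nil.
rewrite big_cons; have [Pi|Pi] := boolP (P i).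
  rewrite (_ : (fun x => _) = fun x => f i x + \sum_(i <- r | P i) f i x); last first.
    by apply/funext => x; rewrite big_cons Pi.
  by rewrite rVID ?IH//; [exact: cf|exact: Cc_sum].
rewrite (_ : (fun x => _) = fun x => \sum_(i <- r | P i) f i x)//.
by apply/funext => x; rewrite big_cons (negbTE Pi).
Qed.

Lemma rVI_bound {d} N : exists2 C, 0 <= C & forall e (f : 'rV[R]_d -> R),
  Cc f -> supp_in N f -> 0 <= e -> (forall x, `|f x| <= e) -> `|rVI f| <= e * C.
Proof. by case: (@rVI_goodP R d) => _ _ /(_ N) [C [C0 h]]; exists C. Qed.

Lemma rVI_cvg {d} {I} (F : set_system I) {FF : Filter F} N
    (f : I -> 'rV[R]_d -> R) (f0 : 'rV[R]_d -> R) :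
  (\forall i \near F, continuous (f i) /\ supp_in N (f i)) -> continuous f0 -> supp_in N f0 ->
  (forall x, `|x| <= N -> f i.2 i.1 @[i --> filter_prod (nbhs x) F] --> f0 x) ->
  rVI (f i) @[i --> F] --> rVI f0.
Proof. by apply: rVI_good_cvg; exact: rVI_goodP. Qed.

Lemma Cc_comp {V W : normedModType R} (f : V -> R) (phi : W -> V) :
  continuous phi -> (forall N, exists M, forall z, M < `|z| -> N < `|phi z|) ->
  Cc f -> Cc (fun x => f (phi x)).
Proof.
move=> cphi pphi [cf [N fN]]; split.
  by move=> x; apply: continuous_comp; [exact: cphi|exact: cf].
by have [M h] := pphi N; exists M => x /h /fN.
Qed.

Lemma prod_norm_lt {V W : normedModType R} (x : V) (y : W) N :
  (N < `|(x, y)|) = (N < `|x|) || (N < `|y|).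
Proof. by rewrite prod_normE lt_max. Qed.

Lemma Cc_pair_r {V W : normedModType R} (g : V * W -> R) x : Cc g -> Cc (fun y => g (x, y)).
Proof.
apply: Cc_comp => [y|N]; first by apply: cvg_pair; [exact: cvg_cst|exact: cvg_id].
by exists N => z; rewrite prod_norm_lt => ->; rewrite orbT.
Qed.

Lemma Cc_pair_l {V W : normedModType R} (g : V * W -> R) y : Cc g -> Cc (fun x => g (x, y)).
Proof.
apply: Cc_comp => [x|N]; first by apply: cvg_pair; [exact: cvg_id|exact: cvg_cst].
by exists N => z; rewrite prod_norm_lt => ->.
Qed.

Lemma Cc_swap {V W : normedModType R} (g : V * W -> R) : Cc g -> Cc (fun z : W * V => g (z.2, z.1)).
Proof.
apply: Cc_comp => [[x y]|N]; first by apply: cvg_pair; [exact: cvg_snd|exact: cvg_fst].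
by exists N => -[x y]; rewrite !prod_norm_lt orbC.
Qed.

Lemma cvg_swap {A B : topologicalType} (a : A) (b : B) :
  (fun i : A * B => (i.2, i.1)) @ filter_prod (nbhs a) (nbhs b) --> (b, a).
Proof.
have h1 : snd @ filter_prod (nbhs a) (nbhs b) --> b by exact: cvg_snd.
have h2 : fst @ filter_prod (nbhs a) (nbhs b) --> a by exact: cvg_fst.
exact: (cvg_pair h1 h2).
Qed.

Lemma Cc_rVI {U : normedModType R} {d} (g : U * 'rV[R]_d -> R) :
  Cc g -> Cc (fun u => rVI (fun y => g (u, y))).
Proof.
move=> cg; have [cg0 [N gN]] := cg.
have gN' u : supp_in N (fun y => g (u, y)).
  by move=> y Ny; apply: gN; rewrite prod_norm_lt Ny orbT.
split; last first.
  exists N => u Nu; rewrite -[RHS](@rVI0 d); congr rVI; apply/funext => y.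
  by apply: gN; rewrite prod_norm_lt Nu.
move=> u; apply: (@rVI_cvg _ _ _ _ N).
- by apply: nearW => v; split => //; exact: (Cc_pair_r v cg).1.
- exact: (Cc_pair_r u cg).1.
- exact: gN'.
move=> y _; apply: (@cvg_comp _ _ _ (fun i : 'rV[R]_d * U => (i.2, i.1)) g _ (nbhs (u, y))).
  exact: cvg_swap.
exact: cg0.
Qed.

Lemma I1_rVI (f : R -> R) : \int[mu]_s f s = rVI (fun x : 'rV[R]_1 => f (x 0 0)).
Proof. by congr Rintegral; apply/funext => s /=; rewrite (consvE0 s (0 : 'rV[R]_0)). Qed.

Lemma Cc_I1 {U : normedModType R} (g : U * R -> R) :
  Cc g -> Cc (fun u => \int[mu]_s g (u, s)).
Proof.
move=> cg; under eq_fun do rewrite I1_rVI.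
apply: (@Cc_rVI U 1 (fun z => g (z.1, z.2 0 0))).
apply: Cc_comp cg => [[u x]|N].
  have h1 : fst @ nbhs (u, x) --> u by exact: cvg_fst.
  have h2 : (fun z : U * 'rV[R]_1 => z.2 0 0) @ nbhs (u, x) --> x 0 0.
    apply: (@cvg_comp _ _ _ snd (fun x : 'rV[R]_1 => x 0 0) _ (nbhs x)); first exact: cvg_snd.
    exact: coord_continuous.
  exact: (cvg_pair h1 h2).
exists (Num.max N 0) => -[u x]; rewrite !prod_norm_lt /= gt_max => /orP[/andP[->]//|].
rewrite gt_max => /andP[Nx x0]; apply/orP; right; rewrite ltNge; apply/negP => h.
move: Nx; rewrite ltNge => /negP; apply; have [N0|N0] := leP 0 N.
  by apply/rV_norm_ler => // i; rewrite ord1.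
by have := le_lt_trans h N0; rewrite normr_lt0.
Qed.

Lemma line_is_derive {V : normedModType R} (u : V -> R) (v x : V) (s : R) :
  derivable u (s *: v + x) v ->
  is_derive s (1 : R) (fun s => u (s *: v + x)) ('D_v u (s *: v + x)).
Proof.
rewrite /derivable => h.
have E : (fun h : R => h^-1 *: (((fun s => u (s *: v + x)) \o shift s) (h *: (1 : R)) - u (s *: v + x)))
  = (fun h : R => h^-1 *: ((u \o shift (s *: v + x)) (h *: v) - u (s *: v + x))).
  by apply/funext => t /=; rewrite addrA -scalerDl [t *: 1]mulr1.
split; first by rewrite /derivable E.
by rewrite /derive E.
Qed.

Lemma norm_small (a C : R) : 0 <= C -> (forall e, 0 < e -> `|a| <= e * C) -> a = 0.
Proof.
move=> C0 h; apply/eqP; rewrite -normr_le0; apply/ler_addgt0Pl => e e0.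
have C1 : 0 < C + 1 by rewrite ltr_wpDl.
apply: le_trans (h (e / (C + 1)) _) _; first by rewrite divr_gt0.
rewrite addr0 -mulrA ler_piMr//; first exact: ltW.
by rewrite mulrC ler_pdivrMr// mul1r lerDl.
Qed.

Lemma R_ball_compact (N : R) : compact [set x : R | `|x| <= N].
Proof.
have -> : [set x : R | `|x| <= N] = `[- N, N]%classic.
  by apply/seteqP; split => x /=; rewrite in_itv/= ler_norml.
exact: segment_compact.
Qed.

Lemma is_derive_est (Q : R -> R) (t L : R) :
  (forall e, 0 < e -> \forall h \near (0 : R), `|Q (t + h) - Q t - h * L| <= e * `|h|) ->
  is_derive t (1 : R) Q L.
Proof.
move=> H.
have cv : (fun h : R => h^-1 *: ((Q \o shift t) (h *: (1 : R)) - Q t)) @ 0^' --> L.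
  apply/cvgrPdist_le => e e0; near=> h.
  have h0 : h != 0 by near: h; exact: nbhs_dnbhs_neq.
  have hh : `|Q (t + h) - Q t - h * L| <= e * `|h|.
    by near: h; exact: cvg_within (H e e0).
  have -> : L - h^-1 *: ((Q \o shift t) (h *: (1 : R)) - Q t) = - (h^-1 * (Q (t + h) - Q t - h * L)).
    by rewrite /= [h *: 1]mulr1 (addrC h) /GRing.scale/=; field.
  by rewrite normrN normrM normfV ler_pdivrMl ?normr_gt0// (mulrC _ e).
by split; [apply/cvg_ex; exists L|exact: cvg_lim].
Unshelve. all: by end_near. Qed.

(* If F s is the primitive of g (s, .), both sides are increments of
   t |-> int F s t ds. *)
Lemma fubini11 (g : R * R -> R) : Cc g ->
  \int[mu]_s \int[mu]_t g (s, t) = \int[mu]_t \int[mu]_s g (s, t).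
Proof.
move=> cg; have [cg0 sg] := cg; have [N N0 gN] := supp_in_pos sg.
have gNs s : supp_in N (fun t => g (s, t)).
  by move=> t Nt; apply: gN; rewrite prod_norm_lt Nt orbT.
have gNt t : supp_in N (fun s => g (s, t)).
  by move=> s Ns; apply: gN; rewrite prod_norm_lt Ns.
have /choice [F FP] : forall s, exists F : R -> R,
    (forall x : R, is_derive x (1 : R) F (g (s, x))) /\
    (forall N x, supp_in N (fun t => g (s, t)) -> (x < - N -> F x = 0) /\ (N < x -> F x = \int[mu]_t g (s, t))).
  by move=> s; exact: Cc_primitive (Cc_pair_r s cg).
have FN t : supp_in N (fun s => F s t).
  (* The slice at s is identically 0, so any radius is admissible, even a negative one; this radius
     places t to the left of the support. *)
  move=> s Ns; apply: ((FP s).2 (- (`|t| + 1)) t _).1.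
    by move=> x _; apply: gN; rewrite prod_norm_lt Ns.
  by rewrite opprK; have := ler_norm t; lra.
have F0 s : F s (- (N + 1)) = 0 by apply: ((FP s).2 _ _ (gNs s)).1; lra.
have cF t : continuous (fun s => F s t).
  move=> s0; apply/cvgrPdist_le => e e0.
  have T0 : 0 < `|t - - (N + 1)| + 1 by rewrite ltr_wpDl.
  have e' : 0 < e / (`|t - - (N + 1)| + 1) by rewrite divr_gt0.
  have := @supp_in_uniform R R R (nbhs s0) _ N (fun s t => g (s, t)) (fun t => g (s0, t))
    (@R_ball_compact N) _ (gNs s0) (Cc_pair_r s0 cg).1 _ _ e'.
  have gg x : g (i.2, i.1) @[i --> filter_prod (nbhs x) (nbhs s0)] --> g (s0, x).
    apply: (@cvg_comp _ _ _ (fun i : R * R => (i.2, i.1)) g _ (nbhs (s0, x))); last exact: cg0.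
    exact: cvg_swap.
  move=> h; have {}h := h _ (filterE _ gNs) (fun x _ => gg x).
  near=> s.
  have gs : forall x, `|g (s, x) - g (s0, x)| <= e / (`|t - - (N + 1)| + 1) by near: s; exact: h.
  have dd (x : R) : is_derive x (1 : R) (F s - F s0) (g (s, x) - g (s0, x)).
    by have := (FP s).1 x; have := (FP s0).1 x => ? ?; apply: is_derive_eq.
  have := MVT_norm (a := - (N + 1)) (b := t) dd (fun x _ => gs x).
  rewrite !fctE !F0 subrr subr0 distrC => /le_trans; apply.
  rewrite -mulrA ler_piMr//; first exact: ltW.
  by rewrite mulrC ler_pdivrMr// mul1r lerDl.
have CF t : Cc (fun s => F s t) by split; [exact: cF|exists N; exact: FN].
have dQ (t : R) : is_derive t (1 : R) (fun t => \int[mu]_s F s t) (\int[mu]_s g (s, t)).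
  apply: is_derive_est => e e0.
  have e' : 0 < e / (4 * N) by rewrite divr_gt0// mulr_gt0.
  have gg x : g (i.1, i.2) @[i --> filter_prod (nbhs x) (nbhs t)] --> g (x, t).
    by rewrite (_ : (fun i => g (i.1, i.2)) = g); [exact: cg0|apply/funext => -[]].
  have H := @supp_in_uniform R R R (nbhs t) _ N (fun x s => g (s, x)) (fun s => g (s, t))
    (@R_ball_compact N) (filterE _ gNt) (gNt t) (Cc_pair_l t cg).1 (fun x _ => gg x) _ e'.
  have [r /= r0 hr] := (nbhs_ballP _ _).1 (H _ _).
  near=> h.
  have hr' x : `|x - t| <= `|h| -> forall s, `|g (s, x) - g (s, t)| <= e / (4 * N).
    move=> xt s; apply: hr; rewrite /ball/= distrC; apply: le_lt_trans xt _.
    by near: h; apply/nbhs_ballP; exists r => // y; rewrite /ball/= sub0r normrN.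
  rewrite -I1Z; last exact: Cc_pair_l.
  have -> : \int[mu]_s F s (t + h) - \int[mu]_s F s t - \int[mu]_s (h * g (s, t)) =
     \int[mu]_s (F s (t + h) - F s t - h * g (s, t)).
    rewrite -!Cc_intB//; [exact: CcB|apply: CcZ; exact: Cc_pair_l].
  rewrite (_ : e * `|h| = e / (4 * N) * `|h| * (4 * N)); last by field; rewrite gt_eqF.
  apply: I1_le => //.
  - by apply: CcB; [exact: CcB|apply: CcZ; exact: Cc_pair_l].
  - by move=> s Ns; rewrite !FN// gNt// mulr0 !subr0.
  - by rewrite mulr_ge0// ltW.
  move=> s.
  have dd (x : R) : is_derive x (1 : R) (fun x => F s x - x * g (s, t)) (g (s, x) - g (s, t)).
    have := (FP s).1 x => ?.
    by apply: is_derive_eq; rewrite /GRing.scale/= mulr0 add0r mulr1.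
  have := MVT_norm (a := t) (b := t + h) (e := e / (4 * N)) dd.
  rewrite (addrC t h) addrK => /(_ _).
  have -> : F s (h + t) - (h + t) * g (s, t) - (F s t - t * g (s, t)) = F s (h + t) - F s t - h * g (s, t) by ring.
  by apply => x xt; exact: hr'.
have [P [dP PE]] := Cc_primitive (Cc_I1 (Cc_swap cg)).
have := primitive_eq (- (N + 1)) (N + 1) dQ dP.
have sN : supp_in N (fun t => \int[mu]_s g (s, t)).
  move=> t Nt; rewrite (_ : (fun s => g (s, t)) = fun=> 0) ?Rintegral_cst ?mul0r//.
  by apply/funext => s; exact: gNs.
rewrite (PE N (N + 1) sN).2; last lra.
rewrite (PE N (- (N + 1)) sN).1; last lra.
rewrite subr0 => <-.
rewrite (_ : (fun s => F s (- (N + 1))) = fun=> 0); last by apply/funext.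
rewrite Rintegral_cst// mul0r subr0; congr Rintegral; apply/funext => s.
by rewrite ((FP s).2 N (N + 1) (gNs s)).2//; lra.
Unshelve. all: by end_near. Qed.

End Fubini.

(** * Fubini in several variables, integrals of derivatives, linear substitutions *)

Section FubiniVec.
Context {R : realType}.
Notation mu := (@lebesgue_measure R).
Notation rVI := rV_integral.

Lemma Cc_consv {U : normedModType R} {d} (g : U * 'rV[R]_d.+1 -> R) :
  Cc g -> Cc (fun z : (U * R) * 'rV[R]_d => g (z.1.1, consv z.1.2 z.2)).
Proof.
apply: Cc_comp => [[[u t] y]|N].
  have h1 : (fun z : (U * R) * 'rV[R]_d => z.1.1) @ nbhs ((u, t), y) --> u.
    by apply: (@cvg_comp _ _ _ fst fst _ (nbhs (u, t))); exact: cvg_fst.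
  have h2 : (fun z : (U * R) * 'rV[R]_d => z.1.2) @ nbhs ((u, t), y) --> t.
    by apply: (@cvg_comp _ _ _ fst snd _ (nbhs (u, t))); [exact: cvg_fst|exact: cvg_snd].
  have h3 : snd @ nbhs ((u, t), y) --> y by exact: cvg_snd.
  exact: (cvg_pair h1 (consv_cvg h2 h3)).
exists N => -[[u t] y]; rewrite !prod_norm_lt /= => /orP[/orP[->//|h]|h].
  by apply/orP; right; apply: lt_le_trans h _; exact: consv_ge_l.
by apply/orP; right; apply: lt_le_trans h _; exact: consv_ge_r.
Qed.

(** The variable s is moved past the coordinates of y one at a time, each exchange being the planar
    case. *)
Lemma fubini1d d (g : R * 'rV[R]_d -> R) : Cc g ->
  \int[mu]_s rVI (fun y => g (s, y)) = rVI (fun y => \int[mu]_s g (s, y)).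
Proof.
elim: d g => [//|d IH] g cg.
have cg' := Cc_consv cg.
rewrite /= (fubini11 (Cc_rVI cg')) /=.
congr Rintegral; apply/funext => t.
rewrite (IH (fun z => g (z.1, consv t z.2)))//.
apply: Cc_comp cg => [[s y]|N].
  have h1 : fst @ nbhs (s, y) --> s by exact: cvg_fst.
  have h2 : (fun=> t) @ nbhs (s, y) --> t by exact: cvg_cst.
  have h3 : snd @ nbhs (s, y) --> y by exact: cvg_snd.
  exact: (cvg_pair h1 (consv_cvg h2 h3)).
exists N => -[s y]; rewrite !prod_norm_lt /= => /orP[->//|h].
by apply/orP; right; apply: lt_le_trans h _; exact: consv_ge_r.
Qed.

Lemma rVI_fubini d d' (g : 'rV[R]_d * 'rV[R]_d' -> R) : Cc g ->
  rVI (fun x => rVI (fun y => g (x, y))) = rVI (fun y => rVI (fun x => g (x, y))).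
Proof.
elim: d g => [//|d IH] g cg /=.
have cg' := Cc_consv (Cc_swap cg).
transitivity (\int[mu]_s rVI (fun y => rVI (fun x => g (consv s x, y)))).
  congr Rintegral; apply/funext => s.
  rewrite (IH (fun z => g (consv s z.1, z.2)))//.
  apply: Cc_comp cg => [[x y]|N].
    have h1 : fst @ nbhs (x, y) --> x by exact: cvg_fst.
    have h2 : (fun=> s) @ nbhs (x, y) --> s by exact: cvg_cst.
    have h3 : snd @ nbhs (x, y) --> y by exact: cvg_snd.
    exact: (cvg_pair (consv_cvg h2 h1) h3).
  exists N => -[x y]; rewrite !prod_norm_lt /= => /orP[h|->]; last by rewrite orbT.
  by apply/orP; left; apply: lt_le_trans h _; exact: consv_ge_r.
rewrite (fubini1d (g := fun z => rVI (fun x => g (consv z.1 x, z.2))))//.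
exact: Cc_swap (Cc_rVI cg').
Qed.

Lemma Cc_shift {V : normedModType R} (f : V -> R) b : Cc f -> Cc (fun x => f (x + b)).
Proof.
apply: Cc_comp => [x|N].
  have h1 : id @ nbhs x --> x by exact: cvg_id.
  have h2 : (fun=> b) @ nbhs x --> b by exact: cvg_cst.
  exact: (cvgD h1 h2).
exists (N + `|b|) => x h; have := ler_normB (x + b) b; rewrite addrK; lra.
Qed.

Lemma rVI_shift d (f : 'rV[R]_d -> R) b : Cc f -> rVI (fun x => f (x + b)) = rVI f.
Proof.
elim: d f b => [|d IH] f b cf; first by rewrite /=; congr f; apply/rowP => -[].
rewrite /= (consv_eta b); set b0 := b 0 ord0; set b' := \row_i _.
rewrite -(I1_affine b0 (oner_neq0 _) (Cc_good_slice (@rVI_goodP R d) cf)) normr1 mul1r.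
congr Rintegral; apply/funext => s; rewrite mul1r.
rewrite -(IH _ b' (Cc_slice _ cf)); congr rVI; apply/funext => y.
by rewrite -/(consv s y) consvD.
Qed.

(** By translation invariance u (x + h v) - u x has integral 0. Hence h times the integral of the
    derivative is, up to sign, the integral of the first-order remainder, which uniform continuity
    of the derivative bounds by e h. With a product for u this is integration by parts. *)
Lemma rVI_derive d (u : 'rV[R]_d -> R) v :
  Cc u -> (forall x, derivable u x v) -> continuous ('D_v u) -> rVI ('D_v u) = 0.
Proof.
move=> cu du cdu; have [_ su] := cu; have [N N0 uN] := supp_in_pos su.
have duN : supp_in N ('D_v u).
  move=> x Nx; have : \forall y \near x, (fun=> 0) y = u y.
    have : \forall y \near x, N < `|y|.
      have : (fun y : 'rV[R]_d => `|y|) @ nbhs x --> `|x| by exact: norm_continuous.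
      by move=> /cvgr_gt; apply.
    by apply: filterS => y /uN ->.
  by move=> /near_eq_derive <-; rewrite (derive_cst (0 : R)).
have cdu' : Cc ('D_v u) by split => //; exists N.
(* A radius containing the supports of all translates by s v with |s| at most 1. *)
set N' := N + `|v|.
have NN' : N <= N' by rewrite lerDl.
have [C C0 hC] := @rVI_bound R d N'.
apply: (norm_small C0) => e e0.
have Hu : forall x, 'D_v u (i.2 *: v + i.1) @[i --> filter_prod (nbhs x) (nbhs (0 : R))] --> 'D_v u x.
  move=> x; apply: (@cvg_comp _ _ _ (fun i : 'rV[R]_d * R => i.2 *: v + i.1) ('D_v u) _ (nbhs x)); last exact: cdu.
  have h1 : snd @ filter_prod (nbhs x) (nbhs (0 : R)) --> (0 : R) by exact: cvg_snd.
  have h2 : fst @ filter_prod (nbhs x) (nbhs (0 : R)) --> x by exact: cvg_fst.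
  have h3 : (fun=> v) @ filter_prod (nbhs x) (nbhs (0 : R)) --> v by exact: cvg_cst.
  have := cvgD (cvgZ h1 h3) h2; rewrite scale0r add0r; exact.
have Hs : \forall s \near (0 : R), supp_in N' (fun x => 'D_v u (s *: v + x)).
  have : \forall s \near (0 : R), `|s| < 1 by apply/nbhs_ballP; exists 1 => //= y; rewrite /ball/= sub0r normrN.
  apply: filterS => s s1 x Nx; apply: duN.
  have := ler_normB (s *: v + x) (s *: v); rewrite addrAC subrr add0r normrZ.
  have : `|s| * `|v| <= `|v| by rewrite ler_piMl// ltW.
  by rewrite /N' in Nx; lra.
have H := @supp_in_uniform R 'rV[R]_d R (nbhs (0 : R)) _ N' (fun s x => 'D_v u (s *: v + x)) ('D_v u)
    (@closed_ball_compact R d N') Hs (supp_inW NN' duN) cdu (fun x _ => Hu x) e e0.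
have [r /= r0 hr] := (nbhs_ballP _ _).1 (H _).
set h := Num.min (r / 2) 1.
have h0 : 0 < h by rewrite lt_min ltr01 andbT divr_gt0.
have hr2 : h < r by rewrite gt_min; apply/orP; left; rewrite gtr_pMr// invf_lt1 ?ltr1n.
have h1 : h <= 1 by rewrite ge_min lexx orbT.
have E : rVI (fun x => (u (x + h *: v) - u x) - h * 'D_v u x) = - (h * rVI ('D_v u)).
  rewrite rVIB; [|by apply: CcB => //; exact: Cc_shift|exact: CcZ].
  by rewrite rVIB ?rVI_shift ?subrr ?sub0r ?rVIZ//; exact: Cc_shift.
have : `|rVI (fun x => (u (x + h *: v) - u x) - h * 'D_v u x)| <= (e * h) * C.
  apply: hC.
  - apply: CcB; last exact: CcZ.
    by apply: CcB => //; exact: Cc_shift.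
  - move=> x Nx; rewrite (supp_inW NN' uN Nx) (supp_inW NN' duN Nx) mulr0 !subr0 uN//.
    have := ler_normB (x + h *: v) (h *: v); rewrite addrK normrZ gtr0_norm//.
    have : h * `|v| <= `|v| by rewrite ler_piMl.
    by rewrite /N' in Nx; lra.
  - by rewrite mulr_ge0// ltW.
  move=> x.
  have dd (s : R) : is_derive s (1 : R) (fun s => u (s *: v + x) - s * 'D_v u x) ('D_v u (s *: v + x) - 'D_v u x).
    have := line_is_derive (du (s *: v + x)) => ?.
    by apply: is_derive_eq; rewrite /GRing.scale/= mulr0 add0r mulr1.
  have := MVT_norm (a := 0) (b := h) (e := e) dd.
  rewrite scale0r add0r mul0r !subr0 (addrC _ x) gtr0_norm// addrAC; apply.
  move=> s; rewrite subr0 => sh; apply: hr; rewrite /ball/= sub0r normrN.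
  exact: le_lt_trans sh hr2.
rewrite E normrN normrM gtr0_norm// (mulrC e) -mulrA ler_pM2l//.
Qed.

Lemma mulmx_norm_le m n (A : 'M[R]_(m, n)) : exists2 C, 0 < C & forall x : 'rV[R]_m, `|x *m A| <= C * `|x|.
Proof.
exists (\sum_i \sum_j `|A i j| + 1).
  by rewrite ltr_wpDl// sumr_ge0// => i _; rewrite sumr_ge0.
move=> x; apply/rV_norm_ler => [|j]; first by rewrite mulr_ge0// addr_ge0// sumr_ge0// => i _; rewrite sumr_ge0.
rewrite mxE mulrDl mul1r; apply: le_trans (ler_norm_sum _ _ _) _.
rewrite -[leLHS]addr0 lerD// mulr_suml ler_sum// => i _.
rewrite normrM mulrC ler_pM//; last exact: rV_norm_ge.
by rewrite (bigD1 j)//= lerDl sumr_ge0.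
Qed.

Lemma mulmx_cont m n (A : 'M[R]_(m, n)) : continuous (fun x : 'rV[R]_m => x *m A).
Proof.
move=> x; have [C C0 h] := mulmx_norm_le A; apply/(@cvgrPdist_le _ _ _ (nbhs x) (nbhs_filter x)) => e e0.
have e' := divr_gt0 e0 C0.
apply/nbhs_ballP; exists (e / C) => // y; rewrite -ball_normE /= => /ltW xy.
by rewrite -mulmxBl (le_trans (h _))// -ler_pdivlMl// mulrC.
Qed.

Lemma Cc_mulmx d (A : 'M[R]_d) (f : 'rV[R]_d -> R) :
  A \in unitmx -> Cc f -> Cc (fun x => f (x *m A)).
Proof.
move=> uA; apply: Cc_comp; first exact: mulmx_cont.
have [C C0 h] := mulmx_norm_le (invmx A) => N.
exists (C * N) => x; have := h (x *m A); rewrite mulmxK// => h1 h2.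
by have := lt_le_trans h2 h1; rewrite ltr_pM2l.
Qed.

Definition lin_cov d (A : 'M[R]_d) :=
  forall f : 'rV[R]_d -> R, Cc f -> `|\det A| * rVI (fun x => f (x *m A)) = rVI f.

Lemma lin_covM d (A B : 'M[R]_d) : A \in unitmx -> B \in unitmx ->
  lin_cov A -> lin_cov B -> lin_cov (A *m B).
Proof.
move=> uA uB hA hB f cf; rewrite det_mulmx normrM mulrC.
under eq_fun do rewrite mulmxA.
rewrite -(hB f cf) -(hA (fun x => f (x *m B))); last exact: Cc_mulmx.
ring.
Qed.

(** Row vectors are multiplied from the left: s becomes a s, and for fixed s the other coordinates
    undergo D followed by the translation s b. Translation invariance and the rule for D settle the
    inner integral, the affine substitution the outer one. *)
Lemma lin_cov_upper d (a : R) (b : 'rV[R]_d) (D : 'M[R]_d) : a != 0 -> D \in unitmx ->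
  lin_cov D -> lin_cov (block_mx (a%:M : 'M[R]_1) b 0 D : 'M[R]_d.+1).
Proof.
move=> a0 uD hD f cf.
rewrite (det_ublock (a%:M : 'M[R]_1) b D) det_scalar1 normrM -mulrA /=.
rewrite -(I1_affine 0 a0 (Cc_good_slice (@rVI_goodP R d) cf)); congr (_ * _).
rewrite -I1Z.
  congr Rintegral; apply/funext => s; rewrite addr0.
  have cs : Cc (fun y => f (consv (a * s) y)) by exact: Cc_slice.
  rewrite -(rVI_shift (s *: b) cs) -(hD _ (Cc_shift (s *: b) cs)).
  congr (_ * _); congr rVI; apply/funext => y; congr f.
  rewrite (mul_row_block (s%:M : 'rV[R]_1) y (a%:M : 'M[R]_1) b 0 D).
  by rewrite mulmx0 addr0 !mul_scalar_mx scale_scalar_mx (mulrC s) (addrC (s *: b)).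
apply: (Cc_good_slice (f := fun x => f (x *m block_mx (a%:M : 'M[R]_1) b 0 D)) (@rVI_goodP R d)).
apply: Cc_mulmx cf.
by rewrite unitmxE (det_ublock (a%:M : 'M[R]_1) b D) det_scalar1 unitrM -unitmxE uD unitfE a0.
Qed.

(** Only the first coordinate moves, by an amount depending on the others. Fubini makes it the
    innermost variable, where that amount is a constant translation. *)
Lemma lin_cov_shear d (v : 'cV[R]_d) :
  lin_cov (block_mx (1%:M : 'M[R]_1) 0 v 1%:M : 'M[R]_d.+1).
Proof.
move=> f cf; rewrite (det_lblock (1%:M : 'M[R]_1) v 1%:M) !det1 mulr1 normr1 mul1r /=.
have E s (y : 'rV[R]_d) : row_mx (s%:M : 'rV[R]_1) y *m block_mx (1%:M : 'M[R]_1) 0 v 1%:M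
   = consv (s + (y *m v) 0 0) y.
  rewrite (mul_row_block (s%:M : 'rV[R]_1) y (1%:M : 'M[R]_1) 0 v 1%:M).
  rewrite !mulmx1 mulmx0 add0r; congr row_mx; rewrite raddfD /=; congr (_ + _).
  by rewrite [LHS]mx11_scalar.
have c2 : Cc (fun z : R * 'rV[R]_d => f (consv z.1 z.2)).
  apply: Cc_comp cf => [[s y]|N].
    have h1 : fst @ nbhs (s, y) --> s by exact: cvg_fst.
    have h3 : snd @ nbhs (s, y) --> y by exact: cvg_snd.
    exact: (consv_cvg h1 h3).
  exists N => -[s y]; rewrite prod_norm_lt => /orP[] h; apply: lt_le_trans h _.
    exact: consv_ge_l.
  exact: consv_ge_r.
have c3 : Cc (fun z : R * 'rV[R]_d => f (consv (z.1 + (z.2 *m v) 0 0) z.2)).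
  have [C C0 hC] := mulmx_norm_le v.
  apply: (@Cc_comp R (R * 'rV[R]_d)%type (R * 'rV[R]_d)%type (fun z => f (consv z.1 z.2)) (fun z : R * 'rV[R]_d => (z.1 + (z.2 *m v) 0 0, z.2)) _ _ c2) => [[s y]|N].
    have h1 : fst @ nbhs (s, y) --> s by exact: cvg_fst.
    have h3 : snd @ nbhs (s, y) --> y by exact: cvg_snd.
    have h4 : (fun z : R * 'rV[R]_d => (z.2 *m v) 0 0) @ nbhs (s, y) --> (y *m v) 0 0.
      apply: (@cvg_comp _ _ _ snd (fun y : 'rV[R]_d => (y *m v) 0 0) _ (nbhs y)); first exact: h3.
      apply: (@cvg_comp _ _ _ (fun y : 'rV[R]_d => y *m v) (fun x : 'rV[R]_1 => x 0 0) _ (nbhs (y *m v))).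
        exact: mulmx_cont.
      exact: coord_continuous.
    exact: (cvg_pair (cvgD h1 h4) h3).
  exists (`|N| + C * `|N|) => -[s y]; rewrite !prod_norm_lt /= => h.
  have [//|yN] := ltP N `|y|; rewrite ?orbT//= orbF.
  have yv := le_trans (rV_norm_ge (y *m v) 0) (hC y).
  have N1 := ler_norm N.
  have yN' : C * `|y| <= C * `|N| by rewrite ler_pM2l// (le_trans yN).
  have CN : 0 <= C * `|N| by rewrite mulr_ge0// ltW.
  have := ler_normB (s + (y *m v) 0 0) ((y *m v) 0 0); rewrite addrK => hh.
  by case/orP: h; lra.
transitivity (\int[mu]_s rVI (fun y => f (consv (s + (y *m v) 0 0) y))).
  by congr Rintegral; apply/funext => s; congr rVI; apply/funext => y; rewrite E.
rewrite (fubini1d c3) /= (fubini1d c2) /=.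
congr rVI; apply/funext => y.
rewrite -(I1_affine ((y *m v) 0 0) (oner_neq0 _) (Cc_pair_l y c2)) normr1 mul1r /=.
by under [in RHS]eq_Rintegral do rewrite mul1r.
Qed.

(* Up to a shear A 0 0 != 0, and then A is a shear times a block triangular
   matrix. *)
Lemma lin_cov_all d (A : 'M[R]_d) : A \in unitmx -> lin_cov A.
Proof.
elim: d A => [|d IH] A uA.
  move=> f cf; rewrite det_mx00 normr1 mul1r /=; congr f; by apply/rowP => -[].
wlog a0 : A uA / A 0 0 != 0 => [hw|].
  have [a0|a0] := eqVneq (A 0 0) 0; last exact: hw.
  have [j Aj] : exists j, A 0 j != 0.
    apply/existsP; rewrite -negb_forall; apply/negP => /forallP h.
    move: uA; rewrite unitmxE (expand_det_row _ 0) big1 ?unitr0// => j _.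
    by rewrite (eqP (h j)) mul0r.
  case: (unliftP 0 j) Aj => [j'|] ->; last by rewrite a0 eqxx.
  move=> Aj.
  (* Multiplying A by [S v] on the right adds to column 0 the column in which row 0 has a nonzero
     entry. *)
  pose v : 'cV[R]_d := delta_mx j' 0.
  pose S w := block_mx (1%:M : 'M[R]_1) 0 w 1%:M : 'M[R]_d.+1.
  have uS w : S w \in unitmx by rewrite unitmxE (det_lblock (1%:M : 'M[R]_1) w 1%:M) !det1 mulr1 unitr1.
  have SN : S v *m S (- v) = 1%:M.
    rewrite (mulmx_block (1%:M : 'M[R]_1) 0 v 1%:M 1%:M 0 (- v) 1%:M).
    rewrite !(mulmx1, mul1mx, mulmx0, mul0mx, addr0, add0r) subrr.
    by rewrite -(@scalar_mx_block _ 1 d 1).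
  have -> : A = (A *m S v) *m S (- v) by rewrite -mulmxA SN mulmx1.
  have uAS : A *m S v \in unitmx by rewrite unitmx_mul uA uS.
  apply: lin_covM => //; last exact: lin_cov_shear.
  apply: hw => //.
  have S00 : S v 0 0 = 1.
    have h := block_mxEul (1%:M : 'M[R]_1) 0 v 1%:M 0 0; rewrite [RHS]mxE mulr1n in h.
    by rewrite -[RHS]h; congr (block_mx _ _ _ _ _ _); apply/val_inj.
  have SS0 k : S v (lift 0 k) 0 = v k 0.
    rewrite -(block_mxEdl (1%:M : 'M[R]_1) 0 v 1%:M k 0).
    by congr (block_mx _ _ _ _ _ _); apply/val_inj.
  rewrite mxE big_ord_recl a0 mul0r add0r (bigD1 j')//= SS0 mxE !eqxx mulr1 big1 ?addr0// => k kj.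
  by rewrite SS0 mxE (negbTE kj) mulr0.
have := submxK (A : 'M[R]_(1 + d)).
set b := ursubmx _; set c := dlsubmx _; set D := drsubmx _; set a := ulsubmx _ => AE.
have aE : a = (A 0 0)%:M.
  by rewrite [LHS]mx11_scalar !mxE; congr (A _ _)%:M; apply/val_inj.
(* One step of Gaussian elimination: [w] clears the first column below the pivot, and D - w b is the
   Schur complement. *)
pose w : 'cV[R]_d := (A 0 0)^-1 *: c.
have uS : (block_mx (1%:M : 'M[R]_1) 0 w 1%:M : 'M[R]_d.+1) \in unitmx.
  by rewrite unitmxE (det_lblock (1%:M : 'M[R]_1) w 1%:M) !det1 mulr1 unitr1.
have AE' : A = (block_mx (1%:M : 'M[R]_1) 0 w 1%:M : 'M[R]_d.+1) *m
     (block_mx ((A 0 0)%:M : 'M[R]_1) b 0 (D - w *m b) : 'M[R]_d.+1).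
  rewrite -[LHS]AE (mulmx_block (1%:M : 'M[R]_1) 0 w 1%:M ((A 0 0)%:M : 'M[R]_1) b 0 (D - w *m b)).
  rewrite aE !(mul1mx, mul0mx, mulmx0, addr0) (addrC (w *m b)) subrK.
  by rewrite mul_mx_scalar scalerA mulfV// scale1r.
have uU : (block_mx ((A 0 0)%:M : 'M[R]_1) b 0 (D - w *m b) : 'M[R]_d.+1) \in unitmx.
  by move: uA; rewrite {1}AE' unitmx_mul => /andP[].
rewrite AE'; apply: lin_covM => //; first exact: lin_cov_shear.
apply: lin_cov_upper => //.
  by move: uU; rewrite unitmxE (det_ublock ((A 0 0)%:M : 'M[R]_1) b) unitrM => /andP[].
apply: IH.
by move: uU; rewrite unitmxE (det_ublock ((A 0 0)%:M : 'M[R]_1) b) unitrM => /andP[].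
Qed.

End FubiniVec.

(** * Change of variables *)

Section Mollifier.
Context {R : realType}.
Notation rVI := rV_integral.

Lemma continuous_extend {T : topologicalType} (V L : set T) (h : T -> R) :
  closed L -> L `<=` V -> (forall x, V x -> h @ nbhs x --> h x) ->
  (forall x, ~ L x -> h x = 0) -> continuous h.
Proof.
move=> cL LV ch h0 x; have [Lx|nLx] := pselect (L x); first exact/ch/LV.
rewrite /continuous_at h0//; apply: cvg_near_cst.
have : nbhs x (~` L) by apply: open_nbhs_nbhs; split => //; exact: closed_openC.
by apply: filterS => y /h0 ->.
Qed.

Lemma rVI_ge0 d (f : 'rV[R]_d -> R) : (forall x, 0 <= f x) -> 0 <= rVI f.
Proof.
elim: d f => [|d IH] f f0 //=.
by apply: Rintegral_ge0 => s _; exact: IH.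
Qed.

Lemma rVI_le d (f g : 'rV[R]_d -> R) : Cc f -> Cc g -> (forall x, f x <= g x) -> rVI f <= rVI g.
Proof.
by move=> cf cg fg; rewrite -subr_ge0 -rVIB//; apply: rVI_ge0 => x; rewrite subr_ge0.
Qed.

Lemma rVI_norm_le d (f g : 'rV[R]_d -> R) :
  Cc f -> Cc g -> (forall x, `|f x| <= g x) -> `|rVI f| <= rVI g.
Proof.
move=> cf cg fg; rewrite ler_norml -mulN1r -rVIZ//; apply/andP; split; apply: rVI_le => //.
- exact: CcZ.
- by move=> x; have := fg x; rewrite ler_norml mulN1r => /andP[].
- by move=> x; have := fg x; rewrite ler_norml => /andP[].
Qed.

Lemma rVI_gt0 d (f : 'rV[R]_d -> R) x0 : Cc f -> (forall x, 0 <= f x) -> 0 < f x0 -> 0 < rVI f.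
Proof.
elim: d f x0 => [|d IH] f x0 cf f0 fx0 /=.
  by rewrite (_ : 0 = x0)//; apply/rowP => -[].
apply: (@I1_gt0 _ _ (x0 0 ord0)).
- exact: (Cc_good_slice (@rVI_goodP R d) cf).
- by move=> s; exact: rVI_ge0.
apply: (IH _ (\row_i x0 0 (lift ord0 i))) => //; first exact: (Cc_slice _ cf).
by rewrite -/(consv _ _) -consv_eta.
Qed.

(** The kernel is the normalized tent 2 max (0, 1 - |x|). Continuity suffices, because no derivative
    is ever put on the mollifier. *)
Lemma mollifierP d : exists k : 'rV[R]_d -> R,
  [/\ Cc k, supp_in 1 k, (forall x, 0 <= k x) & rVI k = 1].
Proof.
pose t (x : 'rV[R]_d) := (1 - `|x|) + `|1 - `|x| |.
have t0 x : 0 <= t x by rewrite /t addrC -lerBlDr sub0r; have := ler_norm (- (1 - `|x|)); rewrite normrN.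
have t1 : supp_in 1 t by move=> x x1; rewrite /t ltr0_norm ?subr_lt0// subrr.
have ct : Cc t.
  split; last by exists 1.
  move=> x.
  have h : (fun x : 'rV[R]_d => 1 - `|x|) @ nbhs x --> 1 - `|x|.
    by apply: cvgB; [exact: cvg_cst|exact: norm_continuous].
  exact: (cvgD h (cvg_norm h)).
have It : 0 < rVI t.
  by apply: (@rVI_gt0 _ _ 0) => //; rewrite /t normr0 subr0 normr1 addr_gt0.
exists (fun x => (rVI t)^-1 * t x); split.
- exact: CcZ.
- by move=> x x1; rewrite t1// mulr0.
- by move=> x; rewrite mulr_ge0// invr_ge0 ltW.
by rewrite rVIZ// mulVf// gt_eqF.
Qed.

Lemma rVI_affine d (G : 'rV[R]_d -> R) a b : a != 0 -> Cc G ->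
  `|a| ^+ d * rVI (fun y => G (a *: y + b)) = rVI G.
Proof.
move=> a0 cG; rewrite -(rVI_shift b cG).
rewrite -(@lin_cov_all R d a%:M _ (fun x => G (x + b))); last exact: Cc_shift.
  rewrite det_scalar normrX; congr (_ * _); congr rVI.
  by apply/funext => y; rewrite mul_mx_scalar.
by rewrite unitmxE det_scalar unitfE expf_neq0.
Qed.

Lemma Cc_affine d (G : 'rV[R]_d -> R) a b : a != 0 -> Cc G ->
  Cc (fun y => G (a *: y + b)).
Proof.
move=> a0 cG.
have := Cc_mulmx (A := a%:M) _ (Cc_shift b cG).
under eq_fun do rewrite mul_mx_scalar; apply.
by rewrite unitmxE det_scalar unitfE expf_neq0.
Qed.

Definition dilate {d} (k : 'rV[R]_d -> R) (e : R) (w : 'rV[R]_d) := (e ^+ d)^-1 * k (e^-1 *: w).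

Lemma dilate_supp d (k : 'rV[R]_d -> R) e w : 0 < e -> supp_in 1 k -> e < `|w| -> dilate k e w = 0.
Proof.
move=> e0 k1 ew; rewrite /dilate k1 ?mulr0// normrZ gtr0_norm ?invr_gt0//.
by rewrite mulrC ltr_pdivlMr// mul1r.
Qed.

Lemma dilate_cont d (k : 'rV[R]_d -> R) e : continuous k -> continuous (dilate k e).
Proof.
move=> ck w.
have h1 : (fun=> (e ^+ d)^-1) @ nbhs w --> (e ^+ d)^-1 by exact: cvg_cst.
have h2 : (fun y : 'rV[R]_d => e^-1 *: y) @ nbhs w --> e^-1 *: w.
  have h : (fun=> e^-1) @ nbhs w --> e^-1 by exact: cvg_cst.
  have h' : id @ nbhs w --> w by exact: cvg_id.
  exact: (cvgZ h h').
have h3 : (fun y : 'rV[R]_d => k (e^-1 *: y)) @ nbhs w --> k (e^-1 *: w).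
  by apply: (@cvg_comp _ _ _ (fun y : 'rV[R]_d => e^-1 *: y) k _ (nbhs (e^-1 *: w))); [exact: h2|exact: ck].
exact: (cvgM h1 h3).
Qed.

Lemma dilate_CcB d (k : 'rV[R]_d -> R) e a : 0 < e -> Cc k -> Cc (fun z => dilate k e (a - z)).
Proof.
move=> e0 ck; apply: CcZ.
have := Cc_affine (a := - e^-1) (e^-1 *: a) _ ck.
under eq_fun do rewrite scaleNr addrC -scalerBr; apply.
by rewrite oppr_eq0 invr_eq0 gt_eqF.
Qed.

Lemma dilate_int d (k : 'rV[R]_d -> R) e a : 0 < e -> Cc k ->
  rVI (fun z => dilate k e (a - z)) = rVI k.
Proof.
move=> e0 ck; have en0 : - e != 0 by rewrite oppr_eq0 gt_eqF.
rewrite -(rVI_affine (a := - e) a en0 (dilate_CcB a e0 ck)) normrN gtr0_norm//.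
rewrite -rVIZ.
  congr rVI; apply/funext => y; rewrite /dilate mulrA mulfV ?mul1r ?expf_neq0 ?gt_eqF//.
  by rewrite opprD addrCA subrr addr0 scaleNr opprK scalerA mulVf ?scale1r// gt_eqF.
exact: (Cc_affine _ en0 (dilate_CcB a e0 ck)).
Qed.

(** The radius comes from the uniform continuity of f on the whole space and therefore serves all
    centres a at once. *)
Lemma mollify_near d (k f : 'rV[R]_d -> R) e : Cc k -> supp_in 1 k -> (forall x, 0 <= k x) ->
  rVI k = 1 -> Cc f -> 0 < e ->
  exists2 r, 0 < r & forall eps a, 0 < eps -> eps < r ->
    `|rVI (fun z => dilate k eps (a - z) * f z) - f a| <= e.
Proof.
move=> ck k1 k0 Ik cf e0; have [cf0 sf] := cf; have [N N0 fN] := supp_in_pos sf.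
have Hs : \forall w \near (0 : 'rV[R]_d), supp_in (N + 1) (fun x => f (x + w)).
  have : \forall w \near (0 : 'rV[R]_d), `|w| < 1.
    by apply/nbhs_ballP; exists 1 => //= y; rewrite -ball_normE /= sub0r normrN.
  apply: filterS => w w1 x Nx; apply: fN.
  have := ler_normB (x + w) w; rewrite addrK; lra.
have Hu x : f (i.1 + i.2) @[i --> filter_prod (nbhs x) (nbhs (0 : 'rV[R]_d))] --> f x.
  apply: (@cvg_comp _ _ _ (fun i : 'rV[R]_d * 'rV[R]_d => i.1 + i.2) f _ (nbhs x)); last exact: cf0.
  have h1 : snd @ filter_prod (nbhs x) (nbhs (0 : 'rV[R]_d)) --> (0 : 'rV[R]_d) by exact: cvg_snd.
  have h2 : fst @ filter_prod (nbhs x) (nbhs (0 : 'rV[R]_d)) --> x by exact: cvg_fst.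
  have := cvgD h2 h1; rewrite addr0; exact.
have NN : N <= N + 1 by rewrite lerDl.
have H := @supp_in_uniform R 'rV[R]_d 'rV[R]_d (nbhs (0 : 'rV[R]_d)) _ (N + 1) (fun w x => f (x + w)) f
    (@closed_ball_compact R d (N + 1)) Hs (supp_inW NN fN) cf0 (fun x _ => Hu x) e e0.
have [r /= r0 hr] := (nbhs_ballP _ _).1 (H _).
exists r => // eps a eps0 epsr.
have cd : Cc (fun z => dilate k eps (a - z)) by exact: dilate_CcB.
have cdf : Cc (fun z => dilate k eps (a - z) * f z).
  by under eq_fun do rewrite mulrC; apply: CcMr => //; exact: cf0.
have E : f a = rVI (fun z => f a * dilate k eps (a - z)) by rewrite rVIZ// dilate_int// Ik mulr1.
rewrite {1}E -rVIB//; last exact: CcZ.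
apply: le_trans (_ : rVI (fun z => e * dilate k eps (a - z)) <= _); last first.
  by rewrite rVIZ// dilate_int// Ik mulr1.
apply: rVI_norm_le; [by apply: CcB => //; exact: CcZ|exact: CcZ|] => z.
rewrite (mulrC (f a)) -mulrBr normrM.
have d0 : 0 <= dilate k eps (a - z) by rewrite mulr_ge0// invr_ge0 exprn_ge0// ltW.
rewrite (ger0_norm d0) mulrC.
have [az|az] := ltP eps `|a - z|; first by rewrite dilate_supp// !mulr0.
rewrite ler_wpM2r//.
have : ball (0 : 'rV[R]_d) r (z - a).
  by rewrite -ball_normE /= sub0r opprB; exact: le_lt_trans az epsr.
by move=> /hr /(_ a); rewrite (addrC a) subrK.
Qed.

End Mollifier.

(** * Substitution along a strictly differentiable homeomorphism *)

Section ChangeOfVariables.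
Context {R : realType}.
Notation rVI := rV_integral.

Lemma compact_norm_bound {U : normedModType R} (L : set U) : compact L ->
  exists2 N, 0 < N & forall x, L x -> `|x| <= N.
Proof.
move=> /compact_bounded [M [_ hM]]; exists (`|M| + 1); first by rewrite ltr_wpDl.
by apply: hM; rewrite (le_lt_trans (ler_norm M))// ltrDl.
Qed.

Lemma Cc_extend {U : normedModType R} (V L : set U) (h : U -> R) :
  compact L -> L `<=` V -> (forall x, V x -> h @ nbhs x --> h x) ->
  (forall x, ~ L x -> h x = 0) -> Cc h.
Proof.
move=> cL LV ch h0; split.
  by apply: (continuous_extend _ LV ch h0); apply: compact_closed => //; exact: norm_hausdorff.
have [N N0 hN] := compact_norm_bound cL; exists N => x Nx; apply: h0 => /hN.
by rewrite leNgt Nx.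
Qed.

Lemma open_indic_near {T : topologicalType} (V : set T) (x : T) : open V -> V x ->
  \forall y \near x, (\1_V y : R) = 1.
Proof.
move=> oV Vx; have : nbhs x V by exact: open_nbhs_nbhs.
by apply: filterS => y Vy; rewrite indicE mem_set.
Qed.

Lemma compact_margin {U : normedModType R} (K W : set U) : compact K -> open W -> K `<=` W ->
  exists2 r, 0 < r & forall z w, K z -> `|w - z| <= r -> W w.
Proof.
move=> /compact_near_coveringP cK oW KW.
have : \forall r \near (0 : R)^'+, K `<=` (fun z => forall w, `|w - z| <= r -> W w).
  apply: cK => z Kz.
  have /nbhs_ballP [e /= e0 he] : nbhs z W by apply: open_nbhs_nbhs; split => //; exact: KW.
  exists (ball z (e / 2), [set r | r < e / 2]) => /=.
    split; first by apply: nbhsx_ballx; rewrite divr_gt0.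
    by apply: nbhs_right_lt; rewrite divr_gt0.
  move=> [z' r] [/= zz' re] w wz; apply: he; rewrite -ball_normE /=.
  move: zz'; rewrite -ball_normE /= => zz'.
  rewrite (_ : z - w = (z - z') - (w - z')); last by rewrite opprB addrA subrK.
  by rewrite (le_lt_trans (ler_normB _ _))// (splitr e) ltrD// (le_lt_trans wz).
move=> h; have /filter_ex [r [r0 hr]] : \forall r \near (0 : R)^'+, 0 < r /\ K `<=` (fun z => forall w, `|w - z| <= r -> W w).
  by near=> r; split; near: r; [exact: nbhs_right_gt|exact: h].
by exists r => // z w Kz; exact: hr.
Unshelve. all: by end_near. Qed.

Lemma compact_thicken {U : normedModType R} (K B : set U) : compact K -> compact B ->
  compact [set w : U | exists z b, [/\ K z, B b & w = z + b]].
Proof.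
move=> cK cB.
have -> : [set w : U | exists z b, [/\ K z, B b & w = z + b]] = (fun p : U * U => p.1 + p.2) @` (K `*` B).
  apply/seteqP; split => w /=; first by move=> [z [b [Kz Bb ->]]]; exists (z, b).
  by move=> [[z b] /= [Kz Bb] <-]; exists z, b.
apply: continuous_compact; last exact: compact_setX.
apply: continuous_subspaceT => -[a b].
have h1 : fst @ nbhs (a, b) --> a by exact: cvg_fst.
have h2 : snd @ nbhs (a, b) --> b by exact: cvg_snd.
exact: (cvgD h1 h2).
Qed.

Variables (d : nat) (V W : set 'rV[R]_d) (tau sigma : 'rV[R]_d -> 'rV[R]_d).
Variable J : 'rV[R]_d -> 'M[R]_d.
Hypothesis (oV : open V) (oW : open W).
Hypothesis (sV : forall z, W z -> V (sigma z)).
Hypothesis (st : forall x, V x -> sigma (tau x) = x) (ts : forall z, W z -> tau (sigma z) = z).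
Hypothesis ctau : forall x, V x -> tau @ nbhs x --> tau x.
Hypothesis csig : forall z, W z -> sigma @ nbhs z --> sigma z.
(** Strict differentiability. The estimate between two arbitrary points near x0 is required because
    the base point sigma z moves together with the scale of the mollifier. Matrices act on row
    vectors from the right. *)
Hypothesis sd : forall x0, V x0 -> forall e, 0 < e -> exists2 r, 0 < r &
  forall x x', `|x0 - x| < r -> `|x0 - x'| < r ->
    `|tau x - tau x' - (x - x') *m J x0| <= e * `|x - x'|.
Hypothesis uJ : forall x, V x -> J x \in unitmx.
Hypothesis cJ : forall x, V x -> (fun x => \det (J x)) @ nbhs x --> \det (J x).

Variables (k : 'rV[R]_d -> R).
Hypothesis (ck : Cc k) (k1 : supp_in 1 k) (k0 : forall x, 0 <= k x) (Ik : rVI k = 1).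

Let D x := `|\det (J x)|.
Let G eps z x := \1_V x * (dilate k eps (tau x - z) * D x).

Let cD x : V x -> D @ nbhs x --> D x. Proof. by move=> /cJ /cvg_norm. Qed.

Let cG eps z x : V x -> (fun p => G eps p.2 p.1) @ nbhs (x, z) --> G eps z x.
Proof.
move=> Vx.
have h1 : fst @ nbhs (x, z) --> x by exact: cvg_fst.
have h2 : snd @ nbhs (x, z) --> z by exact: cvg_snd.
have t1 : (fun p : 'rV[R]_d * 'rV[R]_d => tau p.1) @ nbhs (x, z) --> tau x.
  by apply: (@cvg_comp _ _ _ fst tau _ (nbhs x)); [exact: h1|exact: ctau].
have t2 : (fun p : 'rV[R]_d * 'rV[R]_d => tau p.1 - p.2) @ nbhs (x, z) --> tau x - z.
  exact: (cvgB t1 h2).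
have t3 : (fun p : 'rV[R]_d * 'rV[R]_d => dilate k eps (tau p.1 - p.2)) @ nbhs (x, z) --> dilate k eps (tau x - z).
  apply: (@cvg_comp _ _ _ (fun p : 'rV[R]_d * 'rV[R]_d => tau p.1 - p.2) (dilate k eps) _ (nbhs (tau x - z))) => //.
  exact: (dilate_cont ck.1).
have t4 : (fun p : 'rV[R]_d * 'rV[R]_d => D p.1) @ nbhs (x, z) --> D x.
  by apply: (@cvg_comp _ _ _ fst D _ (nbhs x)); [exact: h1|exact: cD].
have t5 : (fun p : 'rV[R]_d * 'rV[R]_d => \1_V p.1 : R) @ nbhs (x, z) --> (\1_V x : R).
  apply: (@cvg_comp _ _ _ fst (\1_V) _ (nbhs x)); first exact: h1.
  have E := open_indic_near oV Vx; rewrite (nbhs_singleton E).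
  exact: cvg_near_cst.
exact: (cvgM t5 (cvgM t3 t4)).
Qed.

Let cG1 eps z x : V x -> G eps z @ nbhs x --> G eps z x.
Proof.
move=> Vx; apply: (@cvg_comp _ _ _ (fun x => (x, z)) (fun p => G eps p.2 p.1) _ (nbhs (x, z))); last exact: cG.
have h1 : id @ nbhs x --> x by exact: cvg_id.
have h2 : (fun=> z) @ nbhs x --> z by exact: cvg_cst.
exact: (cvg_pair h1 h2).
Qed.

(** The integrand [G] after x = e y + sigma z; the factor e^d of this substitution cancels the
    normalization in [dilate]. *)
Let p (i : 'rV[R]_d * R) (y : 'rV[R]_d) : R :=
  let x := i.2 *: y + sigma i.1 in
  \1_V x * (k (i.2^-1 *: (tau x - i.1)) * D x).

Let pE z e : 0 < e -> (fun y => e ^+ d * G e z (e *: y + sigma z)) = p (z, e).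
Proof.
move=> e0; apply/funext => y; rewrite /G /p /dilate /=.
have E0 : e ^+ d != 0 by rewrite expf_neq0// gt_eqF.
by move: (e ^+ d) E0 => E E0; field.
Qed.

(* Substituting x = e y + sigma z, the integral of k_e (tau x - z) |det J x|
   tends to that of |det J| k (y J), which is 1. *)
Lemma cov_mass_local (K : set 'rV[R]_d) z0 : K `<=` W -> K z0 ->
  (\forall e \near (0 : R)^'+, forall z, K z -> Cc (G e z)) ->
  rVI (p i) @[i --> filter_prod (within K (nbhs z0)) (0 : R)^'+] --> (1 : R).
Proof.
move=> KW Kz0 CG; set F := filter_prod _ _.
have FF : Filter F by exact: filter_prod_filter.
set x0 := sigma z0; have Vx0 : V x0 by exact/sV/KW.
set A := J x0; have uA := uJ Vx0.
have I1 : 1 = rVI (fun y => D x0 * k (y *m A)).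
  by rewrite rVIZ; [rewrite lin_cov_all|exact: Cc_mulmx].
rewrite [X in _ --> X]I1.
have [C C0 hC] := mulmx_norm_le (invmx A).
have hA (v : 'rV[R]_d) : `|v| <= C * `|v *m A| by have := hC (v *m A); rewrite mulmxK.
have csz0 : sigma @ nbhs z0 --> x0 by exact/csig/KW.
have fst_cvg : fst @ F --> z0.
  have h : fst @ F --> within K (nbhs z0) by exact: cvg_fst.
  exact: (cvg_trans h (cvg_within _)).
have snd_cvg : snd @ F --> (0 : R).
  have h : snd @ F --> (0 : R)^'+ by exact: cvg_snd.
  exact: (cvg_trans h (cvg_within _)).
have sig_cvg : (fun i => sigma i.1) @ F --> x0.
  by apply: (@cvg_comp _ _ _ fst sigma _ (nbhs z0)).
have pos : \forall i \near F, 0 < i.2.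
  by exists (setT, [set e | 0 < e]) => [|[z e] []//]; split; [exact: filterT|exact: nbhs_right_gt].
have inK : \forall i \near F, K i.1.
  exists (K, setT) => [|[z e] []//]; split; last exact: filterT.
  exact: withinT.
have GG : \forall i \near F, forall z, K z -> Cc (G i.2 z).
  by exists (setT, [set e | forall z, K z -> Cc (G e z)]) => [|[z e] []//]; split; first exact: filterT.
(* With C a norm bound for the inverse of A, the tolerance 1/(2C) lets the error be absorbed: on the
   support |e y| is at most C e + |e y| / 2, hence |y| is at most 2C. This is the support radius
   common to all z and e. *)
have [r r0 hr] := sd Vx0 (divr_gt0 (divr_gt0 ltr01 C0) (ltr0n R 2)).
have NC : \forall i \near F, `|x0 - sigma i.1| < r.
  by move/cvgrPdist_lt : sig_cvg; apply.
have NS : \forall i \near F, forall w, `|w - i.1| <= i.2 -> `|x0 - sigma w| < r.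
  move/cvgrPdist_lt : csz0 => /(_ _ r0) /nbhs_ballP [s /= s0 hs].
  have s2 : 0 < s / 2 by rewrite divr_gt0.
  near=> i => w wi; apply: hs; rewrite -ball_normE /=.
  rewrite (_ : z0 - w = (z0 - i.1) - (w - i.1)); last by rewrite opprB addrA subrK.
  rewrite (le_lt_trans (ler_normB _ _))// (splitr s) ltr_leD//.
    by near: i; move/cvgrPdist_lt : fst_cvg; apply.
  rewrite (le_trans wi)//; near: i.
  by move/cvgrPdist_le : snd_cvg => /(_ _ s2); apply: filterS => i; rewrite sub0r normrN; exact: (le_trans (ler_norm _)).
have SUP : \forall i \near F, supp_in (2 * C) (p i).
  near=> i => y Ny; apply/eqP; apply/negPn/negP; rewrite !mulf_eq0 !negb_or => /and3P[n1 n2 n3].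
  have i0 : 0 < i.2 by near: i.
  set x := i.2 *: y + sigma i.1 in n1 n2 n3 *.
  have Vx : V x by move: n1; rewrite indicE; case: (boolP (x \in V)) => [/set_mem//|]; rewrite eqxx.
  have tx : `|tau x - i.1| <= i.2.
    rewrite leNgt; apply/negP => h; move/negP : n2; apply; apply/eqP/k1.
    by rewrite normrZ gtr0_norm ?invr_gt0// mulrC ltr_pdivlMr// mul1r.
  have Wi : W i.1 by apply: KW; near: i.
  have xr : `|x0 - x| < r.
    rewrite -(st Vx); move: (tau x) tx; near: i; exact: NS.
  have x'r : `|x0 - sigma i.1| < r by near: i.
  have := hr _ _ xr x'r; rewrite ts//.
  have xs : x - sigma i.1 = i.2 *: y by rewrite addrK.
  rewrite xs => h1.
  have h2 := hA (i.2 *: y).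
  have h3 := ler_normB (tau x - i.1) (tau x - i.1 - i.2 *: y *m A).
  rewrite opprB addrC subrK in h3.
  have nE : `|i.2 *: y| = i.2 * `|y| by rewrite normrZ gtr0_norm.
  move: h1 h2 h3; rewrite nE => h1 h2 h3.
  have h4 : C * `|i.2 *: y *m A| <= C * (i.2 + 1 / C / 2 * (i.2 * `|y|)).
    by rewrite ler_pM2l// (le_trans h3)// lerD.
  have E4 : C * (i.2 + 1 / C / 2 * (i.2 * `|y|)) = C * i.2 + i.2 * `|y| / 2 by field; rewrite gt_eqF.
  rewrite E4 in h4.
  have : i.2 * (2 * C) < i.2 * `|y| by rewrite ltr_pM2l.
  by lra.
apply: (@rVI_cvg _ _ _ F _ (2 * C)).
- near=> i; split; last by near: i.
  have i0 : 0 < i.2 by near: i.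
  have Ki : K i.1 by near: i.
  have CGi : Cc (G i.2 i.1) by move: (i.1) Ki; near: i.
  have := (CcZ (i.2 ^+ d) (Cc_affine (sigma i.1) (lt0r_neq0 i0) CGi)).1.
  by rewrite (pE _ i0); case: (i).
- apply: (CcZ (D x0) (Cc_mulmx uA ck)).1.
- move=> y Ny; rewrite k1 ?mulr0//.
  have := lt_le_trans Ny (hA y).
  by rewrite mulrC ltr_pM2l//; apply: lt_trans; rewrite ltr1n.
move=> y0 _; set FY := filter_prod _ _.
have FFY : Filter FY by exact: filter_prod_filter.
have sF : snd @ FY --> F by exact: cvg_snd.
have yF : fst @ FY --> y0 by exact: cvg_fst.
have eF : (fun i => i.2.2) @ FY --> (0 : R).
  by apply: (@cvg_comp _ _ _ snd snd _ F).
have zF : (fun i => sigma i.2.1) @ FY --> x0.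
  by apply: (@cvg_comp _ _ _ snd (fun i => sigma i.1) _ F).
pose X (i : 'rV[R]_d * ('rV[R]_d * R)) := i.2.2 *: i.1 + sigma i.2.1.
have XF : X @ FY --> x0.
  have := cvgD (cvgZ eF yF) zF; rewrite scale0r add0r; exact.
have DF : (fun i => D (X i)) @ FY --> D x0.
  by apply: (@cvg_comp _ _ _ X D _ (nbhs x0)); [exact: XF|exact: cD].
have iF : (fun i => \1_V (X i) : R) @ FY --> (1 : R).
  apply: (@cvg_comp _ _ _ X (\1_V) _ (nbhs x0)); first exact: XF.
  by apply: cvg_near_cst; exact: (open_indic_near oV Vx0).
have qF : (fun i => i.2.2^-1 *: (tau (X i) - i.2.1)) @ FY --> y0 *m A.
  have yA : (fun i : 'rV[R]_d * ('rV[R]_d * R) => i.1 *m A) @ FY --> y0 *m A.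
    by apply: (@cvg_comp _ _ _ fst (fun y => y *m A) _ (nbhs y0)); [exact: yF|exact: mulmx_cont].
  apply/cvgrPdist_le => e e0.
  have e2 : 0 < e / 2 by rewrite divr_gt0.
  have y1 : 0 < `|y0| + 1 by rewrite ltr_wpDl.
  have [r' r'0 hr'] := sd Vx0 (divr_gt0 e2 y1).
  near=> i.
  have Xr : `|x0 - X i| < r' by near: i; move/cvgrPdist_lt : XF; apply.
  have sr : `|x0 - sigma i.2.1| < r' by near: i; move/cvgrPdist_lt : zF; apply.
  have ip : 0 < i.2.2 by near: i; exact: (sF _ pos).
  have Ki : K i.2.1 by near: i; exact: (sF _ inK).
  have := hr' _ _ Xr sr; rewrite ts; last exact: KW.
  rewrite {2 3}/X addrK normrZ gtr0_norm// => h1.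
  have h2 : `|i.2.2^-1 *: (tau (X i) - i.2.1) - i.1 *m A| <= e / 2.
    rewrite (_ : _ - _ = i.2.2^-1 *: (tau (X i) - i.2.1 - i.2.2 *: i.1 *m A)); last first.
      by rewrite [in RHS]scalerBr [in RHS]scalemxAl scalerA mulVf ?scale1r// gt_eqF.
    rewrite normrZ gtr0_norm ?invr_gt0// ler_pdivrMl//.
    apply: (le_trans h1); rewrite mulrCA ler_pM2l//.
    have yi : `|i.1| <= `|y0| + 1.
      have : `|y0 - i.1| <= 1 by near: i; move/cvgrPdist_le : yF; apply.
      have := ler_normB y0 (y0 - i.1); rewrite opprB addrC subrK; lra.
    by rewrite -mulrA ler_piMr ?(ltW e2)// mulrC ler_pdivrMr// mul1r.
  have h3 : `|y0 *m A - i.1 *m A| <= e / 2 by near: i; move/cvgrPdist_le : yA; apply.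
  rewrite (_ : _ - _ = (y0 *m A - i.1 *m A) - (i.2.2^-1 *: (tau (X i) - i.2.1) - i.1 *m A)); last first.
    by rewrite opprB addrA subrK.
  by rewrite (le_trans (ler_normB _ _))// (splitr e) lerD.
have kF : (fun i => k (i.2.2^-1 *: (tau (X i) - i.2.1))) @ FY --> k (y0 *m A).
  by apply: (@cvg_comp _ _ _ _ k _ (nbhs (y0 *m A))); [exact: qF|exact: ck.1].
have := cvgM iF (cvgM kF DF); rewrite mul1r mulrC; exact.
Unshelve. all: by end_near. Qed.

(** The local limit is joint in the centre z and the scale, so compactness of K makes it uniform in
    z. *)
Lemma cov_mass (K : set 'rV[R]_d) : compact K -> K `<=` W ->
  (\forall e \near (0 : R)^'+, forall z, K z -> Cc (G e z)) ->
  forall e, 0 < e -> \forall eps \near (0 : R)^'+, forall z, K z -> `|rVI (G eps z) - 1| <= e.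
Proof.
move=> /compact_near_coveringP /near_covering_withinP cK KW CG e e0.
have H : \forall eps \near (0 : R)^'+, K `<=` (fun z => `|rVI (p (z, eps)) - 1| <= e).
  apply: cK => z0 Kz0.
  have FF : Filter (filter_prod (within K (nbhs z0)) (0 : R)^'+) by exact: filter_prod_filter.
  have /cvgrPdist_le /(_ _ e0) [[A B] /= [hA hB] hAB] := cov_mass_local KW Kz0 CG.
  exists ((fun z => K z -> A z), B) => [|[z eps] /= [Az Be] Kz]; first by split.
  by rewrite distrC; apply: (hAB (z, eps)); split => //=; exact: Az.
near=> eps => z Kz.
have e1 : 0 < eps by near: eps; exact: nbhs_right_gt.
have CGz : Cc (G eps z) by move: z Kz; near: eps.
suff -> : rVI (G eps z) = rVI (p (z, eps)) by move: z Kz {CGz}; near: eps.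
rewrite -pE// rVIZ; last by apply: Cc_affine => //; exact: lt0r_neq0.
by rewrite -[in RHS](gtr0_norm e1) gtr0_norm// -(rVI_affine (sigma z) (lt0r_neq0 e1) CGz) gtr0_norm.
Unshelve. all: by end_near. Qed.

(* Integrate k_e (tau x - z) f z |det J x| in both orders and let e tend to 0. *)
Lemma change_of_variables_mollified (f : 'rV[R]_d -> R) (K : set 'rV[R]_d) :
  compact K -> K `<=` W -> continuous f -> (forall z, ~ K z -> f z = 0) ->
  rVI (fun x => \1_V x * (f (tau x) * `|\det (J x)|)) = rVI f.
Proof.
move=> cK KW cf f0.
have [del del0 hdel] := compact_margin cK oW KW.
(* At scales up to [del] the kernel centred at a point of K lives in this thickening, which is still
   inside W. Its image under sigma is a compact support in x valid for all such scales and
   centres. *)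
pose K' := [set w : 'rV[R]_d | exists z b, [/\ K z, [set x : 'rV[R]_d | `|x| <= del] b & w = z + b]].
have cK' : compact K' := compact_thicken cK (@closed_ball_compact R d del).
have K'W : K' `<=` W.
  by move=> w [z [b [Kz /= bd ->]]]; apply: (hdel z) => //; rewrite addrAC subrr add0r.
pose L := sigma @` K'.
have cL : compact L.
  apply: continuous_compact => //; apply: continuous_in_subspaceT => z /set_mem /K'W Wz.
  exact: csig.
have LV : L `<=` V by move=> x [w K'w <-]; exact/sV/K'W.
have inL x z : V x -> K z -> `|tau x - z| <= del -> L x.
  move=> Vx Kz h; exists (tau x); last exact: st.
  by exists z, (tau x - z); split => //; rewrite addrC subrK.
have GL eps z x : 0 < eps -> eps <= del -> K z -> ~ L x -> G eps z x = 0.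
  move=> e0 ed Kz nL; rewrite /G indicE; have [Vx|] := boolP (x \in V); last by rewrite mul0r.
  rewrite dilate_supp ?(mul0r,mulr0)//; apply: (le_lt_trans ed).
  by rewrite ltNge; apply/negP => h; apply: nL; apply: (inL x z) => //; exact: set_mem.
have CG eps z : 0 < eps -> eps <= del -> K z -> Cc (G eps z).
  by move=> e0 ed Kz; apply: (Cc_extend cL LV) => [x Vx|x nL]; [exact: cG1|exact: GL].
pose Phi eps (q : 'rV[R]_d * 'rV[R]_d) := G eps q.2 q.1 * f q.2.
have CPhi eps : 0 < eps -> eps <= del -> Cc (Phi eps).
  move=> e0 ed; apply: (@Cc_extend _ (V `*` setT) (L `*` K)).
  - exact: compact_setX.
  - by move=> [x z] [/= Lx _]; split => //; exact: LV.
  - move=> [x z] [/= Vx _].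
    have h2 : (fun q : 'rV[R]_d * 'rV[R]_d => f q.2) @ nbhs (x, z) --> f z.
      apply: (@cvg_comp _ _ _ snd f _ (nbhs z)); [exact: cvg_snd|exact: cf].
    exact: (cvgM (@cG eps z x Vx) h2).
  - move=> [x z] nLK; rewrite /Phi /=; have [Kz|nK] := pselect (K z); last by rewrite f0// mulr0.
    by rewrite GL ?mul0r// => Lx; apply: nLK.
pose La x := \1_V x * (f (tau x) * D x).
have LaL x : ~ L x -> La x = 0.
  move=> nL; rewrite /La indicE; have [Vx|] := boolP (x \in V); last by rewrite mul0r.
  rewrite f0 ?(mul0r, mulr0)// => Kt; apply: nL; apply: (inL _ _ _ Kt); first exact: set_mem.
  by rewrite subrr normr0 ltW.
have CLa : Cc La.
  apply: (Cc_extend cL LV) => // x Vx.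
  have t5 : (fun x => \1_V x : R) @ nbhs x --> (\1_V x : R).
    have E := open_indic_near oV Vx; rewrite (nbhs_singleton E).
    exact: cvg_near_cst.
  have t6 : (fun x => f (tau x)) @ nbhs x --> f (tau x).
    by apply: (@cvg_comp _ _ _ tau f _ (nbhs (tau x))); [exact: ctau|exact: cf].
  exact: (cvgM t5 (cvgM t6 (cD Vx))).
have Cf : Cc f by apply: (Cc_extend cK KW) => [x _|]; [exact: cf|exact: f0].
have [N N0 hN] := compact_norm_bound cL.
have [N' N'0 hN'] := compact_norm_bound cK.
have [B B0 hB] := @rVI_bound R d N.
have [B' B'0 hB'] := @rVI_bound R d N'.
have [DM DM0 hDM] : exists2 M, 0 < M & forall x, L x -> `|D x| <= M.
  have cDL : compact (D @` L).
    by apply: continuous_compact => //; apply: continuous_in_subspaceT => x /set_mem /LV; exact: cD.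
  by have [M M0 h] := compact_norm_bound cDL; exists M => // x Lx; apply: h; exists x.
have [fM fM0 hfM] : exists2 M, 0 < M & forall x, `|f x| <= M.
  have cfK : compact (f @` K).
    by apply: continuous_compact => //; apply: continuous_subspaceT.
  have [M M0 h] := compact_norm_bound cfK; exists M => // x.
  have [Kx|nK] := pselect (K x); first by apply: h; exists x.
  by rewrite f0// normr0 ltW.
apply/eqP; rewrite -subr_eq0; apply/eqP.
have C0 : 0 <= DM * B + fM * B' by rewrite addr_ge0// mulr_ge0// ltW.
apply: (norm_small C0) => e e0.
have Fnear : \forall e \near (0 : R)^'+, forall z, K z -> Cc (G e z).
  near=> eps => z Kz.
  have h1 : 0 < eps by near: eps; exact: nbhs_right_gt.
  have h2 : eps <= del by near: eps; exact: nbhs_right_le.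
  exact: CG.
have [r r0 hr] := mollify_near ck k1 k0 Ik Cf e0.
have /filter_ex [eps [[eps0 epsd] [epsr hm]]] : \forall eps \near (0 : R)^'+,
    (0 < eps /\ eps <= del) /\ (eps < r /\ forall z, K z -> `|rVI (G eps z) - 1| <= e).
  near=> eps; split; split.
  - by near: eps; exact: nbhs_right_gt.
  - by near: eps; exact: nbhs_right_le.
  - by near: eps; exact: nbhs_right_lt.
  - by near: eps; exact: cov_mass.
have Cp := CPhi eps eps0 epsd.
have H1 : `|rVI (fun x => rVI (fun z => Phi eps (x, z))) - rVI La| <= e * DM * B.
  rewrite -rVIB//; last exact: Cc_rVI.
  have dE x : rVI (fun z => Phi eps (x, z)) - La x =
      \1_V x * D x * (rVI (fun z => dilate k eps (tau x - z) * f z) - f (tau x)).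
    have -> : (fun z => Phi eps (x, z)) = fun z => (\1_V x * D x) * (dilate k eps (tau x - z) * f z).
      by apply/funext => z; rewrite /Phi /G /=; ring.
    rewrite rVIZ; first by rewrite /La; ring.
    by under eq_fun do rewrite mulrC; apply: CcMr => //; exact: dilate_CcB (ck).
  have dL x : ~ L x -> rVI (fun z => Phi eps (x, z)) - La x = 0.
    move=> nL; rewrite LaL// subr0 -[RHS](@rVI0 R d); congr rVI; apply/funext => z.
    rewrite /Phi /=; have [Kz|nK] := pselect (K z); last by rewrite f0// mulr0.
    by rewrite GL// mul0r.
  apply: hB.
  - by apply: CcB => //; exact: Cc_rVI.
  - by move=> x Nx; apply: dL => /hN; rewrite leNgt Nx.
  - by rewrite mulr_ge0// ltW.
  move=> x; have [Lx|nL] := pselect (L x); last by rewrite dL// normr0 mulr_ge0// ltW.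
  rewrite dE indicE mem_set ?mul1r; last exact: LV.
  by rewrite normrM mulrC ler_pM//; [exact: hr|exact: hDM].
have H2 : `|rVI (fun z => rVI (fun x => Phi eps (x, z))) - rVI f| <= e * fM * B'.
  rewrite -rVIB//; last exact: Cc_rVI (Cc_swap Cp).
  have dE z : K z -> rVI (fun x => Phi eps (x, z)) - f z = f z * (rVI (G eps z) - 1).
    move=> Kz; have -> : (fun x => Phi eps (x, z)) = fun x => f z * G eps z x.
      by apply/funext => x; rewrite /Phi mulrC.
    by rewrite rVIZ ?mulrBr ?mulr1//; exact: CG.
  have dK z : ~ K z -> rVI (fun x => Phi eps (x, z)) - f z = 0.
    move=> nK; rewrite f0// subr0 -[RHS](@rVI0 R d); congr rVI; apply/funext => x.
    by rewrite /Phi /= f0// mulr0.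
  apply: hB'.
  - by apply: CcB => //; exact: Cc_rVI (Cc_swap Cp).
  - by move=> z Nz; apply: dK => /hN'; rewrite leNgt Nz.
  - by rewrite mulr_ge0// ltW.
  move=> z; have [Kz|nK] := pselect (K z); last by rewrite dK// normr0 mulr_ge0// ltW.
  by rewrite dE// normrM mulrC ler_pM//; exact: hm.
rewrite -/(La _) in H1 *; rewrite -(rVI_fubini Cp) in H2.
rewrite (_ : rVI _ - rVI f = (rVI (fun x => rVI (fun z => Phi eps (x, z))) - rVI f) - (rVI (fun x => rVI (fun z => Phi eps (x, z))) - rVI La)).
  rewrite (le_trans (ler_normB _ _))// mulrDr !mulrA addrC lerD//.
by rewrite /La; ring.
Unshelve. all: by end_near. Qed.

End ChangeOfVariables.

Lemma change_of_variables {R : realType} d (V W : set 'rV[R]_d) (tau sigma : 'rV[R]_d -> 'rV[R]_d)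
    (J : 'rV[R]_d -> 'M[R]_d) (f : 'rV[R]_d -> R) (K : set 'rV[R]_d) :
  open V -> open W -> (forall z, W z -> V (sigma z)) ->
  (forall x, V x -> sigma (tau x) = x) -> (forall z, W z -> tau (sigma z) = z) ->
  (forall x, V x -> tau @ nbhs x --> tau x) -> (forall z, W z -> sigma @ nbhs z --> sigma z) ->
  (forall x0, V x0 -> forall e, 0 < e -> exists2 r, 0 < r &
    forall x x', `|x0 - x| < r -> `|x0 - x'| < r ->
      `|tau x - tau x' - (x - x') *m J x0| <= e * `|x - x'|) ->
  (forall x, V x -> J x \in unitmx) ->
  (forall x, V x -> (fun x => \det (J x)) @ nbhs x --> \det (J x)) ->
  compact K -> K `<=` W -> continuous f -> (forall z, ~ K z -> f z = 0) ->
  rV_integral (fun x => \1_V x * (f (tau x) * `|\det (J x)|)) = rV_integral f.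
Proof.
move=> oV oW sV st ts ct cs sd uJ cJ cK KW cf f0.
have [k [ck k1 k0 Ik]] := @mollifierP R d.
exact: (change_of_variables_mollified oV oW sV st ts ct cs sd uJ cJ ck k1 k0 Ik cK KW cf f0).
Qed.

(** * Calculus of C^1 functions with a parameter *)

Section DifferentiableEstimate.
Context {R : realType} {V W : normedModType R}.

Lemma differentiable_estP (f : V -> W) x : differentiable f x ->
  forall e, 0 < e -> \forall y \near x, `|f y - f x - 'd f x (y - x)| <= e * `|y - x|.
Proof.
move=> /diff_locallyP [_ /eqaddoP h] e e0.
have := h e e0; rewrite (near_shift 0 x) /= subr0; apply: filterS => y /=.
by rewrite addrK !fctE opprD addrA.
Qed.

Lemma differentiable_est (f : V -> W) (L : {linear V -> W}) x : continuous L ->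
  (forall e, 0 < e -> \forall y \near x, `|f y - f x - L (y - x)| <= e * `|y - x|) ->
  differentiable f x /\ 'd f x = L :> (V -> W).
Proof.
move=> cL h.
have H : f \o shift x = cst (f x) + L +o_ 0 id.
  apply/eqaddoP => e e0.
  have := h e e0; rewrite (near_shift 0 x) /= subr0; apply: filterS => y /=.
  by rewrite addrK !fctE opprD addrA.
have dL := diff_unique cL H; split => //.
by apply/diff_locallyP; rewrite dL.
Qed.

Lemma differentiable_near_eq (f g : V -> W) x : (\forall y \near x, f y = g y) ->
  differentiable f x -> differentiable g x.
Proof.
move=> fg df; apply: (differentiable_est (L := 'd f x) _ _).1; first exact: diff_continuous.
move=> e e0; have := differentiable_estP df e0; apply: filterS2 (fg) => y <-.
by rewrite -(nbhs_singleton fg).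
Qed.

End DifferentiableEstimate.

(** * Functions of class C^1 in space depending continuously on a parameter *)

Section JointC1.
Context {R : realType} {V : normedModType R}.
Implicit Types (S : set R) (U : set V) (f g : R -> V -> R) (v : V).

(* Regularity of a family of functions of x in U depending on a parameter s in
   S: joint continuity in (s, x), of f and of its derivatives in x. *)
Definition jc {W : normedModType R} S U (f : R -> V -> W) :=
  forall s x, S s -> U x ->
    (fun z => f z.1 z.2) @ within (S `*` U) (nbhs (s, x)) --> f s x.

Definition jC1 S U f := [/\ forall s x, S s -> U x -> differentiable (f s) x,
  jc S U f & forall v, jc S U (fun s => 'D_v (f s))].

Lemma jc_eq {W : normedModType R} S U (f g : R -> V -> W) :
  (forall s x, S s -> U x -> f s x = g s x) -> jc S U f -> jc S U g.
Proof.
move=> fg cf s x Ss Ux; rewrite -fg//.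
have := cf s x Ss Ux; apply: cvg_trans; apply: near_eq_cvg.
rewrite near_withinE; near=> z => -[/= Sz Uz]; by rewrite fg.
Unshelve. all: by end_near. Qed.

Lemma jc_cst {W : normedModType R} S U (a : W) : jc S U (fun _ _ => a).
Proof. by move=> s x _ _; exact: cvg_cst. Qed.

Lemma jcD {W : normedModType R} S U (f g : R -> V -> W) : jc S U f -> jc S U g -> jc S U (fun s x => f s x + g s x).
Proof. by move=> cf cg s x Ss Ux; exact: (cvgD (cf s x Ss Ux) (cg s x Ss Ux)). Qed.

Lemma jcM S U f g : jc S U f -> jc S U g -> jc S U (fun s x => f s x * g s x).
Proof. by move=> cf cg s x Ss Ux; exact: (cvgM (cf s x Ss Ux) (cg s x Ss Ux)). Qed.

Lemma jcB {W : normedModType R} S U (f g : R -> V -> W) : jc S U f -> jc S U g -> jc S U (fun s x => f s x - g s x).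
Proof. by move=> cf cg s x Ss Ux; exact: (cvgB (cf s x Ss Ux) (cg s x Ss Ux)). Qed.

Lemma jc_sum {I : Type} S U (r : seq I) (P : pred I) (f : I -> R -> V -> R) :
  (forall i, P i -> jc S U (f i)) -> jc S U (fun s x => \sum_(i <- r | P i) f i s x).
Proof.
move=> cf; elim: r => [|i r IH].
  by apply: (jc_eq (f := fun _ _ => 0)) => [s x _ _|]; [rewrite big_nil|exact: jc_cst].
case: (boolP (P i)) => Pi.
  apply: (jc_eq (f := fun s x => f i s x + \sum_(i <- r | P i) f i s x)).
    by move=> s x _ _; rewrite big_cons Pi.
  by apply: jcD => //; exact: cf.
apply: (jc_eq (f := fun s x => \sum_(i <- r | P i) f i s x)) => // s x _ _.
by rewrite big_cons (negbTE Pi).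
Qed.

Lemma jc_comp {W W' : normedModType R} S U (f : R -> V -> W) (phi : W -> W') : jc S U f ->
  (forall s x, S s -> U x -> phi @ nbhs (f s x) --> phi (f s x)) ->
  jc S U (fun s x => phi (f s x)).
Proof.
move=> cf cphi s x Ss Ux.
apply: (@cvg_comp _ _ _ (fun z => f z.1 z.2) phi _ (nbhs (f s x))); [exact: cf|exact: cphi].
Qed.

Lemma jC1_eq S U f g : open U -> (forall s x, S s -> U x -> f s x = g s x) -> jC1 S U f -> jC1 S U g.
Proof.
move=> oU fg [df cf cdf].
have fgn s x : S s -> U x -> \forall y \near x, f s y = g s y.
  by move=> Ss Ux; have : nbhs x U by [exact: open_nbhs_nbhs]; apply: filterS => y Uy; exact: fg.
have D v s x : S s -> U x -> 'D_v (f s) x = 'D_v (g s) x.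
  by move=> Ss Ux; apply: near_eq_derive; exact: fgn.
split; [|exact: jc_eq cf|by move=> v; exact: (jc_eq (D v))].
move=> s x Ss Ux; exact: differentiable_near_eq (fgn s x Ss Ux) (df s x Ss Ux).
Qed.

Lemma jC1_cst S U (a : R) : jC1 S U (fun _ _ => a).
Proof.
split=> [s x _ _||v]; [exact: (differentiable_cst a)|exact: jc_cst|].
apply: (jc_eq (f := fun _ _ => 0)) => [s x _ _|]; last exact: jc_cst.
by rewrite (derive_cst a).
Qed.

Lemma jC1D S U f g : jC1 S U f -> jC1 S U g -> jC1 S U (fun s x => f s x + g s x).
Proof.
move=> [df cf cdf] [dg cg cdg]; split=> [s x Ss Ux||v].
- exact: (differentiableD (df s x Ss Ux) (dg s x Ss Ux)).
- exact: jcD.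
apply: (jc_eq (f := fun s x => 'D_v (f s) x + 'D_v (g s) x)) => [s x Ss Ux|]; last exact: jcD.
by rewrite -deriveD//; apply: diff_derivable; [exact: df|exact: dg].
Qed.

Lemma jC1M S U f g : jC1 S U f -> jC1 S U g -> jC1 S U (fun s x => f s x * g s x).
Proof.
move=> [df cf cdf] [dg cg cdg]; split=> [s x Ss Ux||v].
- exact: (differentiableM (df s x Ss Ux) (dg s x Ss Ux)).
- exact: jcM.
apply: (jc_eq (f := fun s x => f s x * 'D_v (g s) x + g s x * 'D_v (f s) x)) => [s x Ss Ux|].
  apply/esym; apply: (deriveM (f := f s) (g := g s)); apply: diff_derivable; [exact: df|exact: dg].
by apply: jcD; exact: jcM.
Qed.

Lemma jC1Z S U f a : jC1 S U f -> jC1 S U (fun s x => a * f s x).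
Proof. by move=> cf; apply: jC1M => //; exact: jC1_cst. Qed.

Lemma jC1B S U f g : jC1 S U f -> jC1 S U g -> jC1 S U (fun s x => f s x - g s x).
Proof.
move=> cf cg; have := jC1D cf (jC1Z (-1) cg).
by congr (jC1 _ _ _); apply/funext => s; apply/funext => x; rewrite mulN1r.
Qed.

Lemma jC1_sum {I : Type} S U (r : seq I) (P : pred I) (f : I -> R -> V -> R) :
  (forall i, P i -> jC1 S U (f i)) -> jC1 S U (fun s x => \sum_(i <- r | P i) f i s x).
Proof.
move=> cf; elim: r => [|i r IH].
  have := jC1_cst S U 0; congr (jC1 _ _ _).
  by apply/funext => s; apply/funext => x; rewrite big_nil.
case: (boolP (P i)) => Pi.
  have := jC1D (cf i Pi) IH; congr (jC1 _ _ _).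
  by apply/funext => s; apply/funext => x; rewrite big_cons Pi.
move: IH; congr (jC1 _ _ _).
by apply/funext => s; apply/funext => x; rewrite big_cons (negbTE Pi).
Qed.

Lemma jC1_prod {I : Type} S U (r : seq I) (P : pred I) (f : I -> R -> V -> R) :
  (forall i, P i -> jC1 S U (f i)) -> jC1 S U (fun s x => \prod_(i <- r | P i) f i s x).
Proof.
move=> cf; elim: r => [|i r IH].
  have := jC1_cst S U 1; congr (jC1 _ _ _).
  by apply/funext => s; apply/funext => x; rewrite big_nil.
case: (boolP (P i)) => Pi.
  have := jC1M (cf i Pi) IH; congr (jC1 _ _ _).
  by apply/funext => s; apply/funext => x; rewrite big_cons Pi.
move: IH; congr (jC1 _ _ _).
by apply/funext => s; apply/funext => x; rewrite big_cons (negbTE Pi).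
Qed.

Lemma derive_comp1 (phi : R -> R) (f : V -> R) (x v : V) (a : R) :
  differentiable f x -> is_derive (f x) (1 : R) phi a ->
  differentiable (phi \o f) x /\ 'D_v (phi \o f) x = a * 'D_v f x.
Proof.
move=> df [dphi <-].
have dphi' : differentiable phi (f x) by apply/derivable1_diffP.
have dc : differentiable (phi \o f) x by exact: differentiable_comp.
split => //; rewrite !deriveE// diff_comp//= deriv1E// derive1E deriveE//.
by rewrite /GRing.scale/= mul1r mulrC.
Qed.

Lemma jC1_comp S U f (phi phi' : R -> R) : jC1 S U f ->
  (forall s x, S s -> U x -> is_derive (f s x) (1 : R) phi (phi' (f s x))) ->
  (forall s x, S s -> U x -> phi' @ nbhs (f s x) --> phi' (f s x)) ->
  jC1 S U (fun s x => phi (f s x)).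
Proof.
move=> [df cf cdf] dphi cphi; split=> [s x Ss Ux||v].
- exact: (derive_comp1 0 (df s x Ss Ux) (dphi s x Ss Ux)).1.
- apply: jc_comp => // s x Ss Ux; have [dp _] := dphi s x Ss Ux.
  by apply: differentiable_continuous; apply/derivable1_diffP.
apply: (jc_eq (f := fun s x => phi' (f s x) * 'D_v (f s) x)) => [s x Ss Ux|].
  by rewrite (derive_comp1 v (df s x Ss Ux) (dphi s x Ss Ux)).2.
by apply: jcM; [exact: jc_comp|exact: cdf].
Qed.

Lemma jC1V S U f : jC1 S U f -> (forall s x, S s -> U x -> f s x != 0) ->
  jC1 S U (fun s x => (f s x)^-1).
Proof.
move=> cf f0; apply: (@jC1_comp _ _ _ (fun y => y^-1) (fun y => - (y ^- 2))) => //.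
  move=> s x Ss Ux; have h := f0 s x Ss Ux.
  split; first exact: (@derivableV _ _ id).
  by rewrite (@deriveV _ _ id)// derive_id /GRing.scale/= mulr1.
move=> s x Ss Ux; apply: cvgN; apply: cvgV; first by rewrite expf_neq0// f0.
by apply: cvgM; exact: cvg_id.
Qed.

Lemma jC1_sqrt S U f : jC1 S U f -> (forall s x, S s -> U x -> 0 < f s x) ->
  jC1 S U (fun s x => Num.sqrt (f s x)).
Proof.
move=> cf f0; apply: (@jC1_comp _ _ _ Num.sqrt (fun y => (2 * Num.sqrt y)^-1)) => //.
  by move=> s x Ss Ux; apply: is_derive1_sqrt; exact: f0.
move=> s x Ss Ux; apply: cvgV; first by rewrite mulf_neq0// sqrtr_eq0 -ltNge f0.
by apply: cvgM; [exact: cvg_cst|exact: sqrt_continuous].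
Qed.

(** Needed for two maps: the shift h to t + h, which puts the time under study at parameter 0, and
    constant maps, which freeze a time. *)
Lemma jC1_reparam S S' U f (phi : R -> R) : continuous phi -> (forall s, S' s -> S (phi s)) ->
  jC1 S U f -> jC1 S' U (fun s => f (phi s)).
Proof.
move=> cphi SS [df cf cdf].
have H g : jc S U g -> jc S' U (fun s => g (phi s)).
  move=> cg s x Ss Ux.
  apply: (@cvg_comp _ _ _ (fun z : R * V => (phi z.1, z.2)) (fun z => g z.1 z.2) _
    (within (S `*` U) (nbhs (phi s, x)))); last by apply: cg => //; exact: SS.
  have h : (fun z : R * V => (phi z.1, z.2)) @ within (S' `*` U) (nbhs (s, x)) --> (phi s, x).
    apply: cvg_within_filter.
    have h1 : (fun z : R * V => phi z.1) @ nbhs (s, x) --> phi s.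
      by apply: (@cvg_comp _ _ _ fst phi _ (nbhs s)); [exact: cvg_fst|exact: cphi].
    have h2 : snd @ nbhs (s, x) --> x by exact: cvg_snd.
    exact: (cvg_pair h1 h2).
  move=> A hA.
  have H2 : nbhs (s, x) (fun z : R * V => (S' `*` U) z -> ((S `*` U) (phi z.1, z.2) -> A (phi z.1, z.2))) := h _ hA.
  have H3 : nbhs (s, x) (fun z : R * V => (S' `*` U) z -> A (phi z.1, z.2)).
    apply: (filterS _ H2) => z H [S'z Uz].
    by apply: H => //; split => //; exact: SS.
  exact: H3.
split=> [s x Ss Ux||v]; [by apply: df => //; exact: SS|exact: H|exact: (H (fun s => 'D_v (f s)))].
Qed.

Lemma jC1_const S S' U f s : S s -> jC1 S U f -> jC1 S' U (fun _ => f s).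
Proof. by move=> Ss; apply: (jC1_reparam (phi := fun=> s)) => // x; exact: cvg_cst. Qed.

Definition jC1m {m n} S U (A : R -> V -> 'M[R]_(m, n)) := forall i j, jC1 S U (fun s x => A s x i j).

Lemma jC1m_mul {m n p} S U (A : R -> V -> 'M[R]_(m, n)) (B : R -> V -> 'M[R]_(n, p)) :
  jC1m S U A -> jC1m S U B -> jC1m S U (fun s x => A s x *m B s x).
Proof.
move=> cA cB i j.
rewrite (_ : (fun s x => _) = fun s x => \sum_k A s x i k * B s x k j).
  by apply: jC1_sum => k _; apply: jC1M; [exact: cA|exact: cB].
by apply/funext => s; apply/funext => x; rewrite mxE.
Qed.

Lemma jC1m_tr {m n} S U (A : R -> V -> 'M[R]_(m, n)) : jC1m S U A -> jC1m S U (fun s x => (A s x)^T).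
Proof.
move=> cA i j; have := cA j i; congr (jC1 _ _ _).
by apply/funext => s; apply/funext => x; rewrite mxE.
Qed.

Lemma jC1m_det {n} S U (A : R -> V -> 'M[R]_n) : jC1m S U A -> jC1 S U (fun s x => \det (A s x)).
Proof.
move=> cA; apply: jC1_sum => s _; apply: jC1Z; apply: jC1_prod => i _; exact: cA.
Qed.

Lemma jC1m_cofactor {n} S U (A : R -> V -> 'M[R]_n) i j : jC1m S U A ->
  jC1 S U (fun s x => cofactor (A s x) i j).
Proof.
move=> cA; apply: jC1Z; apply: (@jC1m_det _ S U (fun s x => row' i (col' j (A s x)))) => k l.
have := cA (lift i k) (lift j l); congr (jC1 _ _ _).
by apply/funext => s; apply/funext => x; rewrite !mxE.
Qed.

End JointC1.

(** * Mean value arguments, mixed derivatives, integrals over a chart domain *)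

Section LocalCalculus.
Context {R : realType}.
Notation rVI := rV_integral.

Lemma nbhsS {T : topologicalType} (x : T) (P Q : set T) :
  (forall y, P y -> Q y) -> nbhs x P -> nbhs x Q.
Proof. by move=> PQ; apply: filterS. Qed.

Lemma MVT01 (F f : R -> R) (h : R) : 0 <= h ->
  (forall s : R, 0 <= s <= h -> is_derive s (1 : R) F (f s)) ->
  exists2 s : R, 0 <= s <= h & F h - F 0 = f s * h.
Proof.
move=> h0 dF.
have cF : {within `[0, h], continuous F}.
  apply: continuous_in_subspaceT => s /set_mem /=; rewrite in_itv /= => sh.
  by apply: differentiable_continuous; apply/derivable1_diffP; have [] := dF s sh.
have dF' s : s \in `]0, h[%R -> is_derive s (1 : R) F (f s).
  by rewrite in_itv/= => /andP[s0 sh]; apply: dF; rewrite !ltW.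
have [s] := MVT_segment h0 dF' cF; rewrite in_itv/= subr0 => sh ->.
by exists s.
Qed.

Lemma derive_sum_basis {d} (f : 'rV[R]_d -> R) x v : differentiable f x ->
  'D_v f x = \sum_i v 0 i * 'D_('e_i) f x.
Proof.
move=> df; rewrite deriveE// {1}(row_sum_delta v) linear_sum.
by apply: eq_bigr => i _; rewrite linearZ /= -deriveE.
Qed.

(** Along the segment from x' to x the mean value theorem is applied to f minus its linear part at
    x0. Each of the d partial derivatives changes by at most e / (d + 1) near x0; adding 1 keeps the
    quotient meaningful for d = 0. *)
Lemma C1_strong {d} (f : 'rV[R]_d -> R) U x0 : open U -> U x0 ->
  (forall x, U x -> differentiable f x) ->
  (forall v, 'D_v f @ nbhs x0 --> 'D_v f x0) ->
  forall e, 0 < e -> exists2 r, 0 < r & forall x x', `|x0 - x| < r -> `|x0 - x'| < r ->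
    `|f x - f x' - 'D_(x - x') f x0| <= e * `|x - x'|.
Proof.
move=> oU Ux0 df cdf e e0.
have d0 : 0 < (d%:R + 1 : R) by rewrite ltr_wpDl.
have e' : 0 < e / (d%:R + 1) by rewrite divr_gt0.
have HU : nbhs x0 U by exact: open_nbhs_nbhs.
have HD : \forall x \near x0, forall i : 'I_d, `|'D_('e_i) f x0 - 'D_('e_i) f x| <= e / (d%:R + 1).
  by apply: (filter_forall (nbhs_filter x0)) => i; have /cvgrPdist_le /(_ _ e') := cdf 'e_i.
have /nbhs_ballP [r /= r0 hr] : nbhs x0 (fun x => U x /\ forall i : 'I_d, `|'D_('e_i) f x0 - 'D_('e_i) f x| <= e / (d%:R + 1)).
  by apply: filterI.
exists r => // x x' xr x'r; set v := x - x'.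
have seg s : 0 <= s <= 1 -> `|x0 - (s *: v + x')| < r.
  move=> /andP[s0 s1].
  have -> : x0 - (s *: v + x') = s *: (x0 - x) + (1 - s) *: (x0 - x').
    rewrite /v; apply/rowP => i; rewrite !mxE; ring.
  apply: le_lt_trans (ler_normD _ _) _; rewrite !normrZ (ger0_norm s0) ger0_norm ?subr_ge0//.
  have [s00|s00] := eqVneq s 0; first by rewrite s00 mul0r add0r subr0 mul1r.
  have sp : 0 < s by rewrite lt_neqAle eq_sym s00.
  have : s * `|x0 - x| < s * r by rewrite ltr_pM2l.
  have : (1 - s) * `|x0 - x'| <= (1 - s) * r by rewrite ler_wpM2l ?subr_ge0// ltW.
  by lra.
have segB s : 0 <= s <= 1 -> ball x0 r (s *: v + x') by move=> /seg; rewrite -ball_normE.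
have dd (s : R) : 0 <= s <= 1 -> is_derive s (1 : R) (fun s => f (s *: v + x') - s * 'D_v f x0)
    ('D_v f (s *: v + x') - 'D_v f x0).
  move=> /segB /hr [Us _].
  have := line_is_derive (diff_derivable (v := v) (df _ Us)) => ?.
  by apply: is_derive_eq; rewrite /GRing.scale/= mulr0 add0r mulr1.
have [s s01] := MVT01 ler01 dd.
rewrite !scale1r subrK scale0r add0r mul0r subr0 mulr1 mul1r addrAC => ->.
have [Us Hs] := hr _ (segB s s01).
rewrite (derive_sum_basis v (df _ Us)) (derive_sum_basis v (df _ Ux0)) -sumrB.
apply: le_trans (ler_norm_sum _ _ _) _.
apply: (@le_trans _ _ (\sum_(i < d) `|v| * (e / (d%:R + 1)))).
  apply: ler_sum => i _; rewrite -mulrBr normrM ler_pM//; first exact: rV_norm_ge.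
  by rewrite distrC; exact: Hs.
rewrite sumr_const card_ord -[leLHS]mulr_natr.
rewrite [leLHS](_ : _ = e * `|v| * (d%:R / (d%:R + 1))); last by ring.
apply: ler_piMr; first by rewrite mulr_ge0// ltW.
by rewrite ler_pdivrMr// mul1r lerDl.
Qed.

(** Two mean value theorems: one in direction a for the difference of f along two parallel segments,
    then one in direction b for the derivative so obtained. *)
Lemma second_difference {V : normedModType R} (f : V -> R) (U : set V) (x a b : V) (h : R) :
  0 <= h -> (forall y, U y -> differentiable f y) ->
  (forall y, U y -> differentiable ('D_a f) y) ->
  (forall s t, 0 <= s <= h -> 0 <= t <= h -> U (x + s *: a + t *: b)) ->
  exists s t, [/\ 0 <= s <= h, 0 <= t <= h &
    f (x + h *: a + h *: b) - f (x + h *: a) - (f (x + h *: b) - f x)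
      = 'D_b ('D_a f) (x + s *: a + t *: b) * h * h].
Proof.
move=> h0 df ddf sub.
have hh : 0 <= h <= h by rewrite h0 lexx.
have h00 : 0 <= (0 : R) <= h by rewrite h0 lexx.
have dg (s : R) : 0 <= s <= h -> is_derive s (1 : R) (fun s => f (s *: a + (x + h *: b)) - f (s *: a + x))
    ('D_a f (s *: a + (x + h *: b)) - 'D_a f (s *: a + x)).
  move=> sh.
  have U1 : U (s *: a + (x + h *: b)) by rewrite addrA (addrC _ x); exact: sub.
  have U2 : U (s *: a + x) by have := sub s 0 sh h00; rewrite scale0r addr0 addrC.
  have := line_is_derive (diff_derivable (v := a) (df _ U1)) => ?.
  have := line_is_derive (diff_derivable (v := a) (df _ U2)) => ?.
  by apply: is_derive_eq.
have [s sh Es] := MVT01 h0 dg.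
have dk (t : R) : 0 <= t <= h -> is_derive t (1 : R) (fun t => 'D_a f (t *: b + (s *: a + x)))
    ('D_b ('D_a f) (t *: b + (s *: a + x))).
  move=> th; apply: line_is_derive; apply: diff_derivable; apply: ddf.
  by rewrite addrC (addrC _ x); exact: sub.
have [t th Et] := MVT01 h0 dk.
exists s, t; split => //.
rewrite (_ : x + s *: a + t *: b = t *: b + (s *: a + x)); last by rewrite addrC (addrC x).
rewrite -Et scale0r add0r.
rewrite (_ : h *: b + (s *: a + x) = s *: a + (x + h *: b)); last by rewrite addrCA (addrC x).
rewrite -Es scale0r !add0r (_ : h *: a + (x + h *: b) = x + h *: a + h *: b); last by rewrite addrCA addrA.
by rewrite (addrC (h *: a)).
Qed.

(** The second difference over a small parallelogram is symmetric in a and b. Both mixed derivatives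
    thus take a common value at two points close to x, and continuity at x brings them within 2e of
    each other. *)
Lemma schwarz {V : normedModType R} (f : V -> R) (U : set V) (x a b : V) :
  open U -> U x -> (forall y, U y -> differentiable f y) ->
  (forall y, U y -> differentiable ('D_a f) y) ->
  (forall y, U y -> differentiable ('D_b f) y) ->
  'D_b ('D_a f) @ nbhs x --> 'D_b ('D_a f) x ->
  'D_a ('D_b f) @ nbhs x --> 'D_a ('D_b f) x ->
  'D_b ('D_a f) x = 'D_a ('D_b f) x.
Proof.
move=> oU Ux df da db cab cba.
apply/eqP; rewrite -subr_eq0; apply/eqP; apply: (@norm_small _ _ 2) => // e e0.
have /nbhs_ballP [r /= r0 hr] : nbhs x (fun y => [/\ U y, `|'D_b ('D_a f) x - 'D_b ('D_a f) y| <= e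
     & `|'D_a ('D_b f) x - 'D_a ('D_b f) y| <= e]).
  move/cvgrPdist_le : cab => /(_ _ e0) h1; move/cvgrPdist_le : cba => /(_ _ e0) h2.
  have h3 : nbhs x U by exact: open_nbhs_nbhs.
  apply: (nbhsS _ (filterI h3 (filterI h1 h2))) => y [Uy [k1 k2]].
  exact: And3 Uy k1 k2.
pose h := r / (`|a| + `|b| + 1) / 2.
have C0 : 0 < `|a| + `|b| + 1 by rewrite ltr_wpDl// addr_ge0.
have h0 : 0 < h by rewrite !divr_gt0.
have hE : h * (`|a| + `|b| + 1) = r / 2 by rewrite /h; field; rewrite gt_eqF.
have inb s t : 0 <= s <= h -> 0 <= t <= h -> ball x r (x + s *: a + t *: b).
  move=> /andP[s0 sh] /andP[t0 th]; rewrite -ball_normE /= -addrA opprD addrA subrr sub0r normrN.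
  apply: le_lt_trans (ler_normD _ _) _; rewrite !normrZ (ger0_norm s0) (ger0_norm t0).
  have : s * `|a| <= h * `|a| by rewrite ler_wpM2r.
  have : t * `|b| <= h * `|b| by rewrite ler_wpM2r.
  by lra.
have inb' s t : 0 <= s <= h -> 0 <= t <= h -> ball x r (x + s *: b + t *: a).
  by move=> sh th; rewrite -addrA (addrC (s *: b)) addrA; exact: inb.
have inU s t : 0 <= s <= h -> 0 <= t <= h -> U (x + s *: a + t *: b).
  by move=> sh th; have [] := hr _ (inb s t sh th).
have inU' s t : 0 <= s <= h -> 0 <= t <= h -> U (x + s *: b + t *: a).
  by move=> sh th; have [] := hr _ (inb' s t sh th).
have [s [t [sh th E1]]] := second_difference (ltW h0) df da inU.
have [s' [t' [sh' th' E2]]] := second_difference (ltW h0) df db inU'.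
have E : 'D_b ('D_a f) (x + s *: a + t *: b) = 'D_a ('D_b f) (x + s' *: b + t' *: a).
  have E12 : 'D_b ('D_a f) (x + s *: a + t *: b) * h * h = 'D_a ('D_b f) (x + s' *: b + t' *: a) * h * h.
    apply: (etrans (esym E1)); apply: (etrans _ E2).
    rewrite (_ : x + h *: b + h *: a = x + h *: a + h *: b); last by rewrite addrAC.
    by ring.
  move: E12; move: ('D_b ('D_a f) _) ('D_a ('D_b f) _) => p q E12.
  exact: (mulIf (lt0r_neq0 h0) (mulIf (lt0r_neq0 h0) E12)).
have [_ k1 _] := hr _ (inb _ _ sh th).
have [_ _ k2] := hr _ (inb' _ _ sh' th').
move: k1 k2; rewrite -E.
move: ('D_b ('D_a f) _) ('D_a ('D_b f) x) ('D_b ('D_a f) x) => w q p k1 k2.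
have -> : e * 2 = e + e by ring.
apply: le_trans (_ : `|(p - w) - (q - w)| <= _); first by rewrite opprB addrA subrK.
by apply: le_trans (ler_normB _ _) _; exact: lerD.
Qed.

Lemma indic_mul_near {V : normedModType R} (U : set V) (h : V -> R) x : open U -> U x ->
  \forall y \near x, h y = \1_U y * h y.
Proof.
by move=> oU Ux; apply: (nbhsS _ (@open_indic_near R _ U x oU Ux)) => y ->; rewrite mul1r.
Qed.

Lemma indic_continuous {V : normedModType R} (U : set V) (h : V -> R) x : open U -> U x ->
  h @ nbhs x --> h x -> (fun y => \1_U y * h y) @ nbhs x --> \1_U x * h x.
Proof.
move=> oU Ux ch; rewrite -(nbhs_singleton (indic_mul_near h oU Ux)).
by apply: cvg_trans ch; apply: near_eq_cvg; exact: indic_mul_near.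
Qed.

(** Functions read in a chart are controlled on U only. Vanishing on U outside a compact subset of
    U, they become continuous on the whole space once multiplied by the indicator, the form under
    which [surface_integral] integrates them. *)
Lemma Cc_indic {V : normedModType R} (U L : set V) (h : V -> R) : open U -> compact L -> L `<=` U ->
  (forall x, U x -> h @ nbhs x --> h x) -> (forall x, U x -> ~ L x -> h x = 0) ->
  Cc (fun x => \1_U x * h x).
Proof.
move=> oU cL LU ch h0; apply: (Cc_extend cL LU) => [x Ux|x nL].
  by apply: indic_continuous => //; exact: ch.
by rewrite indicE; have [/set_mem Ux|] := boolP (x \in U); rewrite ?mul0r// h0// mulr0.
Qed.

(** The extension by 0 agrees with h near points of L and with 0 near all other points, so it has a
    continuous derivative along v and [rVI_derive] applies. *)
Lemma rVI_derive_indic {d} (U L : set 'rV[R]_d) (h : 'rV[R]_d -> R) v : open U -> compact L -> L `<=` U ->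
  (forall x, U x -> differentiable h x) -> (forall x, U x -> 'D_v h @ nbhs x --> 'D_v h x) ->
  (forall x, U x -> ~ L x -> h x = 0) ->
  rVI (fun x => \1_U x * 'D_v h x) = 0.
Proof.
move=> oU cL LU dh cdh h0.
pose u x := \1_U x * h x.
have cu : Cc u.
  by apply: (Cc_indic oU cL LU) => // x Ux; exact: (differentiable_continuous (dh x Ux)).
have cloL : closed L by apply: compact_closed => //; exact: norm_hausdorff.
have u0 x : ~ L x -> \forall y \near x, (fun=> 0) y = u y.
  move=> nL; have : nbhs x (~` L) by apply: open_nbhs_nbhs; split => //; exact: closed_openC.
  apply: filterS => y nLy; rewrite /u indicE; have [/set_mem Uy|] := boolP (y \in U); rewrite ?mul0r//.
  by rewrite h0// mulr0.
have uE x : U x -> \forall y \near x, h y = u y by move=> Ux; exact: indic_mul_near.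
have Du x : 'D_v u x = \1_U x * 'D_v h x.
  rewrite indicE; have [/set_mem Ux|/negP nU] := boolP (x \in U).
    by rewrite mul1r; apply/esym; apply: near_eq_derive; exact: uE.
  rewrite mul0r; have nL : ~ L x by move=> /LU Ux; apply: nU; exact: mem_set.
  by rewrite -(near_eq_derive v (u0 x nL)) (derive_cst (0 : R)).
have Dh0 x : U x -> ~ L x -> 'D_v h x = 0.
  move=> Ux nL; rewrite (near_eq_derive v (uE x Ux)) -(near_eq_derive v (u0 x nL)).
  exact: (derive_cst (0 : R)).
have <- : 'D_v u = (fun x => \1_U x * 'D_v h x) by apply/funext.
apply: rVI_derive => //.
  move=> x; have [Lx|nL] := pselect (L x).
    have Ux := LU x Lx; apply: (near_eq_derivable (uE x Ux)).
    by apply: diff_derivable; exact: dh.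
  by apply: (near_eq_derivable (u0 x nL)); exact: (derivable_cst (0 : R)).
have -> : 'D_v u = (fun x => \1_U x * 'D_v h x) by apply/funext.
by apply: (Cc_indic oU cL LU cdh Dh0).1.
Qed.

(** Joint continuity with the common support L does the work of a dominated convergence theorem. *)
Lemma rVI_jc_cvg {d} S (U L : set 'rV[R]_d) (f : R -> 'rV[R]_d -> R) s0 : open U -> compact L -> L `<=` U ->
  jc S U f -> (forall s x, S s -> U x -> ~ L x -> f s x = 0) -> S s0 ->
  (fun s => rVI (fun x => \1_U x * f s x)) @ within S (nbhs s0) --> rVI (fun x => \1_U x * f s0 x).
Proof.
move=> oU cL LU cf f0 Ss0.
have cfs s : S s -> forall x, U x -> f s @ nbhs x --> f s x.
  move=> Ss x Ux.
  have h : (fun y => (s, y)) @ nbhs x --> within (S `*` U) (nbhs (s, x)).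
    have h1 : (fun y => (s, y)) @ nbhs x --> (s, x).
      have a1 : (fun=> s) @ nbhs x --> s by exact: cvg_cst.
      have a2 : id @ nbhs x --> x by exact: cvg_id.
      exact: (cvg_pair a1 a2).
    move=> A hA; have hA' : nbhs x (fun y => (S `*` U) (s, y) -> A (s, y)) := h1 _ hA.
    have hU : nbhs x U by exact: open_nbhs_nbhs.
    by apply: (nbhsS _ (filterI hU hA')) => y [Uy]; apply; split.
  exact: (@cvg_comp _ _ _ (fun y => (s, y)) (fun z => f z.1 z.2) _ _ _ h (cf s x Ss Ux)).
have cc s : S s -> Cc (fun x => \1_U x * f s x).
  by move=> Ss; apply: (Cc_indic oU cL LU) => // x Ux; [exact: cfs|exact: f0].
have [N N0 hN] := compact_norm_bound cL.
have sN s : S s -> supp_in N (fun x => \1_U x * f s x).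
  move=> Ss x Nx; rewrite indicE; have [/set_mem Ux|] := boolP (x \in U); rewrite ?mul0r//.
  by rewrite f0 ?mulr0// => /hN; rewrite leNgt Nx.
have cloL : closed L by apply: compact_closed => //; exact: norm_hausdorff.
apply: (@rVI_cvg _ _ _ (within S (nbhs s0)) _ N).
- have : \forall s \near within S (nbhs s0), S s by exact: withinT.
  by apply: filterS => s Ss; split; [exact: (cc s Ss).1|exact: sN].
- exact: (cc s0 Ss0).1.
- exact: sN.
move=> x _; set F := filter_prod _ _; have FF : Filter F by exact: filter_prod_filter.
have SF : \forall i \near F, S i.2.
  by exists (setT, S) => [|[y s] []//]; split; [exact: filterT|exact: withinT].
have [Lx|nL] := pselect (L x).
  have Ux := LU x Lx.
  have hU : nbhs x U by exact: open_nbhs_nbhs.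
  have iF : \forall i \near F, U i.1.
    by exists (U, setT) => [|[y s] []//]; split; [exact: hU|exact: filterT].
  have sw : (fun i => (i.2, i.1)) @ F --> (s0, x).
    have h1 : snd @ F --> s0.
      have h : snd @ F --> within S (nbhs s0) by exact: cvg_snd.
      exact: (cvg_trans h (cvg_within _)).
    have h2 : fst @ F --> x by exact: cvg_fst.
    exact: (cvg_pair h1 h2).
  have sw' : (fun i => (i.2, i.1)) @ F --> within (S `*` U) (nbhs (s0, x)).
    move=> A hA; have hA' : \forall i \near F, (S `*` U) (i.2, i.1) -> A (i.2, i.1) := sw _ hA.
    have : \forall i \near F, A (i.2, i.1).
      by apply: filterS2 (filterI SF iF) hA' => -[y s] /= [Ss Uy]; apply.
    by [].
  have := @cvg_comp _ _ _ (fun i => (i.2, i.1)) (fun z => f z.1 z.2) _ _ _ sw' (cf s0 x Ss0 Ux).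
  rewrite -(nbhs_singleton (indic_mul_near (f s0) oU Ux)).
  apply: cvg_trans; apply: near_eq_cvg.
  by apply: filterS iF => -[y s] /= Uy; rewrite indicE mem_set// mul1r.
have z0 s y : S s -> ~ L y -> \1_U y * f s y = 0.
  by move=> Ss nLy; rewrite indicE; have [/set_mem Uy|] := boolP (y \in U); rewrite ?mul0r// f0// mulr0.
rewrite z0//; apply: cvg_near_cst.
have nLF : \forall i \near F, ~ L i.1.
  exists (~` L, setT) => [|[y s] []//]; split; last exact: filterT.
  by apply: open_nbhs_nbhs; split => //; exact: closed_openC.
by apply: filterS2 SF nLF => -[y s] /= Ss nLy; exact: z0.
Qed.

End LocalCalculus.

(** * From the function spaces of the statement to joint continuity *)

Section Conversions.
Context {R : realType}.

Lemma uniform_near {V W : normedModType R} {I : Type} (F : set_system I) {FF : Filter F}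
    (K : set V) (G : I -> V -> W) (f : V -> W) :
  {uniform K, G i @[i --> F] --> f} ->
  forall e, 0 < e -> \forall i \near F, forall y, K y -> `|f y - G i y| < e.
Proof.
move=> h e e0.
apply: (h [set g | forall y, K y -> `|f y - g y| < e]).
apply/uniform_nbhs; exists [set z | ball z.1 e z.2]; split; first by rewrite -entourage_ballE; exists e.
by move=> g /= hg y /hg; rewrite -ball_normE.
Qed.

Lemma family_near {V W : normedModType R} {I : Type} (F : set_system I) {FF : Filter F}
    (U K : set V) (G : I -> V -> W) (f : V -> W) :
  {family [set K | compact K /\ K `<=` U], G i @[i --> F] --> f} ->
  compact K -> K `<=` U ->
  forall e, 0 < e -> \forall i \near F, forall y, K y -> `|f y - G i y| < e.
Proof.
move=> /fam_cvgP h cK KU; apply: uniform_near; exact: h.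
Qed.

Lemma ball_compact {d} (x : 'rV[R]_d) r : compact [set y : 'rV[R]_d | `|x - y| <= r].
Proof.
apply: bounded_closed_compact.
  exists (`|x| + r); split; [exact: num_real|] => M NM y /= xy.
  have := ler_normB x (x - y); rewrite subKr => h.
  by apply: le_trans h _; apply: le_trans (ltW NM); rewrite lerD2l.
have -> : [set y : 'rV[R]_d | `|x - y| <= r] = (fun y : 'rV[R]_d => `|x - y|) @^-1` [set y | y <= r] by [].
apply: closed_comp => // y _.
have h1 : (fun=> x) @ nbhs y --> x by exact: cvg_cst.
have h2 : id @ nbhs y --> y by exact: cvg_id.
exact: (cvg_norm (cvgB h1 h2)).
Qed.

Lemma within_open_cvg {V : topologicalType} {W : topologicalType} (U : set V) (f : V -> W) x :
  open U -> U x -> {within U, continuous f} -> f @ nbhs x --> f x.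
Proof.
by move=> oU Ux; rewrite continuous_open_subspace// => /(_ x (mem_set Ux)).
Qed.

(** A closed ball around x inside U is one of the compact sets of the family: on it the convergence
    in time is uniform, and the limit is continuous in space. *)
Lemma family_jc {d} {W : normedModType R} (I : set R) (U : set 'rV[R]_d) (F : R -> 'rV[R]_d -> W) :
  open U -> (forall t, I t -> {within U, continuous (F t)}) ->
  (forall t, I t -> {family [set K | compact K /\ K `<=` U],
          F s @[s --> within I (nbhs t)] --> F t}) -> jc I U F.
Proof.
move=> oU cF hF t x It Ux.
have /nbhs_ballP [r /= r0 hr] : nbhs x U by exact: open_nbhs_nbhs.
have r2 : 0 < r / 2 by rewrite divr_gt0.
set K := [set y : 'rV[R]_d | `|x - y| <= r / 2].
have KU : K `<=` U.
  move=> y /= xy; apply: hr; rewrite -ball_normE /=; apply: le_lt_trans xy _.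
  by rewrite gtr_pMr// invf_lt1 ?ltr1n.
apply/cvgrPdist_le => e e0.
have e2 : 0 < e / 2 by rewrite divr_gt0.
have h1 := family_near (hF t It) (@ball_compact d x (r / 2)) KU e2.
have /cvgrPdist_le /(_ _ e2) h2 := within_open_cvg oU Ux (cF t It).
have hK : nbhs x K.
  apply/nbhs_ballP; exists (r / 2) => // y; rewrite -ball_normE /=; exact: ltW.
have H1 : nbhs t (fun s => I s -> forall y, K y -> `|F t y - F s y| < e / 2) by exact: h1.
have H2 : nbhs x (fun y => K y /\ `|F t x - F t y| <= e / 2) by exact: filterI.
suff : nbhs (t, x) (fun z : R * 'rV[R]_d => (I `*` U) z -> `|F t x - F z.1 z.2| <= e) by [].
exists ((fun s => I s -> forall y, K y -> `|F t y - F s y| < e / 2), (fun y => K y /\ `|F t x - F t y| <= e / 2)) => //.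
move=> [s y] /= [h3 [Ky h4]] [Is Uy].
rewrite (_ : F t x - F s y = (F t x - F t y) + (F t y - F s y)); last by rewrite addrA subrK.
by rewrite (le_trans (ler_normD _ _))// (splitr e) lerD// ltW// h3.
Qed.

Lemma within_jc {V W : normedModType R} (S : set R) (U : set V) (f : V -> W) :
  open U -> {within U, continuous f} -> jc S U (fun _ => f).
Proof.
move=> oU cf s x Ss Ux; apply: cvg_within_filter.
apply: (@cvg_comp _ _ _ snd f _ (nbhs x)); first exact: cvg_snd.
exact: within_open_cvg cf.
Qed.

Lemma jC1_coord {V : normedModType R} {n} (S : set R) (U : set V) (F : R -> V -> 'rV[R]_n) k :
  (forall s x, S s -> U x -> differentiable (F s) x) -> jc S U F ->
  (forall v, jc S U (fun s => 'D_v (F s))) ->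
  jC1 S U (fun s x => F s x 0 k) /\
  forall s x v, S s -> U x -> 'D_v (fun x => F s x 0 k) x = ('D_v (F s) x) 0 k.
Proof.
move=> dF cF cdF.
have DE s x v : S s -> U x -> 'D_v (fun x => F s x 0 k) x = ('D_v (F s) x) 0 k.
  by move=> Ss Ux; rewrite derive_mx ?mxE//; apply: diff_derivable; exact: dF.
have cc (f : R -> V -> 'rV[R]_n) : jc S U f -> jc S U (fun s x => f s x 0 k).
  move=> cf; apply: (jc_comp (phi := fun y : 'rV[R]_n => y 0 k)) => // s x _ _.
  exact: coord_continuous.
split => //; split => [s x Ss Ux||v].
- apply: (differentiable_comp (g := fun y : 'rV[R]_n => y 0 k)); first exact: dF.
  exact: differentiable_coord.
- exact: cc.
apply: (jc_eq (f := fun s x => ('D_v (F s) x) 0 k)) => [s x Ss Ux|]; first by rewrite DE.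
exact: (cc _ (cdF v)).
Qed.

Definition jC2 {V : normedModType R} (S : set R) (U : set V) (f : R -> V -> R) :=
  jC1 S U f /\ forall v, jC1 S U (fun s => 'D_v (f s)).

Lemma jC2_reparam {V : normedModType R} (S S' : set R) (U : set V) f (phi : R -> R) :
  continuous phi -> (forall s, S' s -> S (phi s)) ->
  jC2 S U f -> jC2 S' U (fun s => f (phi s)).
Proof.
move=> cphi SS [cf cdf]; split=> [|v]; first exact: jC1_reparam cf.
exact: (jC1_reparam cphi SS (cdf v)).
Qed.

Lemma C0_C2_jC2 {d} (I : set R) (U : set 'rV[R]_d) (F : R -> 'rV[R]_d -> R) :
  open U -> C0_Ck_on 2 I U F -> jC2 I U F.
Proof.
move=> oU [c0 f0 [d0 H1]].
have cF := family_jc oU c0 f0.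
have cD v : jc I U (fun t => 'D_v (F t)) by have [c1 f1 _] := H1 v; exact: family_jc.
split; first by split => // s x Ss Ux; exact: d0.
move=> v; have [_ _ [d1 H2]] := H1 v; split => // w.
by have [c2 f2 _] := H2 w; exact: family_jc.
Qed.

Lemma C0_C2_coord {d n} (I : set R) (U : set 'rV[R]_d) (F : R -> 'rV[R]_d -> 'rV[R]_n) k :
  open U -> C0_Ck_on 2 I U F -> jC2 I U (fun s x => F s x 0 k) /\
  forall s x v, I s -> U x -> 'D_v (fun x => F s x 0 k) x = ('D_v (F s) x) 0 k.
Proof.
move=> oU [c0 f0 [d0 H1]].
have cF := family_jc oU c0 f0.
have cD v : jc I U (fun t => 'D_v (F t)) by have [c1 f1 _] := H1 v; exact: family_jc.
have d0' s x : I s -> U x -> differentiable (F s) x by move=> Is Ux; exact: d0.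
have [J1 DE] := jC1_coord k d0' cF cD; split => //; split => // v.
have [_ _ [d1 H2]] := H1 v.
have cDD w : jc I U (fun t => 'D_w ('D_v (F t))) by have [c2 f2 _] := H2 w; exact: family_jc.
have d1' s x : I s -> U x -> differentiable ('D_v (F s)) x by move=> Is Ux; exact: d1.
have [J2 _] := jC1_coord k d1' (cD v) cDD.
by apply: (jC1_eq oU _ J2) => s x Is Ux; rewrite DE.
Qed.

Lemma Ck2_jC2 {d} (I : set R) (U : set 'rV[R]_d) (F : 'rV[R]_d -> R) :
  open U -> Ck_on 2 U F -> jC2 I U (fun _ => F).
Proof.
move=> oU [c0 [d0 H1]].
have cD v : jc I U (fun _ => 'D_v F) by have [c1 _] := H1 v; exact: within_jc.
split; first by split => //; [move=> s x _; exact: d0|exact: within_jc].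
move=> v; have [_ [d1 H2]] := H1 v; split => [s x _|//|w]; first exact: d1.
by have [c2 _] := H2 w; exact: (within_jc (f := 'D_w ('D_v F))).
Qed.

(** Filling in the value at h = 0 turns that point into an ordinary parameter value, so the limit of
    the difference quotients becomes a case of joint continuity. *)
Definition dquot (T : R) {X : Type} {W : normedModType R} (f : R -> X -> W) (t h : R) (p : X) : W :=
  if h == 0 then dtime T f t p else h^-1 *: (f (t + h) p - f t p).

Lemma within_comp_cvg {d} {V W : normedModType R} (M : set V) (U : set 'rV[R]_d)
    (phi : 'rV[R]_d -> V) (g : V -> W) x :
  open U -> U x -> {within U, continuous phi} -> (forall x, U x -> M (phi x)) ->
  {within M, continuous g} -> (fun x => g (phi x)) @ nbhs x --> g (phi x).
Proof.
move=> oU Ux cphi phiM /subspace_continuousP /(_ _ (phiM x Ux)) cg.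
have h : phi @ nbhs x --> within M (nbhs (phi x)).
  move=> A hA.
  have hA' : nbhs x (fun y => M (phi y) -> A (phi y)) := within_open_cvg oU Ux cphi hA.
  have hU : nbhs x U by exact: open_nbhs_nbhs.
  by apply: (nbhsS _ (filterI hU hA')) => y [Uy]; apply; exact: phiM.
exact: (@cvg_comp _ _ _ phi g _ _ _ h cg).
Qed.

(** At h = 0 this is the uniform convergence of the quotients in C^0(M) together with the continuity
    of the time derivative; at other h it follows from the joint continuity of f. *)
Lemma dquot_jc (T t : R) {d} {V W : normedModType R} (M : set V) (U : set 'rV[R]_d)
    (phi : 'rV[R]_d -> V) (f : R -> V -> W) :
  open U -> {within U, continuous phi} -> (forall x, U x -> M (phi x)) -> 0 <= t <= T ->
  C1_C0 T M f -> jc `[0, T] U (fun s x => f s (phi x)) ->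
  jc [set h | 0 <= t + h <= T] U (fun h x => dquot T f t h (phi x)).
Proof.
move=> oU cphi phiM tT cf jf h0 x Sh Ux.
set S := [set h | 0 <= t + h <= T].
have [c0 u0 cd _] := cf t tT.
have [h00|h00] := eqVneq h0 0.
  have E0 : dquot T f t 0 (phi x) = dtime T f t (phi x) by rewrite /dquot eqxx.
  rewrite h00 E0; apply/cvgrPdist_le => e e0.
  have e2 : 0 < e / 2 by rewrite divr_gt0.
  have /cvgrPdist_le /(_ _ e2) h2 := within_comp_cvg oU Ux cphi phiM cd.
  have h1 := uniform_near u0 e2.
  have H1 : nbhs (0 : R) (fun h => h != 0 -> S h -> forall y, M y -> `|dtime T f t y - h^-1 *: (f (t + h) y - f t y)| < e / 2).
    by exact: h1.
  have H2 : nbhs x (fun y => `|dtime T f t (phi x) - dtime T f t (phi y)| <= e / 2) by exact: h2.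
  suff : nbhs ((0 : R), x) (fun z : R * 'rV[R]_d => (S `*` U) z -> `|dtime T f t (phi x) - dquot T f t z.1 (phi z.2)| <= e) by [].
  exists ((fun h : R => h != 0 -> S h -> forall y, M y -> `|dtime T f t y - h^-1 *: (f (t + h) y - f t y)| < e / 2) : set R,
     (fun y : 'rV[R]_d => `|dtime T f t (phi x) - dtime T f t (phi y)| <= e / 2) : set 'rV[R]_d) => //.
  move=> [h y] /= [h3 h4] [Sh' Uy]; rewrite /dquot; case: ifPn => [_|hn0].
    by apply: le_trans h4 _; rewrite ler_piMr ?(ltW e0)// invf_le1 ?ler1n.
  rewrite -(subrKA (dtime T f t (phi y))) (le_trans (ler_normD _ _))// (splitr e) lerD// ltW//.
  by apply: h3 => //; exact: phiM.
have hI : (fun z : R * 'rV[R]_d => z.1) @ within (S `*` U) (nbhs (h0, x)) --> h0.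
  by apply: cvg_within_filter; exact: cvg_fst.
have sub g : jc `[0, T] U g -> (fun z : R * 'rV[R]_d => g (t + z.1) z.2) @ within (S `*` U) (nbhs (h0, x)) --> (g (t + h0) x : W).
  move=> cg; apply: (@cvg_comp _ _ _ (fun z : R * 'rV[R]_d => (t + z.1, z.2)) (fun z => g z.1 z.2) _
    (within (`[0, T] `*` U) (nbhs (t + h0, x)))); last by apply: cg => //=; rewrite in_itv.
  have hh : (fun z : R * 'rV[R]_d => (t + z.1, z.2)) @ nbhs (h0, x) --> (t + h0, x).
    have a1 : (fun z : R * 'rV[R]_d => t + z.1) @ nbhs (h0, x) --> t + h0.
      have b1 : (fun z : R * 'rV[R]_d => t) @ nbhs (h0, x) --> t by exact: cvg_cst.
      have b2 : fst @ nbhs (h0, x) --> h0 by exact: cvg_fst.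
      exact: (cvgD b1 b2).
    have a2 : snd @ nbhs (h0, x) --> x by exact: cvg_snd.
    exact: (cvg_pair a1 a2).
  move=> A hA.
  have H2 : nbhs (h0, x) (fun z : R * 'rV[R]_d => (`[0, T]%classic `*` U) (t + z.1, z.2) -> A (t + z.1, z.2)) := hh _ hA.
  have H3 : nbhs (h0, x) (fun z : R * 'rV[R]_d => (S `*` U) z -> A (t + z.1, z.2)).
    by apply: (nbhsS _ H2) => z H [Sz Uz]; apply: H; split => //=; rewrite in_itv.
  exact: H3.
have sub0 g : jc `[0, T] U g -> (fun z : R * 'rV[R]_d => g t z.2) @ within (S `*` U) (nbhs (h0, x)) --> (g t x : W).
  move=> cg; apply: (@cvg_comp _ _ _ (fun z : R * 'rV[R]_d => (t, z.2)) (fun z => g z.1 z.2) _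
    (within (`[0, T] `*` U) (nbhs (t, x)))); last by apply: cg => //=; rewrite in_itv.
  have hh : (fun z : R * 'rV[R]_d => (t, z.2)) @ nbhs (h0, x) --> (t, x).
    have b1 : (fun z : R * 'rV[R]_d => t) @ nbhs (h0, x) --> t by exact: cvg_cst.
    have a2 : snd @ nbhs (h0, x) --> x by exact: cvg_snd.
    exact: (cvg_pair b1 a2).
  move=> A hA.
  have H2 : nbhs (h0, x) (fun z : R * 'rV[R]_d => (`[0, T]%classic `*` U) (t, z.2) -> A (t, z.2)) := hh _ hA.
  have H3 : nbhs (h0, x) (fun z : R * 'rV[R]_d => (S `*` U) z -> A (t, z.2)).
    by apply: (nbhsS _ H2) => z H [Sz Uz]; apply: H; split => //=; rewrite in_itv.
  exact: H3.
have hV : (fun z : R * 'rV[R]_d => z.1^-1) @ within (S `*` U) (nbhs (h0, x)) --> h0^-1 by exact: (cvgV h00 hI).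
have hB : (fun z : R * 'rV[R]_d => z.1^-1 *: (f (t + z.1) (phi z.2) - f t (phi z.2))) @ within (S `*` U) (nbhs (h0, x))
    --> h0^-1 *: (f (t + h0) (phi x) - f t (phi x)).
  exact: (cvgZ hV (cvgB (sub _ jf) (sub0 _ jf))).
have E1 : dquot T f t h0 (phi x) = h0^-1 *: (f (t + h0) (phi x) - f t (phi x)) by rewrite /dquot (negbTE h00).
rewrite E1.
have hn : \forall z \near within (S `*` U) (nbhs (h0, x)), z.1 != 0 by exact: (cvgr_neq0 _ hI h00).
have hE : {near within (S `*` U) (nbhs (h0, x)), (fun z : R * 'rV[R]_d => z.1^-1 *: (f (t + z.1) (phi z.2) - f t (phi z.2))) =1
    (fun z : R * 'rV[R]_d => dquot T f t z.1 (phi z.2))}.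
  by apply: filterS hn => z zn0; rewrite /dquot (negbTE zn0).
apply: (cvg_trans _ hB); exact: near_eq_cvg hE.
Qed.

End Conversions.

(** * Area density and conormal *)

Section DetDifference.
Context {R : comNzRingType} {d : nat}.
Implicit Types A B : 'M[R]_d.

Definition hybrid_rows A B (i : nat) : 'M[R]_d :=
  \matrix_(r, c) if (r < i)%N then B r c else A r c.

(** A divided difference of the determinant: its entries are polynomials in those of A and B, and
    for A = B it is the transposed adjugate, the gradient of the determinant. *)
Definition mixed_cofactor A B : 'M[R]_d := \matrix_(i, j) cofactor (hybrid_rows A B i) i j.

Lemma mixed_cofactor_diag A : mixed_cofactor A A = (\adj A)^T.
Proof.
apply/matrixP => i j; rewrite !mxE; congr cofactor.
by apply/matrixP => r c; rewrite mxE if_same.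
Qed.

(** Telescoping over the rows: consecutive hybrid matrices differ in row i only, and the Laplace
    expansions along that row share their cofactors. The identity is exact, with no higher-order
    term. *)
Lemma det_sub A B : \det B - \det A = \tr ((B - A) *m (mixed_cofactor A B)^T).
Proof.
have step (i : 'I_d) : \det (hybrid_rows A B i.+1) - \det (hybrid_rows A B i) =
    \sum_j (B i j - A i j) * mixed_cofactor A B i j.
  rewrite (expand_det_row _ i) (expand_det_row (hybrid_rows A B i) i) -sumrB.
  apply: eq_bigr => j _; rewrite !mxE ltnSn ltnn mulrBl; congr (_ * _ - _).
  rewrite /cofactor; congr (_ * \det _); apply/matrixP => r c; rewrite !mxE.
  suff -> : (lift i r < i.+1)%N = (lift i r < i)%N by [].
  rewrite ltnS leq_eqVlt; case: eqP => // e.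
  by have := neq_lift i r; rewrite (val_inj e) eqxx.
have h0 : hybrid_rows A B 0 = A by apply/matrixP => r c; rewrite mxE.
have hd : hybrid_rows A B d = B by apply/matrixP => r c; rewrite mxE ltn_ord.
have := telescope_sumr (fun i => \det (hybrid_rows A B i)) (leq0n d).
rewrite h0 hd => <-; rewrite big_mkord /mxtrace; apply: eq_bigr => i _.
by rewrite step mxE; apply: eq_bigr => j _; rewrite !mxE.
Qed.

End DetDifference.

(** * Divided difference of the area density *)

Section GramDifference.
Context {R : realType} {d n : nat}.
Implicit Types P Q : 'M[R]_(d, n).

Definition gram P : 'M[R]_d := P *m P^T.

(* conormal P = sqrt (det g) g^-1 P is the gradient of P |-> sqrt (det (P P^T));
   its divided difference secant_conormal is jointly smooth in (P, Q). *)
Definition conormal P : 'M[R]_(d, n) :=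
  Num.sqrt (\det (gram P)) *: (invmx (gram P) *m P).

Definition secant_conormal P Q : 'M[R]_(d, n) :=
  (Num.sqrt (\det (gram P)) + Num.sqrt (\det (gram Q)))^-1 *:
  (mixed_cofactor (gram P) (gram Q) *m Q + (mixed_cofactor (gram P) (gram Q))^T *m P).

Lemma tr_gram P : (gram P)^T = gram P.
Proof. by rewrite /gram trmx_mul trmxK. Qed.

Lemma mxtrace_mulT m (A B : 'M[R]_(m, n)) : \tr (A *m B^T) = \sum_i \sum_j A i j * B i j.
Proof. by apply: eq_bigr => i _; rewrite mxE; apply: eq_bigr => j _; rewrite mxE. Qed.

(** The square roots are handled by r - s = (r^2 - s^2) / (r + s), the determinants by [det_sub],
    and the Gram matrices by Q Q^T - P P^T = (Q - P) Q^T + P (Q - P)^T. The last summand produces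
    the transposed cofactor matrix. *)
Lemma sqrt_det_gram_sub P Q : 0 < \det (gram P) -> 0 < \det (gram Q) ->
  Num.sqrt (\det (gram Q)) - Num.sqrt (\det (gram P)) =
  \sum_i \sum_j (Q i j - P i j) * secant_conormal P Q i j.
Proof.
move=> P0 Q0; set k := mixed_cofactor (gram P) (gram Q).
set s := Num.sqrt (\det (gram P)); set r := Num.sqrt (\det (gram Q)).
have s0 : 0 < s by rewrite sqrtr_gt0.
have r0 : 0 < r by rewrite sqrtr_gt0.
have sr : s + r != 0 by rewrite gt_eqF// addr_gt0.
have E : \det (gram Q) - \det (gram P) = \tr ((Q - P) *m (k *m Q + k^T *m P)^T).
  rewrite det_sub -/k raddfD mulmxDr raddfD /= !trmx_mul trmxK.
  have -> : gram Q - gram P = (Q - P) *m Q^T + P *m (Q - P)^T.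
    by rewrite /gram raddfB /= mulmxBl mulmxBr addrA subrK.
  rewrite mulmxDl raddfD /= -!mulmxA; congr (_ + _).
  by rewrite -mxtrace_tr !trmx_mul !trmxK -mulmxA mxtrace_mulC -mulmxA.
have -> : r - s = (s + r)^-1 * (\det (gram Q) - \det (gram P)).
  rewrite -(sqr_sqrtr (ltW Q0)) -(sqr_sqrtr (ltW P0)) -/s -/r; field; exact: sr.
rewrite E mxtrace_mulT mulr_sumr; apply: eq_bigr => i _.
rewrite mulr_sumr; apply: eq_bigr => j _; rewrite [(Q - P) i j]mxE [(- P) i j]mxE.
by rewrite [secant_conormal _ _ _ _]mxE -/k -/s -/r mulrCA.
Qed.

Lemma secant_conormal_diag P : 0 < \det (gram P) -> secant_conormal P P = conormal P.
Proof.
move=> P0; rewrite /secant_conormal mixed_cofactor_diag trmxK.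
have uP : gram P \in unitmx by rewrite unitmxE unitfE gt_eqF.
have aE : \adj (gram P) = \det (gram P) *: invmx (gram P).
  by rewrite /invmx uP scalerA mulfV ?scale1r// gt_eqF.
have aT : (\adj (gram P))^T = \adj (gram P) by rewrite trmx_adj tr_gram.
rewrite aT aE /conormal -!scalemxAl -scalerDl scalerA; congr (_ *: _).
set s := Num.sqrt _; have s0 : 0 < s by rewrite sqrtr_gt0.
rewrite -(sqr_sqrtr (ltW P0)) -/s; field; rewrite ?gt_eqF//; exact: addr_gt0.
Qed.

Lemma conormal_mulT P : \det (gram P) != 0 -> conormal P *m P^T = (Num.sqrt (\det (gram P)))%:M.
Proof.
move=> P0; have uP : gram P \in unitmx by rewrite unitmxE unitfE.
by rewrite /conormal -scalemxAl -mulmxA -/(gram P) mulVmx// scalemx1.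
Qed.

End GramDifference.

(** * Positivity of the Gram determinant and the normal line *)

Section GramPositive.
Context {R : realType}.

Lemma cvg_big_sum {I : Type} {T : Type} (F : set_system T) {FF : Filter F} (r : seq I) (P : pred I) (f : I -> T -> R) (a : I -> R) :
  (forall i, f i @ F --> a i) -> (fun x => \sum_(i <- r | P i) f i x) @ F --> \sum_(i <- r | P i) a i.
Proof.
move=> fa; elim: r => [|i r IH].
  by rewrite big_nil; under eq_fun do rewrite big_nil; exact: cvg_cst.
rewrite big_cons; under eq_fun do rewrite big_cons.
by case: (P i) => //; apply: cvgD.
Qed.

Lemma cvg_big_prod {I : Type} {T : Type} (F : set_system T) {FF : Filter F} (r : seq I) (P : pred I) (f : I -> T -> R) (a : I -> R) :
  (forall i, f i @ F --> a i) -> (fun x => \prod_(i <- r | P i) f i x) @ F --> \prod_(i <- r | P i) a i.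
Proof.
move=> fa; elim: r => [|i r IH].
  by rewrite big_nil; under eq_fun do rewrite big_nil; exact: cvg_cst.
rewrite big_cons; under eq_fun do rewrite big_cons.
by case: (P i) => //; apply: cvgM.
Qed.

Lemma cvg_det {d} {T : Type} (F : set_system T) {FF : Filter F} (f : T -> 'M[R]_d) (A : 'M[R]_d) :
  (forall i j, (fun x => f x i j) @ F --> A i j) -> (fun x => \det (f x)) @ F --> \det A.
Proof.
move=> fA; apply: cvg_big_sum => s; apply: cvgM; first exact: cvg_cst.
exact: cvg_big_prod.
Qed.

Lemma dotv_self_ge0 n (v : 'rV[R]_n) : 0 <= dotv v v.
Proof. by apply: sumr_ge0 => i _; rewrite -expr2 sqr_ge0. Qed.

Lemma dotv_self_eq0 n (v : 'rV[R]_n) : dotv v v = 0 -> v = 0.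
Proof.
move=> /eqP; rewrite psumr_eq0 => [/allP h|i _]; last by rewrite -expr2 sqr_ge0.
apply/rowP => i; rewrite mxE; apply/eqP.
by have := h i (mem_index_enum i); rewrite mulf_eq0 orbb.
Qed.

Lemma dotvE n (u v : 'rV[R]_n) : dotv u v = (u *m v^T) 0 0.
Proof. by rewrite mxE; apply: eq_bigr => i _; rewrite mxE. Qed.

(** On the path s P P^T + (1 - s) I the matrices are positive definite, hence invertible. The
    determinant starts at 1 for s = 0 and cannot change sign, by the intermediate value theorem. *)
Lemma det_gram_gt0 d n (P : 'M[R]_(d, n)) : row_free P -> 0 < \det (gram P).
Proof.
move=> fP.
pose q s : 'M[R]_d := s *: gram P + (1 - s)%:M.
have q0 s : 0 <= s <= 1 -> \det (q s) != 0.
  move=> /andP[s0 s1]; apply/negP => /eqP /eqP /det0P [v v0 vq].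
  have : dotv (v *m q s) v = 0 by rewrite vq dotvE mul0mx mxE.
  have -> : dotv (v *m q s) v = s * dotv (v *m P) (v *m P) + (1 - s) * dotv v v.
    rewrite !dotvE /q mulmxDr -scalemxAr mul_mx_scalar mulmxDl -!scalemxAl.
    by rewrite trmx_mul /gram !mulmxA !mxE.
  move=> /eqP; have p1 : 0 <= s * dotv (v *m P) (v *m P) by rewrite mulr_ge0// dotv_self_ge0.
  have p2 : 0 <= (1 - s) * dotv v v by rewrite mulr_ge0// ?subr_ge0// dotv_self_ge0.
  rewrite paddr_eq0// => /andP[/eqP e1 /eqP e2].
  have [s00|s00] := eqVneq s 1.
    rewrite s00 mul1r in e1; have vP := dotv_self_eq0 e1.
    by move/eqP: v0; apply; apply: (row_free_inj fP); rewrite vP mul0mx.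
  move/eqP: e2; rewrite mulf_eq0 subr_eq0 eq_sym (negbTE s00) /= => /eqP /dotv_self_eq0 vv.
  by rewrite vv eqxx in v0.
have cq : continuous (fun s => \det (q s)).
  move=> s; apply: cvg_det => i j.
  have -> : (fun s => q s i j) = (fun s => s * gram P i j + (1 - s) * (1%:M : 'M[R]_d) i j).
    by apply/funext => t; rewrite !mxE mulr_natr.
  have -> : q s i j = s * gram P i j + (1 - s) * (1%:M : 'M[R]_d) i j by rewrite !mxE mulr_natr.
  apply: cvgD; apply: cvgM; try exact: cvg_cst; first exact: cvg_id.
  by apply: cvgB; [exact: cvg_cst|exact: cvg_id].
have q1 : q 1 = gram P by rewrite /q scale1r subrr raddf0 addr0.
have qq0 : \det (q 0) = 1 by rewrite /q scale0r add0r subr0 det1.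
rewrite -q1 lt_neqAle eq_sym q0 ?ler01 ?lexx//= leNgt; apply/negP => neg.
have [|c] := @IVT R (fun s => \det (q s)) 0 1 0 ler01 (continuous_subspaceT cq).
  rewrite qq0 ge_min le_max ler01 (ltW neg) orbT//.
by rewrite in_itv /= => /q0 /eqP.
Qed.

(** P has rank d in dimension d + 1, so the vectors orthogonal to its rows form a line, spanned by
    nu. *)
Lemma normal_span d (P : 'M[R]_(d, d.+1)) (nu v : 'rV[R]_d.+1) : row_free P ->
  nu *m P^T = 0 -> dotv nu nu = 1 -> v *m P^T = 0 -> v = dotv v nu *: nu.
Proof.
move=> fP nuP nu1 vP.
have nu0 : nu != 0.
  apply/negP => /eqP nu0; move: nu1; rewrite nu0 dotvE mul0mx mxE => /eqP.
  by rewrite eq_sym oner_eq0.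
have rk : \rank (kermx P^T) = 1%N.
  by rewrite mxrank_ker mxrank_tr (eqP fP) subSnn.
have nk : (nu <= kermx P^T)%MS by apply/sub_kermxP.
have vk : (v <= kermx P^T)%MS by apply/sub_kermxP.
have kn : (kermx P^T <= nu)%MS.
  have := mxrank_leqif_sup nk; rewrite rk rank_rV nu0 => -[_].
  by rewrite eqxx => <-.
have /sub_rVP [a va] := submx_trans vk kn.
rewrite va; congr (_ *: _).
by rewrite dotvE -scalemxAl mxE -dotvE nu1 mulr1.
Qed.

End GramPositive.

(** * Regularity of area densities and conormals *)

Section JointGram.
Context {R : realType} {V : normedModType R}.

Lemma jC1m_gram {d n} (S : set R) (U : set V) (P : R -> V -> 'M[R]_(d, n)) :
  jC1m S U P -> jC1m S U (fun s x => gram (P s x)).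
Proof. by move=> cP; apply: jC1m_mul => //; exact: jC1m_tr. Qed.

Lemma jC1m_mixed {d} (S : set R) (U : set V) (A B : R -> V -> 'M[R]_d) :
  jC1m S U A -> jC1m S U B -> jC1m S U (fun s x => mixed_cofactor (A s x) (B s x)).
Proof.
move=> cA cB i j; rewrite (_ : (fun s x => _) = fun s x => cofactor (hybrid_rows (A s x) (B s x) i) i j).
  apply: jC1m_cofactor => r c; rewrite (_ : (fun s x => _) = fun s x => if (r < i)%N then B s x r c else A s x r c).
    by case: ltnP => _; [exact: cB|exact: cA].
  by apply/funext => s; apply/funext => x; rewrite mxE.
by apply/funext => s; apply/funext => x; rewrite mxE.
Qed.

Lemma jC1_sqrt_det {d n} (S : set R) (U : set V) (P : R -> V -> 'M[R]_(d, n)) :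
  jC1m S U P -> (forall s x, S s -> U x -> row_free (P s x)) ->
  jC1 S U (fun s x => Num.sqrt (\det (gram (P s x)))).
Proof.
move=> cP fP; apply: jC1_sqrt; first by apply: jC1m_det; exact: jC1m_gram.
by move=> s x Ss Ux; apply: det_gram_gt0; exact: fP.
Qed.

Lemma jC1m_secant {d n} (S : set R) (U : set V) (P Q : R -> V -> 'M[R]_(d, n)) :
  jC1m S U P -> jC1m S U Q -> (forall s x, S s -> U x -> row_free (P s x)) ->
  (forall s x, S s -> U x -> row_free (Q s x)) ->
  jC1m S U (fun s x => secant_conormal (P s x) (Q s x)).
Proof.
move=> cP cQ fP fQ i j.
have ck := jC1m_mixed (jC1m_gram cP) (jC1m_gram cQ).
have c1 := jC1m_mul ck cQ.
have c2 := jC1m_mul (jC1m_tr ck) cP.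
have cs := jC1D (jC1_sqrt_det cP fP) (jC1_sqrt_det cQ fQ).
have csV : jC1 S U (fun s x => (Num.sqrt (\det (gram (P s x))) + Num.sqrt (\det (gram (Q s x))))^-1).
  apply: jC1V cs _ => s x Ss Ux; rewrite gt_eqF// addr_gt0// sqrtr_gt0; apply: det_gram_gt0; [exact: fP|exact: fQ].
have := jC1M csV (jC1D (c1 i j) (c2 i j)); congr (jC1 _ _ _).
by apply/funext => s; apply/funext => x; rewrite !mxE.
Qed.

Lemma jC1m_conormal {d n} (S : set R) (U : set V) (P : R -> V -> 'M[R]_(d, n)) : open U ->
  jC1m S U P -> (forall s x, S s -> U x -> row_free (P s x)) ->
  jC1m S U (fun s x => conormal (P s x)).
Proof.
move=> oU cP fP i j; apply: (jC1_eq oU _ (jC1m_secant cP cP fP fP i j)) => s x Ss Ux.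
by rewrite secant_conormal_diag// det_gram_gt0// fP.
Qed.

End JointGram.

(** * Surface operators in a chart, expressed by the conormal *)

Section ChartAlgebra.
Context {R : realType} {d : nat}.
Implicit Types (F Y : 'rV[R]_d -> 'rV[R]_d.+1) (u : 'rV[R]_d -> R).

Definition Dmx {n} (F : 'rV[R]_d -> 'rV[R]_n) x : 'M[R]_(d, n) := \matrix_(b, k) ('D_('e_b) F x) 0 k.

Lemma Dmx_jacobian {n} (F : 'rV[R]_d -> 'rV[R]_n) x : differentiable F x -> 'J F x = Dmx F x.
Proof. by move=> dF; apply/matrixP => b k; rewrite !mxE deriveE. Qed.

Lemma metricE F x : metric F x = gram (Dmx F x).
Proof. by apply/matrixP => i j; rewrite !mxE; apply: eq_bigr => k _; rewrite !mxE. Qed.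

Lemma area_densityE F x : area_density F x = Num.sqrt (\det (gram (Dmx F x))).
Proof. by rewrite /area_density metricE. Qed.

Lemma dotvC n (a b : 'rV[R]_n) : dotv a b = dotv b a.
Proof. by apply: eq_bigr => i _; rewrite mulrC. Qed.

Lemma invmx_gram_sym n (P : 'M[R]_(d, n)) i j : invmx (gram P) i j = invmx (gram P) j i.
Proof. by rewrite -[in LHS](tr_gram P) -trmx_inv mxE. Qed.

Lemma conormalE n (P : 'M[R]_(d, n)) b k :
  conormal P b k = Num.sqrt (\det (gram P)) * \sum_i invmx (gram P) b i * P i k.
Proof. by rewrite mxE mxE. Qed.

Lemma grad_coordE F u x k :
  grad_coord F u x 0 k = \sum_b 'D_('e_b) u x * \sum_i invmx (gram (Dmx F x)) b i * Dmx F x i k.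
Proof.
rewrite /grad_coord metricE summxE.
under eq_bigr => i _ do rewrite summxE.
rewrite exchange_big /=; apply: eq_bigr => j _; rewrite mulr_sumr; apply: eq_bigr => i _.
by rewrite !mxE invmx_gram_sym mulrCA mulrA.
Qed.

(** Multiplication by the area density trades the inverse metric for the conormal, the shape in
    which gradients and divergences enter the integrals. *)
Lemma grad_coord_conormal F u x k :
  area_density F x * grad_coord F u x 0 k = \sum_b 'D_('e_b) u x * conormal (Dmx F x) b k.
Proof.
rewrite grad_coordE area_densityE mulr_sumr; apply: eq_bigr => b _.
by rewrite conormalE mulrCA.
Qed.

Lemma grad_coord_dot F u x B :
  area_density F x * dotv (grad_coord F u x) B =
  \sum_b 'D_('e_b) u x * \sum_k conormal (Dmx F x) b k * B 0 k.
Proof.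
rewrite /dotv mulr_sumr.
under eq_bigr => k _ do rewrite mulrA grad_coord_conormal mulr_suml.
rewrite exchange_big /=; apply: eq_bigr => b _; rewrite mulr_sumr.
by apply: eq_bigr => k _; rewrite mulrA.
Qed.

Lemma div_coord_conormal F Y x :
  area_density F x * div_coord F Y x =
  \sum_b \sum_k conormal (Dmx F x) b k * ('D_('e_b) Y x) 0 k.
Proof.
rewrite area_densityE /div_coord metricE mulr_sumr; apply: eq_bigr => b _.
under [RHS]eq_bigr => k _ do rewrite conormalE -mulrA mulr_suml.
rewrite -mulr_sumr; congr (_ * _); rewrite exchange_big /=; apply: eq_bigr => j _.
rewrite /dotv mulr_sumr; apply: eq_bigr => k _; rewrite !mxE; ring.
Qed.

End ChartAlgebra.

(** * Divergence of the conormal and mean curvature *)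

Section ChartCalculus.
Context {R : realType} {d : nat}.
Notation rVI := rV_integral.

Lemma jc_cvg {V W : normedModType R} (S : set R) (U : set V) (f : R -> V -> W) s x :
  open U -> jc S U f -> S s -> U x -> f s @ nbhs x --> f s x.
Proof.
move=> oU cf Ss Ux.
have h : (fun y => (s, y)) @ nbhs x --> within (S `*` U) (nbhs (s, x)).
  have h1 : (fun y => (s, y)) @ nbhs x --> (s, x).
    have a1 : (fun=> s) @ nbhs x --> s by exact: cvg_cst.
    have a2 : id @ nbhs x --> x by exact: cvg_id.
    exact: (cvg_pair a1 a2).
  move=> A hA; have hA' : nbhs x (fun y => (S `*` U) (s, y) -> A (s, y)) := h1 _ hA.
  have hU : nbhs x U by exact: open_nbhs_nbhs.
  by apply: (nbhsS _ (filterI hU hA')) => y [Uy]; apply; split.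
exact: (@cvg_comp _ _ _ (fun y => (s, y)) (fun z => f z.1 z.2) _ _ _ h (cf s x Ss Ux)).
Qed.

Lemma sum_delta {n} (q : 'I_n -> R) c : \sum_b q b * (b == c)%:R = q c.
Proof.
rewrite (bigD1 c)//= eqxx mulr1 big1 ?addr0// => b /negbTE ->; exact: mulr0.
Qed.

Lemma derive_subr_cst {V : normedModType R} (f : V -> R) (a : R) (x v : V) :
  differentiable f x -> 'D_v (fun y => f y - a) x = 'D_v f x.
Proof.
move=> df.
have e := deriveB (diff_derivable (v := v) df) (derivable_cst a x v).
rewrite derive_cst subr0 in e; exact: e.
Qed.

Lemma derive_sumM {V : normedModType R} {I : Type} (r : seq I) (f g : I -> V -> R) (x v : V) :
  (forall i, differentiable (f i) x) -> (forall i, differentiable (g i) x) ->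
  differentiable (fun y => \sum_(i <- r) f i y * g i y) x /\
  'D_v (fun y => \sum_(i <- r) f i y * g i y) x =
  \sum_(i <- r) (f i x * 'D_v (g i) x + 'D_v (f i) x * g i x).
Proof.
move=> df dg; elim: r => [|i r [IHd IH]].
  rewrite (_ : (fun y => _) = cst 0); last by apply/funext => y; rewrite big_nil.
  by rewrite big_nil derive_cst; split => //; exact: differentiable_cst.
rewrite (_ : (fun y => _) = (f i * g i) + (fun y => \sum_(i <- r) f i y * g i y)); last first.
  by apply/funext => y; rewrite big_cons.
have dfg : differentiable (f i * g i) x by apply: differentiableM; [exact: df|exact: dg].
split; first exact: differentiableD.
rewrite deriveD; [|exact: diff_derivable|exact: diff_derivable].
rewrite IH big_cons deriveM; [|exact: diff_derivable (df i)|exact: diff_derivable (dg i)].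
by congr (_ + _ + _); rewrite /GRing.scale/= mulrC.
Qed.

Variables (U : set 'rV[R]_d) (F : 'rV[R]_d -> 'rV[R]_d.+1).
Hypothesis oU : open U.
Hypothesis FC2 : forall k, jC2 setT U (fun _ x => F x 0 k).
Hypothesis DFE : forall x v k, U x -> 'D_v (fun x => F x 0 k) x = ('D_v F x) 0 k.
Hypothesis FI : forall x, U x -> row_free (Dmx F x).

Let P := Dmx F.
Let Z x := conormal (P x).

Lemma jC1m_Dmx : jC1m setT U (fun _ => P).
Proof.
move=> b k; apply: (jC1_eq oU _ ((FC2 k).2 'e_b)) => s x _ Ux.
by rewrite mxE -DFE.
Qed.

Lemma jC1m_Z : jC1m setT U (fun _ => Z).
Proof. by apply: jC1m_conormal => //; [exact: jC1m_Dmx|move=> s x _; exact: FI]. Qed.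

Let dP x b k : U x -> differentiable (fun y => P y b k) x.
Proof. by move=> Ux; have [h _ _] := jC1m_Dmx b k; exact: (h 0). Qed.

Let dZ x b k : U x -> differentiable (fun y => Z y b k) x.
Proof. by move=> Ux; have [h _ _] := jC1m_Z b k; exact: (h 0). Qed.

(** Near x the density equals its value at x plus the exact sum of the increments of P against the
    secant conormal. At x the increments vanish, so the product rule only keeps their derivatives,
    weighted by the diagonal value Z x. *)
Lemma derive_sqrt_det x v : U x ->
  'D_v (fun y => Num.sqrt (\det (gram (P y)))) x = \sum_b \sum_k Z x b k * 'D_v (fun y => P y b k) x.
Proof.
move=> Ux.
have dS b k : differentiable (fun y => secant_conormal (P x) (P y) b k) x.
  have cP : jC1m setT U (fun (_ : R) (_ : 'rV[R]_d) => P x) by move=> i j; exact: jC1_cst.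
  have [h _ _] := jC1m_secant cP jC1m_Dmx (fun s y _ _ => FI Ux) (fun s y _ Uy => FI Uy) b k.
  exact: (h 0).
have dPx b k : differentiable (fun y => P y b k - P x b k) x.
  by apply: differentiableB; [exact: dP|exact: differentiable_cst].
pose I := ('I_d * 'I_d.+1)%type.
pose f (i : I) y := P y i.1 i.2 - P x i.1 i.2.
pose g (i : I) y := secant_conormal (P x) (P y) i.1 i.2.
have [_ E] := @derive_sumM _ I (index_enum I) f g x v (fun i => dPx i.1 i.2) (fun i => dS i.1 i.2).
have dT : differentiable (fun y => \sum_(i <- index_enum I) f i y * g i y) x.
  by have [] := @derive_sumM _ I (index_enum I) f g x v (fun i => dPx i.1 i.2) (fun i => dS i.1 i.2).
transitivity ('D_v (fun y => Num.sqrt (\det (gram (P x))) + \sum_(i <- index_enum I) f i y * g i y) x).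
  apply: near_eq_derive; have hU : nbhs x U by exact: open_nbhs_nbhs.
  apply: (nbhsS _ hU) => y Uy.
  have := sqrt_det_gram_sub (det_gram_gt0 (FI Ux)) (det_gram_gt0 (FI Uy)).
  by rewrite pair_big /= => /eqP; rewrite subr_eq addrC => /eqP.
rewrite (deriveD (f := cst _)) ?derive_cst ?add0r ?E; [|exact: derivable_cst|exact: diff_derivable].
rewrite pair_big /=; apply: eq_bigr => -[b k] _ /=.
have fx : f (b, k) x = 0 by exact: subrr.
have gx : g (b, k) x = Z x b k by rewrite /g /= secant_conormal_diag ?det_gram_gt0//; exact: FI.
have Df : 'D_v (f (b, k)) x = 'D_v (fun y => P y b k) x by exact: (derive_subr_cst _ _ (dP b k Ux)).
by rewrite fx gx Df mul0r add0r mulrC.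
Qed.

Lemma Dmx_schwarz x b c k : U x ->
  'D_('e_b) (fun y => P y c k) x = 'D_('e_c) (fun y => P y b k) x.
Proof.
move=> Ux; have hU : nbhs x U by exact: open_nbhs_nbhs.
have E a v : 'D_v (fun y => P y a k) x = 'D_v ('D_('e_a) (fun y => F y 0 k)) x.
  by apply: near_eq_derive; apply: (nbhsS _ hU) => y Uy; rewrite mxE DFE.
rewrite !E; have [[df _ _] H] := FC2 k.
apply: (schwarz oU Ux).
- by move=> y Uy; exact: (df 0).
- by move=> y Uy; have [h _ _] := H 'e_c; exact: (h 0).
- by move=> y Uy; have [h _ _] := H 'e_b; exact: (h 0).
- by have [_ _ h] := H 'e_c; exact: (@jc_cvg _ _ _ _ _ 0 x oU (h 'e_b)).
- by have [_ _ h] := H 'e_b; exact: (@jc_cvg _ _ _ _ _ 0 x oU (h 'e_c)).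
Qed.

(** In coordinates this is the area density times the Laplace-Beltrami operator applied to the
    components of F, that is, a density for the mean curvature vector. *)
Definition div_conormal x : 'rV[R]_d.+1 := \row_k \sum_b 'D_('e_b) (fun y => conormal (Dmx F y) b k) x.

(* The tangential part of the divergence of the conormal vanishes, because
   Z P^T = sqrt (det g) and the derivative of sqrt (det g) is Z : DP. *)
Lemma div_conormal_tangent x : U x -> div_conormal x *m (Dmx F x)^T = 0.
Proof.
move=> Ux; apply/rowP => c; rewrite mxE [RHS]mxE.
have hU : nbhs x U by exact: open_nbhs_nbhs.
have E b : \sum_k (Z x b k * 'D_('e_b) (fun y => P y c k) x + 'D_('e_b) (fun y => Z y b k) x * P x c k)
   = 'D_('e_b) (fun y => Num.sqrt (\det (gram (P y)))) x * (b == c)%:R.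
  have [_ <-] := @derive_sumM _ _ (index_enum 'I_d.+1) (fun k y => Z y b k) (fun k y => P y c k) x 'e_b
    (fun k => dZ b k Ux) (fun k => dP c k Ux).
  transitivity ('D_('e_b) (fun y => (b == c)%:R * Num.sqrt (\det (gram (P y)))) x).
    apply: near_eq_derive; apply: (nbhsS _ hU) => y Uy.
    have uP : \det (gram (P y)) != 0 by rewrite gt_eqF// det_gram_gt0//; exact: FI.
    have e := congr1 (fun A : 'M[R]_d => A b c) (conormal_mulT uP).
    rewrite mxE [RHS]mxE in e; rewrite mulr_natl -e.
    by apply: eq_bigr => k _; rewrite [(P y)^T _ _]mxE.
  have dsq : differentiable (fun y => Num.sqrt (\det (gram (P y)))) x.
    by have [h _ _] := jC1_sqrt_det jC1m_Dmx (fun s x _ Ux => FI Ux); exact: (h 0).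
  have e := deriveZ (b == c)%:R (diff_derivable (v := 'e_b) dsq).
  by rewrite mulrC; exact: e.
have S1 : \sum_b 'D_('e_b) (fun y => Num.sqrt (\det (gram (P y)))) x * (b == c)%:R
   = \sum_b \sum_k Z x b k * 'D_('e_b) (fun y => P y c k) x.
  rewrite (sum_delta (fun b => 'D_('e_b) (fun y => Num.sqrt (\det (gram (P y)))) x)).
  rewrite (derive_sqrt_det 'e_c Ux); apply: eq_bigr => b _; apply: eq_bigr => k _.
  by rewrite (Dmx_schwarz b c k Ux).
have : \sum_b \sum_k (Z x b k * 'D_('e_b) (fun y => P y c k) x + 'D_('e_b) (fun y => Z y b k) x * P x c k)
   = \sum_b \sum_k Z x b k * 'D_('e_b) (fun y => P y c k) x.
  by rewrite -S1; apply: eq_bigr => b _; exact: E.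
under eq_bigr => b _ do rewrite big_split.
rewrite big_split /= -[RHS]addr0 => /addrI; rewrite exchange_big /= => E0.
rewrite -[RHS]E0; apply: eq_bigr => k _.
by rewrite [div_conormal x 0 k]mxE [(Dmx F x)^T k c]mxE mulr_suml.
Qed.

(** The product rule, used in two opposite cases. For a normal field Y the left side vanishes, which
    computes the mean curvature; for a tangential Y the first term on the right vanishes, which
    writes the surface divergence as a coordinate divergence. *)
Lemma div_conormal_dot (Y : 'rV[R]_d -> 'rV[R]_d.+1) x : U x ->
  (forall k, differentiable (fun y => Y y 0 k) x) ->
  (forall k v, 'D_v (fun y => Y y 0 k) x = ('D_v Y x) 0 k) ->
  \sum_b 'D_('e_b) (fun y => \sum_k conormal (Dmx F y) b k * Y y 0 k) x =
  dotv (div_conormal x) (Y x) + area_density F x * div_coord F Y x.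
Proof.
move=> Ux dY DY; rewrite div_coord_conormal.
rewrite /dotv (eq_bigr (fun k => \sum_b 'D_('e_b) (fun y => conormal (Dmx F y) b k) x * Y x 0 k)); last first.
  by move=> k _; rewrite mxE mulr_suml.
rewrite exchange_big /= -big_split /=; apply: eq_bigr => b _.
have [_ ->] := @derive_sumM _ _ (index_enum 'I_d.+1) (fun k y => Z y b k) (fun k y => Y y 0 k) x 'e_b
    (fun k => dZ b k Ux) dY.
by rewrite -big_split /=; apply: eq_bigr => k _; rewrite DY addrC.
Qed.

(** The tangential part being 0, the vector is a multiple of nu. The factor comes from
    differentiating the identity that every row of the conormal is orthogonal to nu. *)
Lemma div_conormal_normal (nu : 'rV[R]_d -> 'rV[R]_d.+1) x : U x ->
  (forall k, differentiable (fun y => nu y 0 k) x) ->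
  (forall k v, 'D_v (fun y => nu y 0 k) x = ('D_v nu x) 0 k) ->
  (forall y, U y -> nu y *m (Dmx F y)^T = 0) -> dotv (nu x) (nu x) = 1 ->
  div_conormal x = (- (area_density F x * div_coord F nu x)) *: nu x.
Proof.
move=> Ux dnu Dnu nuP nu1.
have hU : nbhs x U by exact: open_nbhs_nbhs.
rewrite {1}(normal_span (FI Ux) (nuP x Ux) nu1 (div_conormal_tangent Ux)); congr (_ *: _).
have := div_conormal_dot Ux dnu Dnu.
rewrite big1; first by move=> /esym/eqP; rewrite addr_eq0 => /eqP.
move=> b _; transitivity ('D_('e_b) (cst 0 : 'rV[R]_d -> R) x); last by rewrite derive_cst.
apply: near_eq_derive; apply: (nbhsS _ hU) => y Uy.
have : conormal (Dmx F y) *m (nu y)^T = 0.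
  by rewrite /conormal -scalemxAl -mulmxA -[X in _ *m (X *m _)]trmxK -trmx_mul nuP// trmx0 mulmx0 scaler0.
move=> /(congr1 (fun A : 'M[R]_(d, 1) => A b 0)) e; rewrite mxE [RHS]mxE in e.
by rewrite -[RHS]e; apply: eq_bigr => k _; rewrite [(nu y)^T _ _]mxE.
Qed.

End ChartCalculus.

(** * Derivative of the integral in a chart *)

Section ChartDerivative.
Context {R : realType} {d : nat}.
Notation rVI := rV_integral.

Lemma dotvDr n (a b c : 'rV[R]_n) : dotv a (b + c) = dotv a b + dotv a c.
Proof. by rewrite /dotv -big_split; apply: eq_bigr => i _; rewrite mxE mulrDr. Qed.

Lemma dotvZr n (a b : 'rV[R]_n) r : dotv a (r *: b) = r * dotv a b.
Proof. by rewrite /dotv mulr_sumr; apply: eq_bigr => i _; rewrite mxE mulrCA. Qed.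

Lemma dotvZl n (a b : 'rV[R]_n) r : dotv (r *: a) b = r * dotv a b.
Proof. by rewrite dotvC dotvZr dotvC. Qed.

Lemma mulr_factor (i a b h p : R) : i * a - i * b - h * (i * p) = i * (a - b - h * p).
Proof. by ring. Qed.

Lemma increment_ring (X c h p ah a0 s : R) :
  X * (c + h * p) * ah - X * c * a0 - h * (X * p * ah - s) = X * c * (ah - a0) + h * s.
Proof. by ring. Qed.

Lemma product_ring (X Dc DX c z w Dz v : R) :
  ((X * Dc + DX * c) * z + w * Dz) * v = X * (Dc * (z * v)) + c * (DX * (z * v)) + w * (Dz * v).
Proof. by ring. Qed.

(** The cancellations of the whole computation, with X for chi, a for the area density, and gX, gY
    for grad chi against the velocity and against Y. The transport term gc, the curvature term dn qn
    and the terms in c gX drop out; the divergence of chi Y remains. *)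
Lemma integrand_ring (X a c gc dY dn qn gX gY : R) :
  X * (gc + dY - c * dn * qn) * a - (X * (a * gc) + c * (a * gX) + X * c * (- (a * dn) * qn)) + a * (gY + c * gX)
  = X * (a * dY) + a * gY.
Proof. by ring. Qed.

Lemma deriveM_at {V : normedModType R} (f g : V -> R) x v : differentiable f x -> differentiable g x ->
  'D_v (fun y => f y * g y) x = f x * 'D_v g x + 'D_v f x * g x.
Proof.
move=> df dg; have e := deriveM (diff_derivable (v := v) df) (diff_derivable (v := v) dg).
rewrite /GRing.scale/= (mulrC (g x)) in e; exact: e.
Qed.

Lemma derive_outside {V : normedModType R} (U L : set V) (f : V -> R) x v :
  open U -> closed L -> (forall y, U y -> ~ L y -> f y = 0) -> U x -> ~ L x -> 'D_v f x = 0.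
Proof.
move=> oU cL f0 Ux nL; transitivity ('D_v (cst 0 : V -> R) x); last by rewrite derive_cst.
apply: near_eq_derive.
have hU : nbhs x U by exact: open_nbhs_nbhs.
have hL : nbhs x (~` L) by apply: open_nbhs_nbhs; split => //; exact: closed_openC.
by apply: (nbhsS _ (filterI hU hL)) => y [Uy nLy]; exact: f0.
Qed.

(** [F h] and [cc h] stand for the surface and the concentration at time t + h, [q] and [qc] for
    their difference quotients, which at h = 0 are the time derivatives. [Y] stands for the surface
    gradient of G'(c), and [pde] is the equation for c with H replaced by - div nu. *)
Variables (U L : set 'rV[R]_d) (S : set R).
Variables (F q : R -> 'rV[R]_d -> 'rV[R]_d.+1) (cc qc : R -> 'rV[R]_d -> R).
Variables (chi : 'rV[R]_d -> R) (nu Y : 'rV[R]_d -> 'rV[R]_d.+1).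
Hypotheses (oU : open U) (cL : compact L) (LU : L `<=` U) (S0 : S 0).
Hypothesis chiJ : jC1 S U (fun _ => chi).
Hypothesis chi0 : forall x, U x -> ~ L x -> chi x = 0.
Hypothesis F1 : forall k, jC1 S U (fun h x => F h x 0 k).
Hypothesis FP : jC1m S U (fun h => Dmx (F h)).
Hypothesis DFE : forall h x v k, S h -> U x -> 'D_v (fun x => F h x 0 k) x = ('D_v (F h) x) 0 k.
Hypothesis FI : forall h x, S h -> U x -> row_free (Dmx (F h) x).
Hypothesis FC2 : forall k, jC2 setT U (fun _ x => F 0 x 0 k).
Hypothesis ccJ : jC1 S U cc.
Hypothesis qJ : forall k, jc S U (fun h x => q h x 0 k).
Hypothesis qE : forall h x k, S h -> U x -> F h x 0 k - F 0 x 0 k = h * q h x 0 k.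
Hypothesis qcJ : jc S U qc.
Hypothesis qcE : forall h x, S h -> U x -> cc h x - cc 0 x = h * qc h x.
Hypothesis dnu : forall x k, U x -> differentiable (fun y => nu y 0 k) x.
Hypothesis Dnu : forall x k v, U x -> 'D_v (fun y => nu y 0 k) x = ('D_v nu x) 0 k.
Hypothesis nuP : forall x, U x -> nu x *m (Dmx (F 0) x)^T = 0.
Hypothesis nu1 : forall x, U x -> dotv (nu x) (nu x) = 1.
Hypothesis YJ : forall k, jC1 S U (fun _ x => Y x 0 k).
Hypothesis DY : forall x k v, U x -> 'D_v (fun y => Y y 0 k) x = ('D_v Y x) 0 k.
Hypothesis Ynu : forall x, U x -> dotv (Y x) (nu x) = 0.
Hypothesis pde : forall x, U x -> qc 0 x = dotv (q 0 x) (grad_coord (F 0) (cc 0) x)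
  + div_coord (F 0) Y x - cc 0 x * div_coord (F 0) nu x * dotv (q 0 x) (nu x).

Let area h x := Num.sqrt (\det (gram (Dmx (F h) x))).
Let w x := chi x * cc 0 x.
Let Zt h x := secant_conormal (Dmx (F 0) x) (Dmx (F h) x).
Let Z x := conormal (Dmx (F 0) x).
Let G h b k x := w x * Zt h x b k.
(** The integrand of (m h - m 0) / h once the space derivatives have left [q h]. Nothing in it is
    divided by h, so it is jointly continuous up to h = 0. *)
Let Psi h x := chi x * qc h x * area h x - \sum_k (\sum_b 'D_('e_b) (G h b k) x) * q h x 0 k.
Let m h := rVI (fun x => \1_U x * (chi x * cc h x * area h x)).
Let cloL : closed L. Proof. by apply: compact_closed => //; exact: norm_hausdorff. Qed.

Let areaJ : jC1 S U area. Proof. exact: jC1_sqrt_det. Qed.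

Let cc0J : jC1 S U (fun _ => cc 0). Proof. exact: (jC1_const _ S0 ccJ). Qed.

Let wJ : jC1 S U (fun _ => w). Proof. exact: (jC1M chiJ cc0J). Qed.

Let ZtJ : jC1m S U Zt.
Proof.
have a1 : jC1m S U (fun _ => Dmx (F 0)) by move=> i j; exact: (jC1_const (f := fun h x => Dmx (F h) x i j) _ S0 (FP i j)).
exact: (jC1m_secant a1 FP (fun s x _ Ux => FI S0 Ux) FI).
Qed.

Let GJ b k : jC1 S U (fun h => G h b k). Proof. exact: (jC1M wJ (ZtJ b k)). Qed.

Let ZtZ x : U x -> Zt 0 x = Z x.
Proof. by move=> Ux; rewrite /Zt secant_conormal_diag// det_gram_gt0//; exact: FI. Qed.

Let d1 f h x : jC1 S U f -> S h -> U x -> differentiable (f h) x.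
Proof. by move=> [h1 _ _] Sh Ux; exact: h1. Qed.

Let PsiJ : jc S U Psi.
Proof.
have [_ jchi _] := chiJ; have [_ ja _] := areaJ.
apply: jcB; first by apply: jcM => //; exact: jcM.
apply: jc_sum => k _; apply: jcM; last exact: qJ.
by apply: jc_sum => b _; have [_ _ h] := GJ b k; exact: h.
Qed.

Let G0 h b k x : U x -> ~ L x -> G h b k x = 0.
Proof. by move=> Ux nL; rewrite /G /w chi0// !mul0r. Qed.

Let Psi0 h x : S h -> U x -> ~ L x -> Psi h x = 0.
Proof.
move=> Sh Ux nL; rewrite /Psi chi0// !mul0r big1 ?subr0// => k _.
rewrite big1 ?mul0r// => b _.
exact: (derive_outside _ oU cloL (@G0 h b k)).
Qed.

Let Ccf (f : R -> 'rV[R]_d -> R) h : jc S U f -> (forall x, U x -> ~ L x -> f h x = 0) -> S h -> Cc (fun x => \1_U x * f h x).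
Proof.
move=> jf f0 Sh; apply: (Cc_indic oU cL LU) => // x Ux.
exact: (jc_cvg oU jf Sh Ux).
Qed.

Let mJ : jc S U (fun h x => chi x * cc h x * area h x).
Proof.
have [_ jchi _] := chiJ; have [_ ja _] := areaJ; have [_ jcc _] := ccJ.
by apply: jcM => //; exact: jcM.
Qed.

(* The derivatives are moved off F h - F 0 = h q h before h tends to 0: q h is
   only continuous in x, uniformly in h. *)
Lemma increment_eq h : S h -> m h - m 0 = h * rVI (fun x => \1_U x * Psi h x).
Proof.
move=> Sh.
have m0 s x : U x -> ~ L x -> chi x * cc s x * area s x = 0 by move=> Ux nL; rewrite chi0// !mul0r.
have Cm s : S s -> Cc (fun x => \1_U x * (chi x * cc s x * area s x)).
  by move=> Ss; apply: (Ccf (f := fun h x => chi x * cc h x * area h x)) => // x; exact: m0.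
have CP := Ccf PsiJ (fun x => Psi0 Sh) Sh.
apply/eqP; rewrite -subr_eq0 /m -rVIB//; [|exact: Cm|exact: Cm].
rewrite -rVIZ// -rVIB; [|by apply: CcB; exact: Cm|exact: CcZ].
pose eta k x := F h x 0 k - F 0 x 0 k.
have etaJ k : jC1 S U (fun _ => eta k).
  by apply: jC1B; [exact: (jC1_const (f := fun h x => F h x 0 k) _ Sh (F1 k))|exact: (jC1_const (f := fun h x => F h x 0 k) _ S0 (F1 k))].
pose I := ('I_d * 'I_d.+1)%type.
(* The products to be integrated by parts. The two integrands compared differ by the sum of the
   derivatives of [H], each of which has integral 0. *)
pose H (i : I) x := G h i.1 i.2 x * eta i.2 x.
have HJ (i : I) : jC1 S U (fun _ => H i).
  exact: (jC1M (jC1_const (f := fun h => G h i.1 i.2) _ Sh (GJ i.1 i.2)) (etaJ i.2)).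
have H0 (i : I) x : U x -> ~ L x -> H i x = 0 by move=> Ux nL; rewrite /H G0// mul0r.
have HD (i : I) : rVI (fun x => \1_U x * 'D_('e_(i.1)) (H i) x) = 0.
  have [dH _ DH] := HJ i.
  apply: (rVI_derive_indic oU cL LU).
  - by move=> x Ux; exact: (dH 0).
  - move=> x Ux; exact: (jc_cvg oU (DH 'e_(i.1)) S0 Ux).
  - exact: H0.
have CD (i : I) : Cc (fun x => \1_U x * 'D_('e_(i.1)) (H i) x).
  have [_ _ DH] := HJ i.
  apply: (Ccf (f := fun _ => 'D_('e_(i.1)) (H i)) _ _ S0); first exact: DH.
  by move=> x Ux nL; exact: (derive_outside _ oU cloL (H0 i)).
transitivity (rVI (fun x => \sum_(i : I) \1_U x * 'D_('e_(i.1)) (H i) x) == 0); last first.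
  by rewrite rVI_sum// big1 ?eqxx// => i _; exact: HD.
congr (rVI _ == 0); apply/funext => x.
transitivity (\1_U x * (chi x * cc h x * area h x - chi x * cc 0 x * area 0 x - h * Psi h x)).
  exact: mulr_factor.
rewrite -mulr_sumr indicE; have [/set_mem Ux|_] := boolP (x \in U); last by rewrite !mul0r.
congr (_ * _).
have DHx (i : I) : 'D_('e_(i.1)) (H i) x =
    w x * (Zt h x i.1 i.2 * (Dmx (F h) x i.1 i.2 - Dmx (F 0) x i.1 i.2)) + 'D_('e_(i.1)) (G h i.1 i.2) x * (h * q h x 0 i.2).
  rewrite deriveM_at; [|exact: (d1 (GJ i.1 i.2))|exact: (d1 (etaJ i.2) S0)].
  rewrite -qE// -/(eta i.2 x); congr (_ + _); rewrite /G -mulrA; congr (_ * (_ * _)).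
  have dh := d1 (F1 i.2) Sh Ux; have d0 := d1 (F1 i.2) S0 Ux.
  have e := deriveB (diff_derivable (v := 'e_(i.1)) dh) (diff_derivable (v := 'e_(i.1)) d0).
  by rewrite /Dmx !mxE -!DFE//; exact: e.
under eq_bigr => i _ do rewrite DHx.
rewrite big_split /= -mulr_sumr.
have -> : \sum_(i : I) Zt h x i.1 i.2 * (Dmx (F h) x i.1 i.2 - Dmx (F 0) x i.1 i.2) = area h x - area 0 x.
  rewrite /area (sqrt_det_gram_sub (det_gram_gt0 (FI S0 Ux)) (det_gram_gt0 (FI Sh Ux))) pair_big /=.
  by apply: eq_bigr => i _; rewrite mulrC.
have -> : \sum_(i : I) 'D_('e_(i.1)) (G h i.1 i.2) x * (h * q h x 0 i.2) =
    h * \sum_k (\sum_b 'D_('e_b) (G h b k) x) * q h x 0 k.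
  rewrite mulr_sumr (eq_bigr (fun k => \sum_b 'D_('e_b) (G h b k) x * (h * q h x 0 k))); last first.
    by move=> k _; rewrite mulrCA mulr_suml.
  by rewrite exchange_big pair_big.
rewrite /Psi /w; have -> : cc h x = cc 0 x + h * qc h x by rewrite -qcE// addrC subrK.
exact: increment_ring.
Qed.

(** At h = 0 the secant conormal is Z, whose divergence is known. Once the equation is inserted, the
    two integrands add up to the coordinate divergence of chi Z Y, which has compact support in U
    and integrates to 0. *)
Lemma limit_eq : rVI (fun x => \1_U x * Psi 0 x) =
  - rVI (fun x => \1_U x * (area_density (F 0) x * dotv (grad_coord (F 0) chi x) (Y x + cc 0 x *: q 0 x))).
Proof.
pose T b x := \sum_k Z x b k * Y x 0 k.
have ZJ b k : jC1 S U (fun _ x => Z x b k).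
  apply: (jC1_eq oU _ (jC1_const (f := fun h x => Zt h x b k) _ S0 (ZtJ b k))) => s x _ Ux.
  by rewrite -ZtZ.
have TJ b : jC1 S U (fun _ => T b) by apply: jC1_sum => k _; exact: (jC1M (ZJ b k) (YJ k)).
have chiTJ b : jC1 S U (fun _ x => chi x * T b x) by exact: (jC1M chiJ (TJ b)).
have CP := Ccf PsiJ (fun x => Psi0 S0) S0.
pose bdry x := area_density (F 0) x * dotv (grad_coord (F 0) chi x) (Y x + cc 0 x *: q 0 x).
have Dchi0 x v : U x -> ~ L x -> 'D_v chi x = 0 by move=> Ux nL; exact: (derive_outside _ oU cloL chi0).
pose RH x := \sum_b 'D_('e_b) chi x * \sum_k Z x b k * (Y x + cc 0 x *: q 0 x) 0 k.
have RE x : bdry x = RH x by rewrite /bdry grad_coord_dot.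
have [_ _ Dchi] := chiJ; have [_ jcc _] := cc0J.
have RJ : jc S U (fun h x => \sum_b 'D_('e_b) chi x * \sum_k Z x b k * (Y x 0 k + cc 0 x * q h x 0 k)).
  apply: jc_sum => b _; apply: jcM; first exact: Dchi.
  apply: jc_sum => k _; have [_ jZ _] := ZJ b k; have [_ jY _] := YJ k.
  by apply: jcM => //; apply: jcD => //; apply: jcM.
have CR : Cc (fun x => \1_U x * bdry x).
  have -> : (fun x => \1_U x * bdry x) = (fun x => \1_U x * \sum_b 'D_('e_b) chi x * \sum_k Z x b k * (Y x 0 k + cc 0 x * q 0 x 0 k)).
    apply/funext => x; rewrite RE /RH; congr (_ * _); apply: eq_bigr => b _; congr (_ * _).
    by apply: eq_bigr => k _; rewrite !mxE.
  apply: (Ccf RJ) => // x Ux nL; rewrite big1// => b _; by rewrite Dchi0// mul0r.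
apply/eqP; rewrite -addr_eq0 -rVID//.
have HD b : rVI (fun x => \1_U x * 'D_('e_b) (fun x => chi x * T b x) x) = 0.
  have [dH _ DH] := chiTJ b.
  apply: (rVI_derive_indic oU cL LU).
  - by move=> x Ux; exact: (dH 0).
  - by move=> x Ux; exact: (jc_cvg oU (DH 'e_b) S0 Ux).
  - by move=> x Ux nL; rewrite chi0// mul0r.
have CD b : Cc (fun x => \1_U x * 'D_('e_b) (fun x => chi x * T b x) x).
  have [_ _ DH] := chiTJ b.
  apply: (Ccf (f := fun _ => 'D_('e_b) (fun x => chi x * T b x)) _ _ S0); first exact: DH.
  move=> x Ux nL; apply: (derive_outside _ oU cloL _ Ux nL) => y Uy nLy.
  by rewrite chi0// mul0r.
transitivity (rVI (fun x => \sum_b \1_U x * 'D_('e_b) (fun x => chi x * T b x) x) == 0); last first.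
  by rewrite rVI_sum// big1 ?eqxx// => b _; exact: HD.
congr (rVI _ == 0); apply/funext => x.
transitivity (\1_U x * (Psi 0 x + bdry x)); first exact: (esym (mulrDr _ _ _)).
rewrite -mulr_sumr indicE; have [/set_mem Ux|_] := boolP (x \in U); last by rewrite !mul0r.
congr (_ * _).
have FI0 y : U y -> row_free (Dmx (F 0) y) by exact: FI.
have DFE0 y v k : U y -> 'D_v (fun x => F 0 x 0 k) y = ('D_v (F 0) y) 0 k by exact: DFE.
have dY k : differentiable (fun y => Y y 0 k) x by exact: (d1 (YJ k) S0).
have XE := div_conormal_normal oU FC2 DFE0 FI0 Ux (fun k => dnu k Ux) (fun k v => Dnu k v Ux) nuP (nu1 Ux).
have XT := div_conormal_dot oU FC2 DFE0 FI0 Ux dY (fun k v => DY k v Ux).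
have XV V : dotv (div_conormal (F 0) x) V = - (area 0 x * div_coord (F 0) nu x) * dotv V (nu x).
  by rewrite XE dotvZl dotvC /area -area_densityE.
have XY : dotv (div_conormal (F 0) x) (Y x) = 0 by rewrite XV Ynu// mulr0.
have aE : area_density (F 0) x = area 0 x by exact: area_densityE.
rewrite XY add0r aE in XT.
have S1 : \sum_b 'D_('e_b) (fun x => chi x * T b x) x =
    chi x * (area 0 x * div_coord (F 0) Y x) + area 0 x * dotv (grad_coord (F 0) chi x) (Y x).
  rewrite -XT -aE grad_coord_dot mulr_sumr -big_split /=; apply: eq_bigr => b _.
  by rewrite deriveM_at//; [exact: (d1 chiJ S0)|exact: (d1 (TJ b) S0)].
have DG b k : 'D_('e_b) (G 0 b k) x = (chi x * 'D_('e_b) (cc 0) x + 'D_('e_b) chi x * cc 0 x) * Z x b k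
     + w x * 'D_('e_b) (fun y => Z y b k) x.
  have hU : nbhs x U by exact: open_nbhs_nbhs.
  transitivity ('D_('e_b) (fun y => w y * Z y b k) x).
    by apply: near_eq_derive; apply: (nbhsS _ hU) => y Uy; rewrite /G ZtZ.
  rewrite deriveM_at; [|exact: (d1 wJ S0)|exact: (d1 (ZJ b k) S0)].
  rewrite addrC; congr (_ * _ + _).
  by rewrite /w deriveM_at//; [exact: (d1 chiJ S0)|exact: (d1 cc0J S0)].
have S2 : \sum_k (\sum_b 'D_('e_b) (G 0 b k) x) * q 0 x 0 k =
   chi x * (area 0 x * dotv (grad_coord (F 0) (cc 0) x) (q 0 x)) +
   cc 0 x * (area 0 x * dotv (grad_coord (F 0) chi x) (q 0 x)) + w x * dotv (div_conormal (F 0) x) (q 0 x).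
  have SA r (u : 'rV[R]_d -> R) : r * (area 0 x * dotv (grad_coord (F 0) u x) (q 0 x)) =
      \sum_b \sum_k r * ('D_('e_b) u x * (Z x b k * q 0 x 0 k)).
    by rewrite -aE grad_coord_dot mulr_sumr; apply: eq_bigr => b _; rewrite !mulr_sumr.
  have SC : w x * dotv (div_conormal (F 0) x) (q 0 x) =
      \sum_b \sum_k w x * ('D_('e_b) (fun y => Z y b k) x * q 0 x 0 k).
    rewrite /dotv mulr_sumr [RHS]exchange_big /=; apply: eq_bigr => k _.
    by rewrite mxE mulr_suml mulr_sumr.
  rewrite !SA SC -!big_split /=.
  under eq_bigr => k _ do rewrite mulr_suml.
  rewrite exchange_big /=; apply: eq_bigr => b _.
  rewrite -!big_split /=; apply: eq_bigr => k _.
  rewrite DG; exact: product_ring.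
rewrite S1 /Psi S2 XV -/(bdry x) /bdry aE dotvDr dotvZr pde// (dotvC (q 0 x) (grad_coord _ _ _)) /w.
exact: integrand_ring.
Qed.

Lemma chart_derivative :
  (fun h => h^-1 * (rVI (fun x => \1_U x * (chi x * cc h x * area_density (F h) x)) -
     rVI (fun x => \1_U x * (chi x * cc 0 x * area_density (F 0) x)))) @ within S (0 : R)^' -->
  - rVI (fun x => \1_U x * (area_density (F 0) x * dotv (grad_coord (F 0) chi x) (Y x + cc 0 x *: q 0 x))).
Proof.
rewrite -limit_eq.
have h1 : (fun h => rVI (fun x => \1_U x * Psi h x)) @ within S (0 : R)^' --> rVI (fun x => \1_U x * Psi 0 x).
  apply: (cvg_trans _ (rVI_jc_cvg oU cL LU PsiJ Psi0 S0)) => A hA.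
  have hA' : nbhs (0 : R) (fun h => S h -> A (rVI (fun x => \1_U x * Psi h x))) := hA.
  have hA'' : nbhs (0 : R) (fun h => h != 0 -> S h -> A (rVI (fun x => \1_U x * Psi h x))).
    by apply: (nbhsS _ hA') => h H _.
  exact: hA''.
have mE h : rVI (fun x => \1_U x * (chi x * cc h x * area_density (F h) x)) = m h.
  by congr rVI; apply/funext => x; rewrite area_densityE.
have hE : {near within S (0 : R)^', (fun h => rVI (fun x => \1_U x * Psi h x)) =1
    (fun h => h^-1 * (rVI (fun x => \1_U x * (chi x * cc h x * area_density (F h) x)) -
     rVI (fun x => \1_U x * (chi x * cc 0 x * area_density (F 0) x))))}.
  have H h : h != 0 -> S h -> rVI (fun x => \1_U x * Psi h x) = h^-1 * (m h - m 0).
    by move=> hn0 Sh; rewrite (increment_eq Sh) mulrA mulVf// mul1r.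
  have H' : nbhs (0 : R) (fun h => h != 0 -> S h -> rVI (fun x => \1_U x * Psi h x) =
     h^-1 * (rVI (fun x => \1_U x * (chi x * cc h x * area_density (F h) x)) -
     rVI (fun x => \1_U x * (chi x * cc 0 x * area_density (F 0) x)))).
    have H2 h : h != 0 -> S h -> rVI (fun x => \1_U x * Psi h x) =
     h^-1 * (rVI (fun x => \1_U x * (chi x * cc h x * area_density (F h) x)) -
     rVI (fun x => \1_U x * (chi x * cc 0 x * area_density (F 0) x))).
      by move=> hn0 Sh; rewrite (H h hn0 Sh) -(mE h) -(mE 0).
    exact: (filterE _ H2).
  exact: H'.
by apply: (cvg_trans _ h1); exact: near_eq_cvg hE.
Qed.

End ChartDerivative.

(** * Transition maps and surface operators *)

Section Immersions.
Context {R : realType} {d : nat}.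
Implicit Types (U : set 'rV[R]_d) (F phi : 'rV[R]_d -> 'rV[R]_d.+1) (M : set 'rV[R]_d.+1).

(** The parameter of [jC2] is a dummy: a single immersion is treated as a constant family, so that
    the calculus of families applies to it. *)
Definition C2_immersion U F :=
  [/\ open U, forall x, U x -> differentiable F x,
      forall k, jC2 setT U (fun _ x => F x 0 k)
    & forall x, U x -> row_free (Dmx F x)].

Lemma derive_coord {n} (F : 'rV[R]_d -> 'rV[R]_n) x k v : differentiable F x ->
  'D_v (fun y => F y 0 k) x = ('D_v F x) 0 k.
Proof. by move=> dF; rewrite derive_mx ?mxE//; exact: diff_derivable. Qed.

Lemma differentiable_rV (V : normedModType R) {n} (F : V -> 'rV[R]_n) x :
  (forall k, differentiable (fun y => F y 0 k) x) -> differentiable F x.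
Proof.
move=> dF.
have -> : F = \sum_k (fun y => F y 0 k *: 'e_k).
  by apply/funext => y; rewrite fct_sumE; exact: row_sum_delta.
by apply: differentiable_sum => k; exact: differentiableZl.
Qed.

Lemma Ck2_coord {n} (I : set R) U (F : 'rV[R]_d -> 'rV[R]_n) k :
  open U -> Ck_on 2 U F -> jC2 I U (fun _ x => F x 0 k).
Proof.
move=> oU [c0 [d0 H1]].
have cD v : jc I U (fun _ => 'D_v F) by have [c1 _] := H1 v; exact: within_jc.
have [J1 DE] := jC1_coord k (fun s x (_ : I s) => d0 x) (within_jc (S := I) oU c0) cD.
split => // v; have [c1 [d1 H2]] := H1 v.
have cDD w : jc I U (fun _ => 'D_w ('D_v F)) by have [c2 _] := H2 w; exact: within_jc.
have [J2 _] := jC1_coord k (fun s x (_ : I s) => d1 x) (cD v) cDD.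
by apply: (jC1_eq oU _ J2) => s x Is Ux; rewrite (DE s).
Qed.

Lemma local_param_C2 M U phi : local_param M U phi -> C2_immersion U phi.
Proof.
case=> oU cphi im _ _; have dphi x : U x -> differentiable phi x by case: cphi => _ [+ _]; apply.
split=> // [k|x Ux]; first exact: Ck2_coord.
by rewrite -Dmx_jacobian; [exact: im|exact: dphi].
Qed.

Lemma C0_C2_differentiable (T t : R) {W : normedModType R} M (f : R -> 'rV[R]_d.+1 -> W) U phi : C0_C2 T M f ->
  0 <= t <= T -> local_param M U phi -> forall x, U x -> differentiable (f t \o phi) x.
Proof. by move=> h tT lp x Ux; have [_ _ [+ _]] := h _ _ lp; apply => //; rewrite /= in_itv. Qed.

Lemma evolving_C2 (T t : R) M th U phi : evolving_hypersurface T M th ->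
  0 <= t <= T -> local_param M U phi -> C2_immersion U (th t \o phi).
Proof.
case=> _ h im tT lp; have [oU _ _ _ _] := lp.
have dF := C0_C2_differentiable h tT lp.
have It : `[0, T]%classic t by rewrite /= in_itv.
split => // [k|x Ux].
  have [J _] := C0_C2_coord k oU (h _ _ lp).
  exact: (jC2_reparam (phi := fun=> t) (fun x => cvg_cst t) (fun _ _ => It) J).
by rewrite -Dmx_jacobian; [exact: im lp _ Ux|exact: dF].
Qed.

Section ImmersionRegularity.
Variables (U : set 'rV[R]_d) (F : 'rV[R]_d -> 'rV[R]_d.+1).
Hypothesis iF : C2_immersion U F.

Lemma C2_Dmx : jC1m setT U (fun _ => Dmx F).
Proof.
case: iF => oU dF J _ b k; apply: (jC1_eq oU _ ((J k).2 'e_b)) => s x _ Ux.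
by rewrite mxE -derive_coord//; exact: dF.
Qed.

Lemma C2_conormal : jC1m setT U (fun _ x => conormal (Dmx F x)).
Proof. by case: iF => oU _ _ fF; apply: jC1m_conormal => //; [exact: C2_Dmx|move=> s x _; exact: fF]. Qed.

Lemma C2_det_gt0 x : U x -> 0 < \det (gram (Dmx F x)).
Proof. by case: iF => _ _ _ fF Ux; exact: det_gram_gt0 (fF x Ux). Qed.

Lemma C2_area_gt0 x : U x -> 0 < area_density F x.
Proof. by move=> Ux; rewrite area_densityE sqrtr_gt0; exact: C2_det_gt0. Qed.

Lemma C2_area : jC1 setT U (fun _ x => area_density F x).
Proof.
case: iF => oU _ _ fF; have := jC1_sqrt_det C2_Dmx (fun s x _ => fF x).
by apply: jC1_eq => // s x _ _; rewrite area_densityE.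
Qed.

Lemma C2_strong x0 : U x0 -> forall e, 0 < e -> exists2 r, 0 < r &
  forall x x', `|x0 - x| < r -> `|x0 - x'| < r ->
    `|F x - F x' - (x - x') *m Dmx F x0| <= e * `|x - x'|.
Proof.
move=> Ux0 e e0; case: iF => oU dF J _.
have h k : exists2 r, 0 < r & forall x x', `|x0 - x| < r -> `|x0 - x'| < r ->
    `|F x 0 k - F x' 0 k - 'D_(x - x') (fun y => F y 0 k) x0| <= e * `|x - x'|.
  have [[dk ck cdk] _] := J k.
  apply: (C1_strong oU Ux0) => // [x Ux|v]; first exact: (dk 0).
  exact: (jc_cvg (s := 0) oU (cdk v)).
have [r [r0 hr]] : exists r, 0 < r /\ forall k, forall x x', `|x0 - x| < r -> `|x0 - x'| < r ->
    `|F x 0 k - F x' 0 k - 'D_(x - x') (fun y => F y 0 k) x0| <= e * `|x - x'|.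
  have hk k : \forall s \near (0 : R)^'+, forall x x', `|x0 - x| < s -> `|x0 - x'| < s ->
      `|F x 0 k - F x' 0 k - 'D_(x - x') (fun y => F y 0 k) x0| <= e * `|x - x'|.
    have [r r0 hr] := h k; apply: filterS (nbhs_right_lt r0) => s sr x x' h1 h2.
    by apply: hr; [exact: lt_trans h1 sr|exact: lt_trans h2 sr].
  have FF : Filter (0 : R)^'+ by exact: _.
  have hA := filter_forall FF hk.
  have [r [r0 hr]] := @filter_ex _ _ (at_right_proper_filter 0) _ (filterI (nbhs_right_gt (0 : R)) hA).
  by exists r.
exists r => // x x' h1 h2; apply/rV_norm_ler; first by rewrite mulr_ge0// ltW.
move=> k; have := hr k x x' h1 h2.
rewrite (derive_sum_basis (f := fun y => F y 0 k)); last by have [[dk _ _] _] := J k; exact: (dk 0).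
suff -> : (F x - F x' - (x - x') *m Dmx F x0) 0 k = F x 0 k - F x' 0 k - \sum_i (x - x') 0 i * 'D_('e_i) (fun y => F y 0 k) x0 by [].
have sub3 (A B C : 'rV[R]_d.+1) : (A - B - C) 0 k = A 0 k - B 0 k - C 0 k by rewrite !mxE.
by rewrite sub3; congr (_ - _); rewrite [LHS]mxE; apply: eq_bigr => b _; rewrite [Dmx _ _ _ _]mxE derive_coord//; exact: dF.
Qed.
End ImmersionRegularity.

Lemma Dmx_mul {n} (F : 'rV[R]_d -> 'rV[R]_n) x v : differentiable F x -> 'D_v F x = v *m Dmx F x.
Proof.
move=> dF; apply/rowP => k; rewrite -derive_coord// derive_sum_basis.
  rewrite [RHS]mxE; apply: eq_bigr => b _; rewrite [Dmx _ _ _ _]mxE.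
  by rewrite derive_coord.
exact: (differentiable_comp dF (differentiable_coord _ _ _)).
Qed.

Lemma mulmx_section_sub n m (a b : 'rV[R]_n) (w : 'rV[R]_m) (A1 A2 : 'M[R]_(n, m)) (B : 'M[R]_(m, n)) :
  A2 *m B = 1%:M -> a - b *m (A1 *m B) = (w - b *m A1) *m B - (w - a *m A2) *m B.
Proof.
by move=> AB; rewrite !mulmxBl -!mulmxA AB mulmx1 opprB [RHS]addrC addrA subrK.
Qed.

Section Transition.
Variables (U1 U2 : set 'rV[R]_d) (phi1 phi2 : 'rV[R]_d -> 'rV[R]_d.+1) (tau : 'rV[R]_d -> 'rV[R]_d).
Hypotheses (i1 : C2_immersion U1 phi1) (i2 : C2_immersion U2 phi2).

(** D phi1 times P^T g^-1, the right inverse of P = D phi2 at tau x. The formula involves only the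
    values of tau, so J is available, and its determinant continuous, before tau is known to be
    differentiable. *)
Definition transition_jacobian x : 'M[R]_d :=
  (Num.sqrt (\det (gram (Dmx phi2 (tau x)))))^-1 *: (Dmx phi1 x *m (conormal (Dmx phi2 (tau x)))^T).
Let J := transition_jacobian.

(* Inverting phi2 (tau x) = phi1 x to first order on the range of D phi2. *)
Lemma transition_strong x0 : U1 x0 -> U2 (tau x0) ->
  (\forall x \near x0, phi2 (tau x) = phi1 x) -> tau @ nbhs x0 --> tau x0 ->
  forall e, 0 < e -> exists2 r, 0 < r & forall x x', `|x0 - x| < r -> `|x0 - x'| < r ->
    `|tau x - tau x' - (x - x') *m J x0| <= e * `|x - x'|.
Proof.
move=> U1x U2x ptau ctau e e0.
pose A1 := Dmx phi1 x0; pose A2 := Dmx phi2 (tau x0).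
pose B := (Num.sqrt (\det (gram A2)))^-1 *: (conormal A2)^T.
have A2B : A2 *m B = 1%:M.
  have g0 := C2_det_gt0 i2 U2x.
  rewrite -scalemxAr -[A2 *m _]trmxK trmx_mul trmxK conormal_mulT ?gt_eqF// tr_scalar_mx.
  by rewrite scale_scalar_mx mulVf// sqrtr_eq0 -ltNge.
have JE : J x0 = A1 *m B by rewrite /J /transition_jacobian -scalemxAr.
have [C C0 hC] := mulmx_norm_le B; have [C1 C10 hC1] := mulmx_norm_le (J x0).
(* With a and b the increments of tau and of x, e1 C at most 1/2 lets |a| be absorbed, giving |a| at
   most 2 (C1 + 1) |b|. Inserting this in the bound C e1 (|b| + |a|) of the error leaves e1 M0
   |b|. *)
pose M0 := C * (1 + 2 * (C1 + 1)).
have M00 : 0 < M0 by rewrite /M0; nra.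
pose e1 := Num.min (e / M0) (Num.min (1 / (2 * C)) 1).
have C20 : 0 < 2 * C by rewrite mulr_gt0.
have e10 : 0 < e1 by rewrite /e1 !lt_min ltr01 (divr_gt0 e0 M00) (divr_gt0 ltr01 C20).
have e1a : e1 * M0 <= e by rewrite -ler_pdivlMr// /e1 ge_min lexx.
have e1b : e1 * C <= 1 / 2.
  have : e1 * (2 * C) <= 1 by rewrite -ler_pdivlMr// /e1 !ge_min lexx orbT.
  by lra.
have e1c : e1 <= 1 by rewrite /e1 !ge_min lexx !orbT.
have [r1 r10 h1] := C2_strong i1 U1x e10.
have [r2 r20 h2] := C2_strong i2 U2x e10.
have ht : \forall x \near x0, `|tau x0 - tau x| < r2 by have /cvgrPdist_lt /(_ _ r20) := ctau.
have /nbhs_ballP [r3 /= r30 h3] : nbhs x0 (fun x => phi2 (tau x) = phi1 x /\ `|tau x0 - tau x| < r2).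
  exact: filterI ptau ht.
exists (Num.min r1 r3) => [|x x']; first by rewrite lt_min r10.
rewrite !lt_min => /andP[x1 x3] /andP[x'1 x'3].
have [px tx] : phi2 (tau x) = phi1 x /\ `|tau x0 - tau x| < r2 by apply: h3; rewrite -ball_normE.
have [px' tx'] : phi2 (tau x') = phi1 x' /\ `|tau x0 - tau x'| < r2 by apply: h3; rewrite -ball_normE.
have := h1 x x' x1 x'1; have := h2 _ _ tx tx'; rewrite px px' -/A1 -/A2.
set w := phi1 x - phi1 x'; set a := tau x - tau x'; set b := x - x' => E2 E1.
clearbody w a b.
have aE : a - b *m J x0 = (w - b *m A1) *m B - (w - a *m A2) *m B.
  by rewrite JE; exact: mulmx_section_sub.
have b1 := hC (w - b *m A1); have b2 := hC (w - a *m A2).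
have N1 : `|a - b *m J x0| <= C * (e1 * `|b|) + C * (e1 * `|a|).
  rewrite aE; apply: le_trans (ler_normB _ _) _.
  by apply: lerD; [apply: le_trans b1 _|apply: le_trans b2 _]; rewrite ler_pM2l.
have N2 : `|a| <= `|a - b *m J x0| + C1 * `|b|.
  rewrite -[X in `|X| <= _](subrK (b *m J x0)); apply: le_trans (ler_normD _ _) _.
  by rewrite lerD2l.
have := normr_ge0 a; have := normr_ge0 b; move: N1 N2; set n := `|a - _|; set na := `|a|; set nb := `|b|.
move=> N1 N2 nb0 na0.
have T1 : C * (e1 * na) <= 1 / 2 * na by rewrite mulrA (mulrC C) ler_wpM2r.
have T2 : C * (e1 * nb) <= 1 / 2 * nb by rewrite mulrA (mulrC C) ler_wpM2r.
clearbody n na nb; clear -N1 N2 T1 T2 nb0 na0 C0 C10 e10 e1b e1a.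
have N3 : na <= 2 * (C1 + 1) * nb by lra.
apply: le_trans N1 _; apply: (@le_trans _ _ (e1 * M0 * nb)); last by rewrite ler_wpM2r.
have : C * e1 * na <= C * e1 * (2 * (C1 + 1) * nb) by rewrite ler_wpM2l// mulr_ge0// ltW.
rewrite (_ : e1 * M0 * nb = C * (e1 * nb) + C * e1 * (2 * (C1 + 1) * nb)); last by rewrite /M0; ring.
by rewrite -mulrA lerD2l.
Qed.

Lemma transition_derive x0 : U1 x0 -> U2 (tau x0) ->
  (\forall x \near x0, phi2 (tau x) = phi1 x) -> tau @ nbhs x0 --> tau x0 ->
  differentiable tau x0 /\ forall v, 'D_v tau x0 = v *m J x0.
Proof.
move=> U1x U2x ptau ctau.
have cL : continuous (mulmxr (J x0) : {linear 'rV[R]_d -> 'rV[R]_d}) := @mulmx_cont _ _ _ (J x0).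
have [dt DE] : differentiable tau x0 /\ 'd tau x0 = mulmxr (J x0) :> ('rV[R]_d -> 'rV[R]_d).
  apply: (differentiable_est cL) => e e0.
  have [r r0 hr] := transition_strong U1x U2x ptau ctau e0.
  apply: (nbhsS _ (nbhsx_ballx x0 r r0)) => y; rewrite -ball_normE => yr.
  by apply: (hr y x0 yr); rewrite subrr normr0.
by split => // v; rewrite deriveE// DE.
Qed.

Lemma derive_transition {W : normedModType R} (F G : 'rV[R]_d -> W) x v : U1 x -> U2 (tau x) ->
  (\forall x \near x, phi2 (tau x) = phi1 x) -> tau @ nbhs x --> tau x ->
  differentiable G (tau x) -> (\forall y \near x, G (tau y) = F y) ->
  'D_v F x = 'D_(v *m J x) G (tau x).
Proof.
move=> U1x U2x ptau ctau dG GF; have [dt DE] := transition_derive U1x U2x ptau ctau.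
rewrite -(near_eq_derive v GF) deriveE; last exact: differentiable_comp.
by rewrite (diff_comp dt dG) /= -!deriveE// DE.
Qed.

Lemma transition_mul x : U1 x -> U2 (tau x) ->
  (\forall x \near x, phi2 (tau x) = phi1 x) -> tau @ nbhs x --> tau x ->
  forall (F G : 'rV[R]_d -> 'rV[R]_d.+1),
  differentiable G (tau x) -> (\forall y \near x, G (tau y) = F y) ->
  Dmx F x = J x *m Dmx G (tau x).
Proof.
move=> U1x U2x ptau ctau F G dG GF; apply/row_matrixP => b.
have -> : row b (Dmx F x) = 'D_('e_b) F x by apply/rowP => k; rewrite !mxE.
by rewrite (derive_transition _ U1x U2x ptau ctau dG GF) Dmx_mul// rowE mulmxA.
Qed.

End Transition.
End Immersions.

(** * Invariance of the surface operators under transition maps *)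

Section ChartInvariance.
Context {R : realType} {d : nat}.
Implicit Types (U : set 'rV[R]_d) (F phi : 'rV[R]_d -> 'rV[R]_d.+1) (M : set 'rV[R]_d.+1).
Notation E := 'rV[R]_d.+1.

Lemma gram_mul n (J : 'M[R]_d) (A : 'M[R]_(d, n)) : gram (J *m A) = J *m gram A *m J^T.
Proof. by rewrite /gram trmx_mul !mulmxA. Qed.

Lemma invmx_congruence (J g : 'M[R]_d) : J \in unitmx -> g \in unitmx ->
  J^T *m invmx (J *m g *m J^T) *m J = invmx g.
Proof.
move=> uJ ug; have uJT : J^T \in unitmx by rewrite unitmx_tr.
have uX : J *m g *m J^T \in unitmx by rewrite !unitmx_mul uJ ug.
apply: (can_inj (mulmxK ug)); rewrite mulVmx//; apply: (can_inj (mulmxK uJT)).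
by rewrite mul1mx -!mulmxA [J *m (g *m _)]mulmxA mulVmx// mulmx1.
Qed.

Lemma grad_coord_mx F u x : grad_coord F u x =
  (\row_j 'D_('e_j) u x) *m invmx (gram (Dmx F x)) *m Dmx F x.
Proof.
apply/rowP => k; rewrite grad_coordE -mulmxA [RHS]mxE; apply: eq_bigr => b _.
by rewrite [X in _ = X * _]mxE [X in _ = _ * X]mxE.
Qed.

Lemma div_coord_mx F Y x : div_coord F Y x =
  \tr (invmx (gram (Dmx F x)) *m (Dmx F x *m (Dmx Y x)^T)).
Proof.
rewrite /div_coord /mxtrace metricE; apply: eq_bigr => i _; rewrite [RHS]mxE.
apply: eq_bigr => j _; congr (_ * _); rewrite [RHS]mxE; apply: eq_bigr => k _.
by rewrite [(_^T) _ _]mxE [Dmx F _ _ _]mxE [Dmx Y _ _ _]mxE mulrC.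
Qed.

Lemma area_congruence F G x y (J : 'M[R]_d) : Dmx F x = J *m Dmx G y ->
  area_density F x = `|\det J| * area_density G y.
Proof.
move=> FG; rewrite !area_densityE FG gram_mul !det_mulmx det_tr mulrAC -expr2.
by rewrite sqrtrM ?sqr_ge0// sqrtr_sqr.
Qed.

Lemma grad_congruence F G (u w : 'rV[R]_d -> R) x y (J : 'M[R]_d) : J \in unitmx -> gram (Dmx G y) \in unitmx ->
  Dmx F x = J *m Dmx G y -> \row_j 'D_('e_j) u x = (\row_j 'D_('e_j) w y) *m J^T ->
  grad_coord F u x = grad_coord G w y.
Proof.
move=> uJ ug FG uw; rewrite !grad_coord_mx uw FG gram_mul -(invmx_congruence uJ ug).
by rewrite !mulmxA.
Qed.

Lemma div_congruence F G Y Z x y (J : 'M[R]_d) : J \in unitmx -> gram (Dmx G y) \in unitmx ->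
  Dmx F x = J *m Dmx G y -> Dmx Y x = J *m Dmx Z y -> div_coord F Y x = div_coord G Z y.
Proof.
move=> uJ ug FG YZ; rewrite !div_coord_mx YZ FG gram_mul -(invmx_congruence uJ ug).
by rewrite trmx_mul !mulmxA mxtrace_mulC !mulmxA.
Qed.

Lemma local_param_sub M U phi : local_param M U phi -> forall x, U x -> M (phi x).
Proof. by case=> _ _ _ [A _ AE] _ x Ux; have [] : (M `&` A) (phi x) by rewrite -AE; exists x. Qed.

Lemma local_param_continuous M U phi : local_param M U phi ->
  forall x, U x -> phi @ nbhs x --> phi x.
Proof. by move=> /local_param_C2 [_ dphi _ _] x Ux; exact: differentiable_continuous (dphi x Ux). Qed.

Definition transition U1 phi1 U2 phi2 (tau : 'rV[R]_d -> 'rV[R]_d) :=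
  (forall x y, U2 y -> phi1 x = phi2 y -> tau x = y) /\
  forall x, U1 x -> (phi2 @` U2) (phi1 x) ->
    [/\ U2 (tau x), phi2 (tau x) = phi1 x,
      \forall y \near x, U1 y /\ (phi2 @` U2) (phi1 y) & tau @ nbhs x --> tau x].

(** tau is the continuous left inverse of phi2 after phi1. The overlap is open because the image of
    phi2 is relatively open in M and phi1 takes its values in M. *)
Lemma transition_exists M U1 phi1 U2 phi2 : local_param M U1 phi1 -> local_param M U2 phi2 ->
  exists tau, transition U1 phi1 U2 phi2 tau.
Proof.
move=> lp1 lp2; have [oU1 _ _ _ _] := lp1; have [_ _ _ [A oA AE] [psi cpsi psiK]] := lp2.
exists (psi \o phi1); split=> [x y U2y /= ->|x U1x xA]; first exact: psiK.
have c1 := local_param_continuous lp1 U1x.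
have near1 : \forall y \near x, U1 y /\ (phi2 @` U2) (phi1 y).
  have [_ Ax] : (M `&` A) (phi1 x) by rewrite -AE.
  have hA : nbhs x (phi1 @^-1` A) by apply: c1; exact: open_nbhs_nbhs.
  have hU : nbhs x U1 by exact: open_nbhs_nbhs.
  apply: (nbhsS _ (filterI hU hA)) => y [U1y Ay]; split => //.
  by rewrite AE; split => //; exact: (local_param_sub lp1).
have [y U2y yE] := xA.
split => //=; rewrite -?yE ?psiK//.
move/subspace_continuousP : cpsi => /(_ _ xA) cpsi.
have h : phi1 @ nbhs x --> within (phi2 @` U2) (nbhs (phi1 x)).
  move=> B hB; have hB' : nbhs x (fun y => (phi2 @` U2) (phi1 y) -> B (phi1 y)) := c1 _ hB.
  by apply: (nbhsS _ (filterI near1 hB')) => z [[_ zA]]; apply.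
have e : psi (phi1 x) = y by rewrite -yE psiK.
by rewrite -e; exact: (@cvg_comp _ _ _ phi1 psi _ _ _ h cpsi).
Qed.

Section TransitionInvariance.
Variables (M : set E) (U1 U2 : set 'rV[R]_d) (phi1 phi2 : 'rV[R]_d -> E) (tau : 'rV[R]_d -> 'rV[R]_d).
Hypotheses (lp1 : local_param M U1 phi1) (lp2 : local_param M U2 phi2)
  (tr : transition U1 phi1 U2 phi2 tau).
Variable (x : 'rV[R]_d).
Hypotheses (U1x : U1 x) (xA : (phi2 @` U2) (phi1 x)).
Let J := transition_jacobian phi1 phi2 tau x.

Let i1 := local_param_C2 lp1.
Let i2 := local_param_C2 lp2.

Let U2x : U2 (tau x). Proof. by have [] := tr.2 _ U1x xA. Qed.

Let ctau : tau @ nbhs x --> tau x. Proof. by have [] := tr.2 _ U1x xA. Qed.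

Lemma transition_near : \forall y \near x, phi2 (tau y) = phi1 y.
Proof.
have [_ _ h _] := tr.2 _ U1x xA.
by apply: (nbhsS _ h) => y [U1y yA]; have [_ ->] := tr.2 _ U1y yA.
Qed.

Lemma transition_comp_near {W : Type} (f : E -> W) : \forall y \near x, (f \o phi2) (tau y) = (f \o phi1) y.
Proof. by apply: (nbhsS _ transition_near) => y /= ->. Qed.

Lemma transition_Dmx (f : E -> E) : differentiable (f \o phi2) (tau x) ->
  Dmx (f \o phi1) x = J *m Dmx (f \o phi2) (tau x).
Proof. by move=> df; exact: (transition_mul i1 i2 U1x U2x transition_near ctau df (transition_comp_near f)). Qed.

Lemma transition_row (f : E -> R) : differentiable (f \o phi2) (tau x) ->
  \row_j 'D_('e_j) (f \o phi1) x = (\row_j 'D_('e_j) (f \o phi2) (tau x)) *m J^T.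
Proof.
move=> df; apply/rowP => b.
rewrite [LHS]mxE (derive_transition i1 i2 _ U1x U2x transition_near ctau df (transition_comp_near f)).
rewrite derive_sum_basis// [RHS]mxE; apply: eq_bigr => i _.
by rewrite -rowE [row _ _ _ _]mxE [(J^T) _ _]mxE [X in _ = X * _]mxE mulrC.
Qed.

(** D phi1 = J D phi2 has rank d, and the rank of a product is at most that of its left factor J. *)
Lemma transition_unit : J \in unitmx.
Proof.
have [_ dphi2 _ f2] := i2; have [_ _ _ f1] := i1.
have := f1 x U1x; rewrite -row_free_unit /row_free.
have := transition_Dmx (f := id) (dphi2 _ U2x) => -> /eqP rk.
by rewrite eqn_leq rank_leq_row -{1}rk mxrankM_maxl.
Qed.

Section Geometry.
Variable th : E -> E.
Hypothesis ith : C2_immersion U2 (th \o phi2).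

Let Dth : Dmx (th \o phi1) x = J *m Dmx (th \o phi2) (tau x).
Proof. by apply: transition_Dmx; case: ith => _ + _ _; apply. Qed.

Let gth : gram (Dmx (th \o phi2) (tau x)) \in unitmx.
Proof. by rewrite unitmxE unitfE gt_eqF// (C2_det_gt0 ith). Qed.

Lemma transition_area : area_density (th \o phi1) x = `|\det J| * area_density (th \o phi2) (tau x).
Proof. exact: area_congruence Dth. Qed.

Lemma transition_grad f : differentiable (f \o phi2) (tau x) ->
  grad_coord (th \o phi1) (f \o phi1) x = grad_coord (th \o phi2) (f \o phi2) (tau x).
Proof. by move=> df; apply: (grad_congruence transition_unit gth Dth); exact: transition_row. Qed.

Lemma transition_div Y : differentiable (Y \o phi2) (tau x) ->
  div_coord (th \o phi1) (Y \o phi1) x = div_coord (th \o phi2) (Y \o phi2) (tau x).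
Proof. by move=> df; apply: (div_congruence transition_unit gth Dth); exact: transition_Dmx. Qed.

End Geometry.
End TransitionInvariance.

Section SurfaceOperators.
Variables (M : set E) (th : E -> E).
Hypothesis ith : forall U phi, local_param M U phi -> C2_immersion U (th \o phi).
Variables (U : set 'rV[R]_d) (phi : 'rV[R]_d -> E) (x : 'rV[R]_d).
Hypotheses (lp : local_param M U phi) (Ux : U x).

(** The surface operators are evaluated in a chart picked by [get]. A transition map from the given
    chart to that one, sending x to the picked coordinates, lets the invariance results remove the
    choice. *)
Lemma local_coord_transition : exists U2, exists tau, let k := local_coord M (phi x) in
  [/\ local_param M U2 k.1, transition U phi U2 k.1 tau, (k.1 @` U2) (phi x), U2 k.2 & tau x = k.2].
Proof.
have [U2 [lp2 U2x xE]] : exists U2, [/\ local_param M U2 (local_coord M (phi x)).1,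
    U2 (local_coord M (phi x)).2 & (local_coord M (phi x)).1 (local_coord M (phi x)).2 = phi x].
  by apply: (getPex (P := [set k | exists U, [/\ local_param M U k.1, U k.2 & k.1 k.2 = phi x]])); exists (phi, x), U.
have [tau tr] := transition_exists lp lp2.
exists U2, tau; split => //; first by exists (local_coord M (phi x)).2.
by apply: tr.1 => //; rewrite xE.
Qed.

Lemma surface_gradE f : (forall U phi, local_param M U phi -> forall x, U x -> differentiable (f \o phi) x) ->
  surface_grad M th f (phi x) = grad_coord (th \o phi) (f \o phi) x.
Proof.
move=> df; have [U2 [tau [lp2 tr xA U2x tx]]] := local_coord_transition.
rewrite (transition_grad lp lp2 tr Ux xA (ith lp2)) ?tx//.
exact: df lp2 _ U2x.
Qed.

Lemma surface_divE Y : (forall U phi, local_param M U phi -> forall x, U x -> differentiable (Y \o phi) x) ->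
  surface_div M th Y (phi x) = div_coord (th \o phi) (Y \o phi) x.
Proof.
move=> df; have [U2 [tau [lp2 tr xA U2x tx]]] := local_coord_transition.
rewrite (transition_div lp lp2 tr Ux xA (ith lp2)) ?tx//.
exact: df lp2 _ U2x.
Qed.

End SurfaceOperators.
End ChartInvariance.

(** * Integration with a partition of unity *)

Section PartitionIntegrals.
Context {R : realType} {d : nat}.
Implicit Types (U : set 'rV[R]_d) (F phi : 'rV[R]_d -> 'rV[R]_d.+1) (M : set 'rV[R]_d.+1).
Notation E := 'rV[R]_d.+1.
Notation rVI := rV_integral.

Lemma local_param_inj M U phi x y : local_param M U phi -> U x -> U y -> phi x = phi y -> x = y.
Proof. by case=> _ _ _ _ [psi _ psiK] Ux Uy xy; rewrite -(psiK x Ux) -(psiK y Uy) xy. Qed.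

Lemma local_param_image_compact M U phi (K : set 'rV[R]_d) : local_param M U phi -> compact K ->
  K `<=` U -> compact (phi @` K).
Proof.
move=> lp cK KU; apply: continuous_compact => //; apply: continuous_in_subspaceT => x.
by rewrite inE => Kx; apply: (local_param_continuous lp); exact: KU.
Qed.

Lemma jacobian_det_continuous U1 U2 phi1 phi2 (tau : 'rV[R]_d -> 'rV[R]_d) x :
  C2_immersion U1 phi1 -> C2_immersion U2 phi2 -> U1 x -> U2 (tau x) -> tau @ nbhs x --> tau x ->
  (fun y => \det (transition_jacobian phi1 phi2 tau y)) @ nbhs x --> \det (transition_jacobian phi1 phi2 tau x).
Proof.
move=> i1 i2 U1x U2x ctau; apply: cvg_det => i j.
have [oU1 _ _ _] := i1; have [oU2 _ _ _] := i2.
have JE y : transition_jacobian phi1 phi2 tau y i j =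
    (area_density phi2 (tau y))^-1 * \sum_k Dmx phi1 y i k * conormal (Dmx phi2 (tau y)) j k.
  rewrite area_densityE [LHS]mxE; congr (_ * _); rewrite [LHS]mxE; apply: eq_bigr => k _.
  by rewrite [(_^T) _ _]mxE.
have ca : (fun y => area_density phi2 y) @ nbhs (tau x) --> area_density phi2 (tau x).
  by have [_ h _] := C2_area i2; exact: (jc_cvg (s := 0) oU2 h).
have c1 k : (fun y => Dmx phi1 y i k) @ nbhs x --> Dmx phi1 x i k.
  by have [_ h _] := C2_Dmx i1 i k; exact: (jc_cvg (s := 0) oU1 h).
have c2 k : (fun y => conormal (Dmx phi2 y) j k) @ nbhs (tau x) --> conormal (Dmx phi2 (tau x)) j k.
  by have [_ h _] := C2_conormal i2 j k; exact: (jc_cvg (s := 0) oU2 h).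
have ca' := cvg_comp _ _ ctau ca.
have c2' k := cvg_comp _ _ ctau (c2 k).
have a0 : area_density phi2 (tau x) != 0 by rewrite gt_eqF// (C2_area_gt0 i2).
have c3 k : (fun y => Dmx phi1 y i k * conormal (Dmx phi2 (tau y)) j k) @ nbhs x -->
    Dmx phi1 x i k * conormal (Dmx phi2 (tau x)) j k.
  exact: (cvgM (c1 k) (c2' k)).
have s : (fun y => \sum_k Dmx phi1 y i k * conormal (Dmx phi2 (tau y)) j k) @ nbhs x -->
    \sum_k Dmx phi1 x i k * conormal (Dmx phi2 (tau x)) j k.
  exact: (@cvg_big_sum _ _ _ (nbhs x) _ _ _ _ _ c3).
have key := cvgM (cvgV a0 ca') s.
have -> : (fun y => transition_jacobian phi1 phi2 tau y i j) = (fun y =>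
    (area_density phi2 (tau y))^-1 * \sum_k Dmx phi1 y i k * conormal (Dmx phi2 (tau y)) j k) := funext JE.
by rewrite JE; exact: key.
Qed.

Section ChartChange.
Variables (M : set E) (U1 U2 K1 K2 : set 'rV[R]_d) (phi1 phi2 : 'rV[R]_d -> E) (th : E -> E) (h : E -> R).
Hypotheses (lp1 : local_param M U1 phi1) (lp2 : local_param M U2 phi2)
  (cK1 : compact K1) (KU1 : K1 `<=` U1) (cK2 : compact K2) (KU2 : K2 `<=` U2)
  (ith : C2_immersion U2 (th \o phi2))
  (ch : forall x, U2 x -> (fun y => h (phi2 y)) @ nbhs x --> h (phi2 x))
  (h0 : forall p, M p -> h p != 0 -> (phi1 @` K1) p /\ (phi2 @` K2) p).

Lemma chart_overlap_compact : compact [set y | K2 y /\ (phi1 @` K1) (phi2 y)].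
Proof.
have cC := local_param_image_compact lp1 cK1 KU1.
apply: (subclosed_compact _ cK2) => [y hy|y []//].
have K2y : K2 y.
  apply: (compact_closed _ cK2); first exact: norm_hausdorff.
  by move=> B /hy [z [[K2z _] Bz]]; exists z.
split=> //; apply: (compact_closed _ cC); first exact: norm_hausdorff.
move=> B hB; have := local_param_continuous lp2 (KU2 K2y) hB => /hy [z [[_ Cz] Bz]].
by exists (phi2 z).
Qed.

(** By [h0] the integrand lives over the overlap of the two charts, with compact support there. On
    the overlap the area densities differ by the factor |det J|, which is what the substitution tau
    requires. *)
Lemma chart_change :
  rVI (fun x => \1_U1 x * (h (phi1 x) * area_density (th \o phi1) x)) =
  rVI (fun x => \1_U2 x * (h (phi2 x) * area_density (th \o phi2) x)).
Proof.
have [tau tr] := transition_exists lp1 lp2; have [sigma st] := transition_exists lp2 lp1.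
have i1 := local_param_C2 lp1; have i2 := local_param_C2 lp2; have [oU2 _ _ _] := i2.
pose V := [set x | U1 x /\ (phi2 @` U2) (phi1 x)]; pose W := [set x | U2 x /\ (phi1 @` U1) (phi2 x)].
have oV : open V by rewrite openE => x [U1x xA]; have [_ _ + _] := tr.2 _ U1x xA.
have oW : open W by rewrite openE => x [U1x xA]; have [_ _ + _] := st.2 _ U1x xA.
have sV z : W z -> V (sigma z).
  by move=> [Uz zA]; have [? e _ _] := st.2 _ Uz zA; split => //; rewrite e; exists z.
have st_id x : V x -> sigma (tau x) = x.
  by move=> [U1x xA]; have [? e _ _] := tr.2 _ U1x xA; exact: st.1.
have ts_id x : W x -> tau (sigma x) = x.
  by move=> [U1x xA]; have [? e _ _] := st.2 _ U1x xA; exact: tr.1.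
have ctau x : V x -> tau @ nbhs x --> tau x by move=> [U1x xA]; have [] := tr.2 _ U1x xA.
have csig x : W x -> sigma @ nbhs x --> sigma x by move=> [U1x xA]; have [] := st.2 _ U1x xA.
pose J := transition_jacobian phi1 phi2 tau.
have sJ x0 : V x0 -> forall e, 0 < e -> exists2 r, 0 < r & forall x x', `|x0 - x| < r -> `|x0 - x'| < r ->
    `|tau x - tau x' - (x - x') *m J x0| <= e * `|x - x'|.
  move=> [U1x xA] e e0; have [U2x _ _ ct] := tr.2 _ U1x xA.
  exact: (transition_strong i1 i2 U1x U2x (transition_near tr U1x xA) ct e0).
have uJ x : V x -> J x \in unitmx by move=> [U1x xA]; exact: (transition_unit lp1 lp2 tr U1x xA).
have cJ x : V x -> (fun x => \det (J x)) @ nbhs x --> \det (J x).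
  move=> [U1x xA]; have [U2x _ _ ct] := tr.2 _ U1x xA.
  exact: (jacobian_det_continuous i1 i2 U1x U2x ct).
have zero y : U2 y -> ~ (K2 y /\ (phi1 @` K1) (phi2 y)) -> h (phi2 y) * area_density (th \o phi2) y = 0.
  move=> U2y nK; have [->|hn] := eqVneq (h (phi2 y)) 0; first by rewrite mul0r.
  case: nK; have [c1 [z K2z zy]] := h0 (local_param_sub lp2 U2y) hn; split => //.
  by rewrite -(local_param_inj lp2 (KU2 K2z) U2y zy).
have KU : [set y | K2 y /\ (phi1 @` K1) (phi2 y)] `<=` U2 by move=> y [/KU2].
have KW : [set y | K2 y /\ (phi1 @` K1) (phi2 y)] `<=` W.
  by move=> y [/KU2 U2y [z /KU1 Uz zy]]; split => //; exists z.
pose f x := \1_U2 x * (h (phi2 x) * area_density (th \o phi2) x).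
have cf : continuous f.
  have [+ _] : Cc f; last by [].
  apply: (Cc_indic oU2 chart_overlap_compact KU) => // x U2x.
  apply: (cvgM (ch U2x)); have [_ c _] := C2_area ith.
  exact: (jc_cvg (s := 0) oU2 c).
have f0 z : ~ [set y | K2 y /\ (phi1 @` K1) (phi2 y)] z -> f z = 0.
  move=> nK; rewrite /f indicE; case: (asboolP (U2 z)) => Uz; last by rewrite memNset// mul0r.
  by rewrite zero// mulr0.
rewrite -[RHS](change_of_variables oV oW sV st_id ts_id ctau csig sJ uJ cJ chart_overlap_compact KW cf f0).
congr rV_integral; apply/funext => x; rewrite !indicE.
have [U1x|U1x] := asboolP (U1 x); last by rewrite (memNset U1x) memNset ?mul0r// => -[].
have [xA|xA] := asboolP ((phi2 @` U2) (phi1 x)).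
  rewrite !mem_set//; have [U2x e _ _] := tr.2 _ U1x xA.
  have -> : f (tau x) = h (phi1 x) * area_density (th \o phi2) (tau x).
    by rewrite /f indicE mem_set// mul1r e.
  have -> : area_density (th \o phi1) x = `|\det (J x)| * area_density (th \o phi2) (tau x).
    exact: (transition_area lp1 lp2 tr U1x xA ith).
  by congr (_ * _); rewrite mulrAC -mulrA.
have -> : h (phi1 x) = 0.
  have [//|hn] := eqVneq (h (phi1 x)) 0.
  have [_ [z K2z zx]] := h0 (local_param_sub lp1 U1x) hn.
  by case: xA; exists z => //; exact: KU2.
by rewrite mul0r mulr0 memNset ?mul0r// => -[].
Qed.

End ChartChange.
End PartitionIntegrals.

(** * Gradients of a partition of unity *)

Section PartitionOfUnity.
Context {R : realType} {d : nat}.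
Implicit Types (U : set 'rV[R]_d) (F phi : 'rV[R]_d -> 'rV[R]_d.+1) (M : set 'rV[R]_d.+1).
Notation E := 'rV[R]_d.+1.
Notation rVI := rV_integral.

Lemma grad_dot_cvg U F u (B : 'rV[R]_d -> E) x : C2_immersion U F -> U x ->
  jC1 setT U (fun _ => u) -> (forall k, (fun y => B y 0 k) @ nbhs x --> B x 0 k) ->
  (fun y => dotv (grad_coord F u y) (B y)) @ nbhs x --> dotv (grad_coord F u x) (B x).
Proof.
move=> iF Ux [du cu cdu] cB; have [oU _ _ _] := iF.
pose N y := \sum_b 'D_('e_b) u y * \sum_k conormal (Dmx F y) b k * B y 0 k.
have NE y : U y -> (area_density F y)^-1 * N y = dotv (grad_coord F u y) (B y).
  by move=> Uy; rewrite /N -grad_coord_dot mulKf// gt_eqF// (C2_area_gt0 iF).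
have ca : area_density F @ nbhs x --> area_density F x.
  by have [_ h _] := C2_area iF; exact: (jc_cvg (s := 0) oU h).
have a0 : area_density F x != 0 by rewrite gt_eqF// (C2_area_gt0 iF).
have c1 b k : (fun y => conormal (Dmx F y) b k) @ nbhs x --> conormal (Dmx F x) b k.
  by have [_ h _] := C2_conormal iF b k; exact: (jc_cvg (s := 0) oU h).
have c2 b : 'D_('e_b) u @ nbhs x --> 'D_('e_b) u x by exact: (jc_cvg (s := 0) oU (cdu 'e_b)).
have c3 b k : (fun y => conormal (Dmx F y) b k * B y 0 k) @ nbhs x --> conormal (Dmx F x) b k * B x 0 k.
  exact: (cvgM (c1 b k) (cB k)).
have c4 b : (fun y => \sum_k conormal (Dmx F y) b k * B y 0 k) @ nbhs x --> \sum_k conormal (Dmx F x) b k * B x 0 k.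
  exact: (@cvg_big_sum _ _ _ (nbhs x) _ _ _ _ _ (c3 b)).
have c5 b : (fun y => 'D_('e_b) u y * \sum_k conormal (Dmx F y) b k * B y 0 k) @ nbhs x -->
   'D_('e_b) u x * \sum_k conormal (Dmx F x) b k * B x 0 k.
  exact: (cvgM (c2 b) (c4 b)).
have c6 : N @ nbhs x --> N x by exact: (@cvg_big_sum _ _ _ (nbhs x) _ _ _ _ _ c5).
have key : (fun y => (area_density F y)^-1 * N y) @ nbhs x --> (area_density F x)^-1 * N x.
  exact: (cvgM (cvgV a0 ca) c6).
refine (eq_ind _ (fun l : R => _ @ nbhs x --> l) _ _ (NE x Ux)).
have hE : {near nbhs x, (fun y => (area_density F y)^-1 * N y) =1
    (fun y => dotv (grad_coord F u y) (B y))}.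
  by apply: (nbhsS _ (open_nbhs_nbhs (conj oU Ux))) => y Uy; exact: NE.
by apply: (cvg_trans _ key); exact: near_eq_cvg hE.
Qed.

Lemma local_param_image_mem M U phi (K : set 'rV[R]_d) x : local_param M U phi -> U x -> K `<=` U ->
  (phi @` K) (phi x) -> K x.
Proof. by move=> lp Ux KU [z Kz zx]; rewrite -(local_param_inj lp (KU _ Kz) Ux zx). Qed.

Lemma grad_coord_near0 F u x : (\forall y \near x, u y = 0) -> grad_coord F u x = 0.
Proof.
move=> u0; rewrite /grad_coord big1// => i _; rewrite big1// => j _.
by rewrite (near_eq_derive (g := fun _ => 0))// derive_cst mulr0 scale0r.
Qed.

Lemma sum_grad_dot F {m} (u : 'I_m -> 'rV[R]_d -> R) x B (a : R) :
  (forall i, differentiable (u i) x) -> (\forall y \near x, \sum_i u i y = a) ->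
  area_density F x != 0 -> \sum_i dotv (grad_coord F (u i) x) B = 0.
Proof.
move=> du ua a0; apply: (mulfI a0); rewrite mulr0 mulr_sumr.
under eq_bigr do rewrite grad_coord_dot.
rewrite exchange_big big1// => b _; rewrite -mulr_suml.
suff -> : \sum_i 'D_('e_b) (u i) x = 0 by rewrite mul0r.
have h := derive_sum (fun i => diff_derivable (v := 'e_b) (du i)).
rewrite -h (near_eq_derive (g := fun _ => a)) ?derive_cst//.
by apply: (nbhsS _ ua) => y; rewrite fct_sumE.
Qed.

Variables (M : set E) (P : nat * (nat -> set 'rV[R]_d * ('rV[R]_d -> E) * (E -> R))).
Hypothesis pou : partition_of_unity M P.
Let n := P.1.
Let U (i : 'I_n) := (P.2 i).1.1.
Let phi (i : 'I_n) := (P.2 i).1.2.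
Let chi (i : 'I_n) := (P.2 i).2.

Lemma pou_chart i : local_param M (U i) (phi i).
Proof. by have := pou.1 i (ltn_ord i); rewrite /U /phi; case: (P.2 i) => [[? ?] ?] []. Qed.

Lemma pou_C2 i U' phi' : local_param M U' phi' -> jC2 setT U' (fun _ => chi i \o phi').
Proof.
move=> lp; have [oU _ _ _ _] := lp; apply: Ck2_jC2 => //.
by have := pou.1 i (ltn_ord i); rewrite /chi; case: (P.2 i) => [[? ?] ?] [_ + _ _]; apply.
Qed.

Lemma pou_support i : exists K, [/\ compact K, K `<=` U i &
  forall p, M p -> chi i p != 0 -> (phi i @` K) p].
Proof. by have := pou.1 i (ltn_ord i); rewrite /chi /U /phi; case: (P.2 i) => [[? ?] ?] []. Qed.

Lemma pou_sum p : M p -> \sum_i chi i p = 1.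
Proof. by move=> Mp; exact: pou.2. Qed.

Lemma pou_differentiable i U' phi' : local_param M U' phi' ->
  forall x, U' x -> differentiable (chi i \o phi') x.
Proof. by move=> lp x Ux; have [[h _ _] _] := pou_C2 i lp; exact: (h 0). Qed.

Variable th : E -> E.
Hypothesis ith : forall U phi, local_param M U phi -> C2_immersion U (th \o phi).

Lemma pou_grad0 i K U' phi' x : local_param M U' phi' -> U' x -> compact K -> K `<=` U i ->
  (forall p, M p -> chi i p != 0 -> (phi i @` K) p) -> ~ (phi i @` K) (phi' x) ->
  grad_coord (th \o phi') (chi i \o phi') x = 0.
Proof.
move=> lp Ux cK KU chiK nK; apply: grad_coord_near0.
have cC := local_param_image_compact (pou_chart i) cK KU.
have oC : open (~` (phi i @` K)) by rewrite openC; apply: (compact_closed _ cC); exact: norm_hausdorff.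
have hC : nbhs x (phi' @^-1` (~` (phi i @` K))).
  by apply: (local_param_continuous lp Ux); exact: open_nbhs_nbhs.
have [oU' _ _ _ _] := lp.
apply: (nbhsS _ (filterI (open_nbhs_nbhs (conj oU' Ux)) hC)) => y [Uy nCy].
have [//|hn] := eqVneq ((chi i \o phi') y) 0.
by case: nCy; exact: chiK (local_param_sub lp Uy) hn.
Qed.

Variable B : E -> E.
Hypothesis cB : forall U phi, local_param M U phi -> forall x k, U x ->
  (fun y => B (phi y) 0 k) @ nbhs x --> B (phi x) 0 k.

Let u i p := dotv (surface_grad M th (chi i) p) (B p).

Let uE i U' phi' x : local_param M U' phi' -> U' x ->
  u i (phi' x) = dotv (grad_coord (th \o phi') (chi i \o phi') x) (B (phi' x)).
Proof. by move=> lp Ux; rewrite /u (surface_gradE ith lp Ux)// => ? ? h; exact: pou_differentiable. Qed.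

Let uc i U' phi' x : local_param M U' phi' -> U' x ->
  (fun y => u i (phi' y)) @ nbhs x --> u i (phi' x).
Proof.
move=> lp Ux; have [oU' _ _ _ _] := lp; rewrite (uE i lp Ux).
have h := grad_dot_cvg (ith lp) Ux (pou_C2 i lp).1 (fun k => @cB _ _ lp x k Ux).
have hE : {near nbhs x, (fun y => dotv (grad_coord (th \o phi') (chi i \o phi') y) (B (phi' y))) =1 (fun y => u i (phi' y))}.
  by apply: (nbhsS _ (open_nbhs_nbhs (conj oU' Ux))) => y Uy; rewrite (uE i lp Uy).
by apply: (cvg_trans _ h); exact: near_eq_cvg hE.
Qed.

Let cc i U' phi' x : local_param M U' phi' -> U' x ->
  (fun y => chi i (phi' y)) @ nbhs x --> chi i (phi' x).
Proof. by move=> lp Ux; exact: differentiable_continuous (pou_differentiable i lp Ux). Qed.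

Let w i j x := \1_(U j) x * (chi j (phi j x) * u i (phi j x) * area_density (th \o phi j) x).

Let wc i j U' phi' x : local_param M U' phi' -> U' x ->
  (fun y => chi j (phi' y) * u i (phi' y)) @ nbhs x --> chi j (phi' x) * u i (phi' x).
Proof.
move=> lp Ux; have h1 : (fun y => chi j (phi' y)) @ nbhs x --> chi j (phi' x) by exact: (@cc j _ _ x lp Ux).
have h2 : (fun y => u i (phi' y)) @ nbhs x --> u i (phi' x) by exact: (@uc i _ _ x lp Ux).
exact: (cvgM h1 h2).
Qed.

Let vc i j U' phi' x : local_param M U' phi' -> U' x ->
  (fun y => chi j (phi' y) * u i (phi' y) * area_density (th \o phi') y) @ nbhs x
    --> chi j (phi' x) * u i (phi' x) * area_density (th \o phi') x.
Proof.
move=> lp Ux; have [oU' _ _ _ _] := lp; have [_ h _] := C2_area (ith lp).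
have h1 : (fun y => area_density (th \o phi') y) @ nbhs x --> area_density (th \o phi') x.
  exact: (jc_cvg (s := 0) oU' h).
have h2 : (fun y => chi j (phi' y) * u i (phi' y)) @ nbhs x --> chi j (phi' x) * u i (phi' x) by exact: (@wc i j _ _ x lp Ux).
exact: (cvgM h2 h1).
Qed.

(* Insert 1 = sum_j chi_j, move each product to the chart j, and sum over i. *)
Lemma sum_grad_partition : \sum_i rVI (fun x => \1_(U i) x *
  (area_density (th \o phi i) x * dotv (grad_coord (th \o phi i) (chi i \o phi i) x) (B (phi i x)))) = 0.
Proof.
have step1 i : rVI (fun x => \1_(U i) x * (area_density (th \o phi i) x *
    dotv (grad_coord (th \o phi i) (chi i \o phi i) x) (B (phi i x)))) = \sum_j rVI (w i j).
  have lp := pou_chart i; have [oU _ _ _ _] := lp.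
  have [K [cK KU chiK]] := pou_support i.
  have h j : rVI (w i j) = rVI (fun x => \1_(U i) x * (chi j (phi i x) * u i (phi i x) * area_density (th \o phi i) x)).
    have [L [cL LU chiL]] := pou_support j.
    apply/esym; apply: (chart_change (h := fun p => chi j p * u i p) lp (pou_chart j) cK KU cL LU (ith (pou_chart j))) => [x Ux|p Mp].
    - exact: (@wc i j _ _ x (pou_chart j) Ux).
    rewrite mulf_eq0 negb_or => /andP[cj ui]; split; last exact: chiL.
    (* The point p is not yet known to lie in chart i, so the gradient of chi_i is evaluated in
       chart j, which contains p because chi_j p is nonzero. *)
    have [U' [phi' [lp' [x Ux xp]]]] : exists U' phi', local_param M U' phi' /\ (phi' @` U') p.
      by have [z Kz zp] := chiL p Mp cj; exists (U j), (phi j); split; [exact: pou_chart|exists z => //; exact: LU].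
    apply: contrapT => nK; move: ui; rewrite -xp (uE i lp' Ux) (pou_grad0 lp' Ux cK KU chiK) ?xp//.
    by rewrite /dotv big1 ?eqxx// => k _; rewrite mxE mul0r.
  rewrite (eq_bigr _ (fun j _ => h j)) -rVI_sum => [|j _]; last first.
    apply: (Cc_indic oU cK KU) => [x Ux|x Ux nKx]; first exact: (@vc _ _ _ _ x lp Ux).
    rewrite (uE i lp Ux) (pou_grad0 lp Ux cK KU chiK); last by move/(local_param_image_mem lp Ux KU).
    by rewrite /dotv big1 ?mulr0 ?mul0r// => k _; rewrite mxE mul0r.
  congr rV_integral; apply/funext => x; rewrite -mulr_sumr !indicE.
  have [Ux|Ux] := asboolP (U i x); last by rewrite memNset// !mul0r.
  rewrite -!mulr_suml pou_sum; last exact: local_param_sub lp _ Ux.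
  by rewrite mul1r (uE i lp Ux); congr (_ * _); exact: mulrC.
rewrite (eq_bigr _ (fun i _ => step1 i)) exchange_big big1// => j _.
have lp := pou_chart j; have [oU _ _ _ _] := lp; have [L [cL LU chiL]] := pou_support j.
rewrite -rVI_sum => [|i _]; last first.
  apply: (Cc_indic oU cL LU) => [x Ux|x Ux nKx]; first exact: (@vc _ _ _ _ x lp Ux).
  have [->|hn] := eqVneq (chi j (phi j x)) 0; first by rewrite !mul0r.
  case: nKx; apply: (local_param_image_mem lp Ux LU); exact: chiL (local_param_sub lp Ux) hn.
rewrite -[RHS](rVI0 (d := d)); congr rV_integral; apply/funext => x; rewrite -mulr_sumr indicE.
have [Ux|Ux] := asboolP (U j x); last by rewrite memNset// mul0r.
rewrite -mulr_suml -mulr_sumr; under eq_bigr do rewrite (uE _ lp Ux).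
have dchi i : differentiable (chi i \o phi j) x by exact: pou_differentiable lp _ Ux.
have sum1 : \forall y \near x, \sum_i (chi i \o phi j) y = 1.
  by apply: (nbhsS _ (open_nbhs_nbhs (conj oU Ux))) => y Uy; exact: pou_sum (local_param_sub lp Uy).
have a0 : area_density (th \o phi j) x != 0 by rewrite gt_eqF// (C2_area_gt0 (ith lp)).
by rewrite (sum_grad_dot _ dchi sum1 a0) mulr0 mul0r mulr0.
Qed.

End PartitionOfUnity.

(** * Conservation *)

Section RegularityTransfer.
Context {R : realType} {d : nat}.
Implicit Types (U : set 'rV[R]_d) (F phi : 'rV[R]_d -> 'rV[R]_d.+1) (M : set 'rV[R]_d.+1).
Notation E := 'rV[R]_d.+1.

Lemma jC2_comp {V : normedModType R} (S : set R) (U : set V) f (phi phi1 phi2 : R -> R) : open U ->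
  jC2 S U f -> (forall y, is_derive y (1 : R) phi (phi1 y)) -> (forall y, is_derive y (1 : R) phi1 (phi2 y)) ->
  continuous phi2 -> jC2 S U (fun s x => phi (f s x)).
Proof.
move=> oU [cf cdf] d1 d2 c2.
have c1 : continuous phi1.
  by move=> y; have [h _] := d2 y; apply: differentiable_continuous; apply/derivable1_diffP.
split=> [|v].
  exact: (jC1_comp (phi' := phi1) cf (fun s x _ _ => d1 (f s x)) (fun s x _ _ => c1 (f s x))).
have J : jC1 S U (fun s x => phi1 (f s x)).
  exact: (jC1_comp (phi' := phi2) cf (fun s x _ _ => d2 (f s x)) (fun s x _ _ => c2 (f s x))).
apply: (jC1_eq oU _ (jC1M J (cdf v))) => s x Ss Ux.
have [df _ _] := cf.
by have [_ ->] := derive_comp1 v (df s x Ss Ux) (d1 (f s x)).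
Qed.

(** Three derivatives of G make G' of class C^2, hence also G'(c) in space, so that its surface
    gradient is C^1 and can be integrated by parts. *)
Lemma Ck3_derive (G : R -> R) : Ck_real 3 G -> [/\ forall y, is_derive y (1 : R) (derive1 G) (G^`(2) y),
  forall y, is_derive y (1 : R) G^`(2) (G^`(3) y) & continuous G^`(3)].
Proof.
move=> [dG cG]; split=> [y|y|]; last exact: cG.
  by split; [exact: (dG 1%N y isT)|rewrite -derive1E].
by split; [exact: (dG 2%N y isT)|rewrite -derive1E].
Qed.

Lemma grad_coord_jC1 U F u k : C2_immersion U F -> jC2 setT U (fun _ => u) ->
  jC1 setT U (fun _ x => grad_coord F u x 0 k).
Proof.
move=> iF [cu cdu]; have [oU _ _ _] := iF.
have ca : jC1 setT U (fun _ x => (area_density F x)^-1).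
  by apply: (jC1V (C2_area iF)) => _ x _ Ux; rewrite gt_eqF// (C2_area_gt0 iF).
have cs : jC1 setT U (fun _ x => \sum_b 'D_('e_b) u x * conormal (Dmx F x) b k).
  by apply: jC1_sum => b _; exact: (jC1M (cdu 'e_b) (C2_conormal iF b k)).
apply: (jC1_eq oU _ (jC1M ca cs)) => s x _ Ux.
by rewrite -grad_coord_conormal mulKf// gt_eqF// (C2_area_gt0 iF).
Qed.

Lemma grad_coord_normal F u x nu : nu *m (Dmx F x)^T = 0 -> dotv (grad_coord F u x) nu = 0.
Proof.
move=> nuP; rewrite dotvE grad_coord_mx -[_ *m nu^T]mulmxA.
have -> : Dmx F x *m nu^T = (nu *m (Dmx F x)^T)^T by rewrite trmx_mul trmxK.
by rewrite nuP trmx0 mulmx0 mxE.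
Qed.

(* Near x0, nu is the normalized projection of the constant vector nu x0 onto
   the normal line. *)
Lemma normal_differentiable U F (nu : 'rV[R]_d -> E) x0 : C2_immersion U F ->
  (forall x k, U x -> (fun y => nu y 0 k) @ nbhs x --> nu x 0 k) ->
  (forall x, U x -> dotv (nu x) (nu x) = 1) ->
  (forall x, U x -> nu x *m (Dmx F x)^T = 0) ->
  U x0 -> differentiable nu x0.
Proof.
move=> iF cnu nu1 nuP Ux0; have [oU _ _ fF] := iF.
pose n0 := nu x0.
(* The conormal divided by the area density is g^-1 P, so the subtracted term is the tangential
   projection of [n0]. Every ingredient other than the constant [n0] is C^1 in x. *)
pose v x := n0 - (area_density F x)^-1 *: (n0 *m (Dmx F x)^T *m conormal (Dmx F x)).
have Jv k : jC1 setT U (fun _ x => v x 0 k).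
  have ca : jC1 setT U (fun _ x => (area_density F x)^-1).
    by apply: (jC1V (C2_area iF)) => _ x _ Ux; rewrite gt_eqF// (C2_area_gt0 iF).
  have cm : jC1m setT U (fun _ x => n0 *m (Dmx F x)^T *m conormal (Dmx F x)).
    apply: jC1m_mul (C2_conormal iF); apply: (jC1m_mul (A := fun _ _ => n0)); last exact: (jC1m_tr (C2_Dmx iF)).
    by move=> i j; exact: jC1_cst.
  apply: (jC1_eq oU _ (jC1B (jC1_cst _ _ (n0 0 k)) (jC1M ca (cm 0 k)))) => s x _ _.
  by rewrite /v [RHS]mxE [X in _ = _ + X]mxE [X in _ = _ - X]mxE.
have vP x : U x -> v x *m (Dmx F x)^T = 0.
  move=> Ux; rewrite mulmxBl -scalemxAl -[_ *m conormal _ *m _]mulmxA conormal_mulT; last first.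
    by rewrite gt_eqF// (C2_det_gt0 iF).
  rewrite mul_mx_scalar scalerA -area_densityE mulVf ?scale1r ?subrr//.
  by rewrite gt_eqF// (C2_area_gt0 iF).
have vnu x : U x -> v x = dotv n0 (nu x) *: nu x.
  move=> Ux; rewrite {1}(normal_span (fF x Ux) (nuP x Ux) (nu1 x Ux) (vP x Ux)); congr (_ *: _).
  rewrite /v !dotvE mulmxBl -scalemxAl -[_ *m conormal _ *m _]mulmxA.
  have -> : conormal (Dmx F x) *m (nu x)^T = 0.
    rewrite /conormal -scalemxAl -[_ *m _^T]mulmxA.
    have -> : Dmx F x *m (nu x)^T = (nu x *m (Dmx F x)^T)^T by rewrite trmx_mul trmxK.
    by rewrite nuP// trmx0 mulmx0 scaler0.
  by rewrite mulmx0 scaler0 subr0.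
pose q x := \sum_k v x 0 k * v x 0 k.
have Jq : jC1 setT U (fun _ x => q x) by apply: jC1_sum => k _; exact: jC1M.
have qE x : U x -> q x = dotv n0 (nu x) ^+ 2.
  by move=> Ux; rewrite /q -/(dotv _ _) vnu// dotvZl dotvZr nu1// mulr1 expr2.
have s0 : dotv n0 (nu x0) = 1 by exact: nu1.
(* Since v = (n0 . nu) nu, normalizing v gives nu up to sign; near x0 the factor is positive and the
   sign is right. *)
have near1 : \forall x \near x0, U x /\ 0 < dotv n0 (nu x).
  have cs : (fun x => dotv n0 (nu x)) @ nbhs x0 --> dotv n0 (nu x0).
    have h k : (fun y => n0 0 k * nu y 0 k) @ nbhs x0 --> n0 0 k * nu x0 0 k.
      by have h1 := cnu x0 k Ux0; exact: (cvgM (cvg_cst (n0 0 k)) h1).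
    exact: (@cvg_big_sum _ _ _ (nbhs x0) _ _ _ _ _ h).
  have hn : \forall x \near x0, 0 < dotv n0 (nu x).
    have /cvgrPdist_lt /(_ 1 ltr01) := cs; apply: nbhsS => x.
    by rewrite s0 => /ltr_normlP [h1 h2]; lra.
  exact: (filterI (open_nbhs_nbhs (conj oU Ux0)) hn).
apply: differentiable_rV => k.
have nE : \forall x \near x0, (Num.sqrt (q x))^-1 * v x 0 k = nu x 0 k.
  apply: (nbhsS _ near1) => x [Ux sx]; rewrite qE// sqrtr_sqr gtr0_norm// vnu// mxE mulKf//.
  by rewrite gt_eqF.
apply: (differentiable_near_eq nE).
have q0 : q x0 = 1 by rewrite qE// s0 expr1n.
have [dq _ _] := Jq; have [dv _ _] := Jv k.
have ds : differentiable (fun x => Num.sqrt (q x)) x0.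
  have q00 : 0 < q x0 by rewrite q0.
  exact: (derive_comp1 0 (dq 0 x0 I Ux0) (is_derive1_sqrt q00)).1.
have dsV : differentiable (fun x => (Num.sqrt (q x))^-1) x0.
  apply: (differentiable_comp (g := fun y : R => y^-1) ds); apply/derivable1_diffP.
  by apply: (@derivableV _ _ id); rewrite ?q0 ?sqrtr1 ?oner_eq0.
exact: (differentiableM dsV (dv 0 x0 I Ux0)).
Qed.

(** The quotients are one-sided at 0 and T. There they are used for continuity only; a two-sided
    derivative is needed just inside the interval, where small increments stay in [0, T]. *)
Lemma derivative0_constant (T : R) (f : R -> R) : 0 < T ->
  (forall t, 0 <= t <= T ->
    (fun h => h^-1 * (f (t + h) - f t)) @ within [set h | 0 <= t + h <= T] 0^' --> (0 : R)) ->
  forall t, 0 <= t <= T -> f t = f 0.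
Proof.
move=> T0 h t /andP[t0 tT].
have near0 s (A : set R) : 0 <= s <= T -> nbhs (0 : R) A ->
    \forall h \near (0 : R), h != 0 -> 0 <= s + h <= T -> A (h^-1 * (f (s + h) - f s)).
  by move=> sT hA; exact: (h s sT _ hA).
have cf : {within `[0, t], continuous f}.
  apply/subspace_continuousP => s; rewrite /= in_itv /= => /andP[s0 st].
  have sT : 0 <= s <= T by rewrite s0 (le_trans st tT).
  apply/cvgrPdist_lt => e e0.
  (* Near s the quotients have absolute value below 1, hence |f x - f s| < |x - s| for x distinct
     from s. *)
  have [r /= r0 hr] := near0 s _ sT (nbhsx_ballx (0 : R) 1 ltr01).
  have m0 : 0 < Num.min r e by rewrite lt_min r0.
  apply: (nbhsS _ (nbhsx_ballx s _ m0)) => x; rewrite -ball_normE /ball_ /= lt_min => /andP[xr xe].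
  rewrite in_itv /= => /andP[x0 xt].
  have [->|xs] := eqVneq x s; first by rewrite subrr normr0.
  have xs0 : x - s != 0 by rewrite subr_eq0.
  have := hr (x - s); rewrite /ball_ /= sub0r normrN distrC => /(_ xr xs0).
  rewrite subrKC x0 (le_trans xt tT) -ball_normE /= sub0r normrN normrM normfV => /(_ isT).
  rewrite mulrC ltr_pdivrMr ?normr_gt0// mul1r distrC => H.
  by rewrite (lt_trans H)// distrC.
have df s : s \in `]0, t[%R -> is_derive s (1 : R) f 0.
  rewrite in_itv /= => /andP[s0 st].
  have sT : 0 <= s <= T by rewrite !ltW// (lt_le_trans st tT).
  have H : (fun h : R => h^-1 *: (f (h *: 1 + s) - f s)) @ (0 : R)^' --> (0 : R).
    move=> A hA; have h1 := near0 s A sT hA.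
    have m0 : 0 < Num.min s (t - s) by rewrite lt_min s0 subr_gt0.
    apply: (nbhsS _ (filterI (nbhsx_ballx (0 : R) _ m0) h1)) => k [].
    rewrite -ball_normE /ball_ /= sub0r normrN lt_min => /andP[k1 k2] + kn0 => /(_ kn0).
    rewrite /GRing.scale /= mulr1 (addrC k s); apply.
    by move: k1 k2 => /ltr_normlP [k1 k1'] /ltr_normlP [k2 k2']; apply/andP; split; lra.
  by split; [apply/cvg_ex; exists 0|exact: cvg_lim H].
have [s _] := MVT_segment t0 df cf; rewrite mul0r => /eqP.
by rewrite subr_eq0 => /eqP.
Qed.
End RegularityTransfer.

Lemma div_coord_near_eq {R : realType} {d} (F Y Z : 'rV[R]_d -> 'rV[R]_d.+1) x :
  (\forall y \near x, Y y = Z y) -> div_coord F Y x = div_coord F Z x.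
Proof.
move=> YZ; rewrite !div_coord_mx; have -> : Dmx Y x = Dmx Z x; last by [].
by apply/matrixP => b k; rewrite [LHS]mxE [RHS]mxE (near_eq_derive _ YZ).
Qed.

(** [surface_integral] with the partition as an argument: the derivative is computed for one
    arbitrary partition that stays fixed in time. *)
Definition partition_integral {R : realType} {d} (P : nat * (nat -> set 'rV[R]_d * ('rV[R]_d -> 'rV[R]_d.+1) * ('rV[R]_d.+1 -> R)))
    (th : 'rV[R]_d.+1 -> 'rV[R]_d.+1) (f : 'rV[R]_d.+1 -> R) : R :=
  \sum_(i < P.1) rV_integral (fun x => \1_((P.2 i).1.1) x * ((P.2 i).2 ((P.2 i).1.2 x) *
     f ((P.2 i).1.2 x) * area_density (th \o (P.2 i).1.2) x)).

Lemma surface_integralE {R : realType} {d} (M : set 'rV[R]_d.+1) th f :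
  surface_integral M th f = partition_integral (get (partition_of_unity M)) th f.
Proof. by apply: eq_bigr => i _; case: ((get (partition_of_unity M)).2 i) => [[? ?] ?]. Qed.

(* get returns the default value, which has no charts. *)
Lemma surface_integral_nopartition {R : realType} {d} (M : set 'rV[R]_d.+1) th f :
  (forall P, ~ partition_of_unity M P) -> surface_integral M th f = 0.
Proof.
move=> nP; have E := getPN nP; rewrite surface_integralE.
move: E; move: (get _) => P ->; exact: big_ord0.
Qed.

(** * The derivative of the total mass *)

Section Conservation.
Context {R : realType} {d : nat}.
Notation E := 'rV[R]_d.+1.
Notation rVI := rV_integral.
Variables (G : R -> R) (T : R) (M : set E) (theta nu : R -> E -> E) (c : R -> E -> R).
Hypotheses (G_C3 : Ck_real 3 G) (htheta : evolving_hypersurface T M theta)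
  (hnu : normal_field T M theta nu) (c_C1C0 : C1_C0 T M c) (c_C0C2 : C0_C2 T M c).
Variable t : R.
Hypothesis tT : 0 <= t <= T.
Let f p := derive1 G (c t p).
Let V := normal_velocity T theta nu t.
Let H := mean_curvature M theta nu t.
Hypothesis pde : forall p, M p -> normal_dtime T M theta c t p =
  laplace_beltrami M (theta t) f p + c t p * H p * V p.

Let S := [set h : R | 0 <= t + h <= T].

Let S0 : S 0. Proof. by rewrite /S /= addr0. Qed.

Let inT s : S s -> `[0, T]%classic (t + s).
Proof. by move=> Ss; rewrite /= in_itv. Qed.

Let tTI : `[0, T]%classic t.
Proof. by rewrite /= in_itv. Qed.

Let cshift : continuous (fun h : R => t + h).
Proof. by move=> h; apply: cvgD; [exact: cvg_cst|exact: cvg_id]. Qed.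

Let cconst : continuous (fun _ : R => t).
Proof. by move=> h; exact: cvg_cst. Qed.

Let ith U phi : local_param M U phi -> C2_immersion U (theta t \o phi).
Proof. by move=> lp; exact: evolving_C2 htheta tT lp. Qed.

Let cJ U phi : local_param M U phi -> jC2 `[0, T] U (fun s => c s \o phi).
Proof. by move=> lp; have [oU _ _ _ _] := lp; apply: C0_C2_jC2 => //; exact: c_C0C2. Qed.

Let fJ U phi : local_param M U phi -> jC2 setT U (fun _ => f \o phi).
Proof.
move=> lp; have [oU _ _ _ _] := lp; have [d1 d2 c3] := Ck3_derive G_C3.
have J := jC2_reparam (S' := setT) cconst (fun _ _ => tTI) (cJ lp).
exact: (jC2_comp oU J d1 d2 c3).
Qed.

Let df U phi : local_param M U phi -> forall x, U x -> differentiable (f \o phi) x.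
Proof. by move=> lp x Ux; have [[h _ _] _] := fJ lp; exact: (h 0). Qed.

Let dc U phi : local_param M U phi -> forall x, U x -> differentiable (c t \o phi) x.
Proof. by move=> lp x Ux; exact: C0_C2_differentiable c_C0C2 tT lp x Ux. Qed.

Let Y phi := grad_coord (theta t \o phi) (f \o phi).

Let gradE U phi x : local_param M U phi -> U x -> surface_grad M (theta t) f (phi x) = Y phi x.
Proof. by move=> lp Ux; exact: (surface_gradE ith lp Ux df). Qed.

Let YJ U phi k : local_param M U phi -> jC1 setT U (fun _ x => Y phi x 0 k).
Proof. by move=> lp; exact: (grad_coord_jC1 k (ith lp) (fJ lp)). Qed.

Let dY U phi x : local_param M U phi -> U x -> differentiable (Y phi) x.
Proof.
by move=> lp Ux; apply: differentiable_rV => k; have [h _ _] := YJ k lp; exact: (h 0).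
Qed.

Let near_gradE U phi x : local_param M U phi -> U x ->
  \forall y \near x, Y phi y = (surface_grad M (theta t) f \o phi) y.
Proof.
move=> lp Ux; have [oU _ _ _ _] := lp.
by apply: (nbhsS _ (open_nbhs_nbhs (conj oU Ux))) => y Uy; rewrite /= (gradE lp Uy).
Qed.

Let laplaceE U phi x : local_param M U phi -> U x ->
  laplace_beltrami M (theta t) f (phi x) = div_coord (theta t \o phi) (Y phi) x.
Proof.
move=> lp Ux; rewrite /laplace_beltrami (surface_divE ith lp Ux) => [|U' phi' lp' y Uy].
  exact: (esym (div_coord_near_eq _ (near_gradE lp Ux))).
exact: differentiable_near_eq (near_gradE lp' Uy) (dY lp' Uy).
Qed.

Let nu1 p : M p -> dotv (nu t p) (nu t p) = 1.
Proof. by case: hnu => _ /(_ t tT) [+ _]; apply. Qed.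

Let nuP U phi x : local_param M U phi -> U x -> nu t (phi x) *m (Dmx (theta t \o phi) x)^T = 0.
Proof.
move=> lp Ux; apply/rowP => b; rewrite [RHS]mxE [LHS]mxE.
case: hnu => _ /(_ t tT) [_ /(_ _ _ lp x 'e_b Ux)] h; rewrite -[RHS]h.
by apply: eq_bigr => k _; rewrite [(_^T) _ _]mxE [Dmx _ _ _ _]mxE.
Qed.

Let cphi U phi : local_param M U phi -> {within U, continuous phi}.
Proof.
move=> lp; apply: continuous_in_subspaceT => x; rewrite inE => Ux.
exact: (local_param_continuous lp Ux).
Qed.

Let dnu U phi x : local_param M U phi -> U x -> differentiable (nu t \o phi) x.
Proof.
move=> lp Ux; have [oU _ _ _ _] := lp.
apply: (normal_differentiable (ith lp)) Ux => [y k Uy|y Uy|y Uy]; last exact: (nuP lp Uy).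
  have cn : {within M, continuous (nu t)}.
    case: hnu => /subspace_continuousP h _; apply/subspace_continuousP => p Mp.
    have hp : (fun q => (t, q)) @ within M (nbhs p) --> within (`[0, T]%classic `*` M) (nbhs (t, p)).
      move=> A [[B C] /= [hB hC] BC]; apply: (nbhsS _ hC) => q Cq Mq.
      by apply: BC => //; split => //=; exact: nbhs_singleton.
    exact: (@cvg_comp _ _ _ (fun q => (t, q)) (fun z => nu z.1 z.2) _ _ _ hp (h (t, p) (conj tTI Mp))).
  have h := within_comp_cvg oU Uy (cphi lp) (local_param_sub lp) cn.
  exact: (@cvg_comp _ _ _ _ (fun z : E => z 0 k) _ _ _ h (@coord_continuous _ _ _ 0 k (nu t (phi y)))).
by apply: nu1; exact: local_param_sub lp _ Uy.
Qed.

(** The base time is written [t + 0] because it arises as the value at 0 of the families indexed by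
    t + h. *)
Let dquotE {W : normedModType R} (g : R -> E -> W) h p : g (t + h) p - g (t + 0) p = h *: dquot T g t h p.
Proof.
rewrite /dquot addr0; have [->|hn] := eqVneq h 0; first by rewrite addr0 subrr scale0r.
by rewrite scalerA divff// scale1r.
Qed.

Let cquot U phi : local_param M U phi -> jc S U (fun h x => dquot T c t h (phi x)).
Proof.
move=> lp; have [oU _ _ _ _] := lp; have [[_ h _] _] := cJ lp.
exact: (dquot_jc oU (cphi lp) (local_param_sub lp) tT c_C1C0 h).
Qed.

Let tquot U phi : local_param M U phi -> jc S U (fun h x => dquot T theta t h (phi x)).
Proof.
move=> lp; have [oU _ _ _ _] := lp; have [h1 h2 _] := htheta.
have [c0 f0 _] := h2 _ _ lp.
exact: (dquot_jc oU (cphi lp) (local_param_sub lp) tT h1 (family_jc oU c0 f0)).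
Qed.

Let velocity_pde U phi x : local_param M U phi -> U x ->
  dtime T c t (phi x) = dotv (dtime T theta t (phi x)) (grad_coord (theta t \o phi) (c t \o phi) x)
    + div_coord (theta t \o phi) (Y phi) x
    - c t (phi x) * div_coord (theta t \o phi) (nu t \o phi) x * dotv (dtime T theta t (phi x)) (nu t (phi x)).
Proof.
move=> lp Ux; have := pde (local_param_sub lp Ux).
rewrite (laplaceE lp Ux) /normal_dtime (surface_gradE ith lp Ux dc) /total_velocity.
rewrite /H /mean_curvature (surface_divE ith lp Ux); last by move=> ? ? lp' ? ?; exact: dnu lp' _.
move/eqP; rewrite subr_eq => /eqP ->; rewrite /V /normal_velocity /total_velocity mulrN mulNr.
by rewrite [LHS]addrC addrA.
Qed.

(** The field paired with grad chi in each chart. It is a function on M, the same for all charts, so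
    that the contributions of the charts can be summed by [sum_grad_partition]. *)
Let B p := surface_grad M (theta t) f p + c t p *: dtime T theta t p.

Lemma conservation_chart U phi L chi : local_param M U phi -> compact L -> L `<=` U ->
  jC2 setT U (fun _ => chi \o phi) -> (forall x, U x -> ~ L x -> chi (phi x) = 0) ->
  (fun h => h^-1 * (rVI (fun x => \1_U x * (chi (phi x) * c (t + h) (phi x) * area_density (theta (t + h) \o phi) x)) -
     rVI (fun x => \1_U x * (chi (phi x) * c t (phi x) * area_density (theta t \o phi) x)))) @ within S (0 : R)^' -->
  - rVI (fun x => \1_U x * (area_density (theta t \o phi) x *
     dotv (grad_coord (theta t \o phi) (chi \o phi) x) (B (phi x)))).
Proof.
move=> lp cL LU chiJ chi0; have [oU _ _ _ _] := lp.
have e0 : t + 0 = t := addr0 t.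
have [h1 h2 h3] := htheta.
have dF h x : S h -> U x -> differentiable (theta (t + h) \o phi) x.
  by move=> Sh Ux; apply: (C0_C2_differentiable h2 _ lp).
have Jth k : jC2 S U (fun h x => theta (t + h) (phi x) 0 k).
  exact: (jC2_reparam cshift inT (C0_C2_coord k oU (h2 _ _ lp)).1).
pose F h := theta (t + h) \o phi; pose q h x := dquot T theta t h (phi x).
pose cc h := c (t + h) \o phi; pose qc h x := dquot T c t h (phi x).
have F0 : F 0 = theta t \o phi by rewrite /F e0.
have cc0 : cc 0 = c t \o phi by rewrite /cc e0.
have a1 : jC1 S U (fun _ => chi \o phi) by exact: (jC1_const _ (s := 0) (S := setT) I chiJ.1).
have a2 k : jC1 S U (fun h x => F h x 0 k) by exact: (Jth k).1.
have a3 : jC1m S U (fun h => Dmx (F h)).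
  move=> b k; apply: (jC1_eq oU _ ((Jth k).2 'e_b)) => h x Sh Ux.
  by rewrite [RHS]mxE -derive_coord//; exact: dF.
have a4 h x v k : S h -> U x -> 'D_v (fun y => F h y 0 k) x = ('D_v (F h) x) 0 k.
  by move=> Sh Ux; apply: derive_coord; exact: dF.
have a5 h x : S h -> U x -> row_free (Dmx (F h) x).
  by move=> Sh Ux; have [_ _ _] := evolving_C2 htheta Sh lp; apply.
have a6 k : jC2 setT U (fun _ x => F 0 x 0 k) by rewrite F0; have [_ _ + _] := ith lp; apply.
have a7 : jC1 S U cc by exact: (jC2_reparam cshift inT (cJ lp)).1.
have a8 k : jc S U (fun h x => q h x 0 k).
  apply: (jc_comp (phi := fun y : E => y 0 k) (tquot lp)) => h x _ _.
  exact: coord_continuous.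
have a9 h x k : S h -> U x -> F h x 0 k - F 0 x 0 k = h * q h x 0 k.
  move=> _ _; have := congr1 (fun y : E => y 0 k) (dquotE theta h (phi x)).
  by rewrite [X in X = _ -> _]mxE [X in _ + X = _ -> _]mxE [X in _ = X -> _]mxE.
have a10 : jc S U qc by exact: (cquot lp).
have a11 h x : S h -> U x -> cc h x - cc 0 x = h * qc h x by move=> _ _; exact: (dquotE c h (phi x)).
have a12 x k : U x -> differentiable (fun y => (nu t \o phi) y 0 k) x.
  by move=> Ux; exact: (differentiable_comp (dnu lp Ux) (differentiable_coord _ _ _)).
have a13 x k v : U x -> 'D_v (fun y => (nu t \o phi) y 0 k) x = ('D_v (nu t \o phi) x) 0 k.
  by move=> Ux; apply: derive_coord; exact: (dnu lp Ux).
have a14 x : U x -> (nu t \o phi) x *m (Dmx (F 0) x)^T = 0 by move=> Ux; rewrite F0; exact: (nuP lp Ux).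
have a15 x : U x -> dotv ((nu t \o phi) x) ((nu t \o phi) x) = 1.
  by move=> Ux; apply: nu1; exact: local_param_sub lp _ Ux.
have a16 k : jC1 S U (fun _ x => Y phi x 0 k) by exact: (jC1_const _ (s := 0) (S := setT) I (YJ k lp)).
have a17 x k v : U x -> 'D_v (fun y => Y phi y 0 k) x = ('D_v (Y phi) x) 0 k.
  by move=> Ux; apply: derive_coord; exact: (dY lp Ux).
have a18 x : U x -> dotv (Y phi x) ((nu t \o phi) x) = 0.
  by move=> Ux; apply: grad_coord_normal; exact: (nuP lp Ux).
have dq0 (W : normedModType R) (g : R -> E -> W) p : dquot T g t 0 p = dtime T g t p.
  by rewrite /dquot eqxx.
have a19 x : U x -> qc 0 x = dotv (q 0 x) (grad_coord (F 0) (cc 0) x) + div_coord (F 0) (Y phi) x -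
    cc 0 x * div_coord (F 0) (nu t \o phi) x * dotv (q 0 x) ((nu t \o phi) x).
  by move=> Ux; rewrite F0 cc0 /q /qc !dq0; exact: (velocity_pde lp Ux).
have key := @chart_derivative R d U L S F q cc qc (chi \o phi) (nu t \o phi) (Y phi) oU cL LU S0
  a1 chi0 a2 a3 a4 a5 a6 a7 a8 a9 a10 a11 a12 a13 a14 a15 a16 a17 a18 a19.
have e2 : rVI (fun x => \1_U x * (area_density (theta t \o phi) x *
     dotv (grad_coord (theta t \o phi) (chi \o phi) x) (B (phi x)))) =
  rVI (fun x => \1_U x * (area_density (F 0) x * dotv (grad_coord (F 0) (chi \o phi) x) (Y phi x + cc 0 x *: q 0 x))).
  congr rV_integral; apply/funext => x; rewrite !indicE.
  have [Ux|Ux] := asboolP (U x); last by rewrite memNset// !mul0r.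
  by rewrite /B (gradE lp Ux) F0 cc0 /q dq0.
have e1 : rVI (fun x => \1_U x * (chi (phi x) * c t (phi x) * area_density (theta t \o phi) x)) =
  rVI (fun x => \1_U x * ((chi \o phi) x * cc 0 x * area_density (F 0) x)).
  by rewrite F0 cc0.
have subst (A : R -> R) a a' b b' : a' = a -> b' = b ->
  (fun h => h^-1 * (A h - a)) @ within S (0 : R)^' --> - b -> (fun h => h^-1 * (A h - a')) @ within S (0 : R)^' --> - b'.
  by move=> -> ->.
exact: (subst _ _ _ _ _ e1 e2 key).
Qed.

Let cB U phi : local_param M U phi -> forall x k, U x ->
  (fun y => B (phi y) 0 k) @ nbhs x --> B (phi x) 0 k.
Proof.
move=> lp x k Ux; have [oU _ _ _ _] := lp.
have [_ h1 _] := YJ k lp; have c1 : (fun y => Y phi y 0 k) @ nbhs x --> Y phi x 0 k by exact: (jc_cvg (s := 0) oU h1).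
have c2 : (fun y => c t (phi y)) @ nbhs x --> c t (phi x) by exact: differentiable_continuous (dc lp Ux).
have h3 := jc_cvg oU (tquot lp) S0 Ux.
have c3 : (fun y => dquot T theta t 0 (phi y) 0 k) @ nbhs x --> dquot T theta t 0 (phi x) 0 k.
  exact: (@cvg_comp _ _ _ _ (fun z : E => z 0 k) _ _ _ h3 (@coord_continuous _ _ _ 0 k (dquot T theta t 0 (phi x)))).
have c4 : (fun y => c t (phi y) * dquot T theta t 0 (phi y) 0 k) @ nbhs x --> c t (phi x) * dquot T theta t 0 (phi x) 0 k.
  exact: (cvgM c2 c3).
have key : (fun y => Y phi y 0 k + c t (phi y) * dquot T theta t 0 (phi y) 0 k) @ nbhs x -->
   Y phi x 0 k + c t (phi x) * dquot T theta t 0 (phi x) 0 k by exact: (cvgD c1 c4).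
have BE y : U y -> Y phi y 0 k + c t (phi y) * dquot T theta t 0 (phi y) 0 k = B (phi y) 0 k.
  by move=> Uy; rewrite /B (gradE lp Uy) /dquot eqxx [RHS]mxE [X in _ = _ + X]mxE.
refine (eq_ind _ (fun l : R => _ @ nbhs x --> l) _ _ (BE x Ux)).
have hE : {near nbhs x, (fun y => Y phi y 0 k + c t (phi y) * dquot T theta t 0 (phi y) 0 k) =1 (fun y => B (phi y) 0 k)}.
  by apply: (nbhsS _ (open_nbhs_nbhs (conj oU Ux))) => y Uy; exact: BE.
by apply: (cvg_trans _ key); exact: near_eq_cvg hE.
Qed.

Lemma conservation_derivative P : partition_of_unity M P ->
  let m s := partition_integral P (theta s) (c s) in
  (fun h => h^-1 * (m (t + h) - m t)) @ within S (0 : R)^' --> (0 : R).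
Proof.
move=> pou m.
pose A (i : 'I_P.1) s := rVI (fun x => \1_((P.2 i).1.1) x * ((P.2 i).2 ((P.2 i).1.2 x) *
  c s ((P.2 i).1.2 x) * area_density (theta s \o (P.2 i).1.2) x)).
pose D (i : 'I_P.1) := rVI (fun x => \1_((P.2 i).1.1) x * (area_density (theta t \o (P.2 i).1.2) x *
  dotv (grad_coord (theta t \o (P.2 i).1.2) ((P.2 i).2 \o (P.2 i).1.2) x) (B ((P.2 i).1.2 x)))).
have D0 : \sum_i - D i = 0 by rewrite sumrN; have -> := sum_grad_partition pou ith cB; rewrite oppr0.
have ci i : (fun h => h^-1 * (A i (t + h) - A i t)) @ within S (0 : R)^' --> - D i.
  have [K [cK KU chiK]] := pou_support pou i; have lp := pou_chart pou i.
  apply: (conservation_chart lp cK KU (pou_C2 pou i lp)) => x Ux nK.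
  have [//|hn] := eqVneq ((P.2 i).2 ((P.2 i).1.2 x)) 0.
  by case: nK; apply: (local_param_image_mem lp Ux KU); exact: chiK (local_param_sub lp Ux) hn.
have s : (fun h => \sum_i h^-1 * (A i (t + h) - A i t)) @ within S (0 : R)^' --> \sum_i - D i.
  exact: (@cvg_big_sum _ _ _ (within S (0 : R)^') _ _ _ _ _ ci).
have mE : (fun h => h^-1 * (m (t + h) - m t)) = fun h => \sum_i h^-1 * (A i (t + h) - A i t).
  by apply/funext => h; rewrite -mulr_sumr sumrB.
by rewrite mE; rewrite D0 in s; exact: s.
Qed.

End Conservation.

Theorem theorem3p13 (R : realType) (d : nat) (d_ge1 : (1 <= d)%N)
    (G : R -> R) (G_C3 : Ck_real 3 G)
    (T : R) (T_gt0 : 0 < T)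
    (M : set 'rV[R]_d.+1) (hM : closed_C2_hypersurface M)
    (theta : R -> 'rV[R]_d.+1 -> 'rV[R]_d.+1)
    (htheta : evolving_hypersurface T M theta)
    (nu : R -> 'rV[R]_d.+1 -> 'rV[R]_d.+1)
    (hnu : normal_field T M theta nu)
    (c : R -> 'rV[R]_d.+1 -> R)
    (c_C1C0 : C1_C0 T M c) (c_C0C2 : C0_C2 T M c) :
  let G' := derive1 G in
  let g := fun s => G s - G' s * s in
  let V := normal_velocity T theta nu in
  let H := mean_curvature M theta nu in
  (forall t p, 0 <= t <= T -> M p -> V t p = g (c t p) * H t p) ->
  (forall t p, 0 <= t <= T -> M p ->
     normal_dtime T M theta c t p =
       laplace_beltrami M (theta t) (fun q => G' (c t q)) p
       + c t p * H t p * V t p) ->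
  exists m : R, forall t, 0 <= t <= T ->
    surface_integral M (theta t) (c t) = m.
Proof.
move=> G' g V H hV pde.
exists (surface_integral M (theta 0) (c 0)) => t tT.
(* Either M has a partition of unity, and then [get] returns one, or [surface_integral] is an empty
   sum at every time. *)
have [[P hP]|npou] := pselect (exists P, partition_of_unity M P); last first.
  by rewrite !surface_integral_nopartition// => P hP; apply: npou; exists P.
have pou : partition_of_unity M (get (partition_of_unity M)) by apply: getPex; exists P.
apply: (@derivative0_constant R T (fun s => surface_integral M (theta s) (c s)) T_gt0) tT => s sT.
have key := conservation_derivative G_C3 htheta hnu c_C1C0 c_C0C2 sT (pde s ^~ sT) pou.
rewrite surface_integralE.
have -> : (fun h => h^-1 * (surface_integral M (theta (s + h)) (c (s + h)) -
    partition_integral (get (partition_of_unity M)) (theta s) (c s))) =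
  fun h => h^-1 * (partition_integral (get (partition_of_unity M)) (theta (s + h)) (c (s + h)) -
    partition_integral (get (partition_of_unity M)) (theta s) (c s)).
  by apply/funext => h; rewrite surface_integralE.
exact: key.
Qed.
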